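(* Let $\mathcal{A}$ be an arrangement in $V=\mathbb{K}^\ell$ and $0\le p\le\ell$, and assume $D^p(\mathcal{A})$ is a free $S$-module. Let $H\in\mathcal{A}$ and $\mathcal{A}'=\mathcal{A}\setminus\{H\}$. If $D^p(\mathcal{A}')$ is not free, then there exist $\varphi_1,\dots,\varphi_s\in D^p(\mathcal{A}')$ such that $\overline{\partial^p}(\varphi_1),\dots,\overline{\partial^p}(\varphi_s)$ form a minimal set of generators of $D^{p-1}(\mathcal{A}^H)\overline{B}$ and $$D^p(\mathcal{A}')=D^p(\mathcal{A})+\sum_{i=1}^sS\varphi_i;$$ moreover $\operatorname{pd}_SD^p(\mathcal{A}')=\operatorname{pd}_{\overline{S}}D^{p-1}(\mathcal{A}^H)+1$. In particular, if $D^p(\mathcal{A})$ and $D^{p-1}(\mathcal{A}^H)$ are both free, then $\operatorname{pd}_SD^p(\mathcal{A}\setminus\{H\})\le1$.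
   Context: $\mathbb{K}$ a field, $S=\mathbb{K}[x_1,\dots,x_\ell]$. For an arrangement (finite set of linear hyperplanes) $\mathcal{A}$, $\alpha_H$ is a defining linear form, $Q(\mathcal{A})=\prod\alpha_H$. $\operatorname{Der}^pS=\wedge^p_S\operatorname{Der}S$, elements viewed as alternating multiderivations $S^p\to S$; $D^p(\mathcal{A})=\{\theta\in\operatorname{Der}^pS:\theta(\alpha_H,f_2,\dots,f_p)\in\alpha_HS\ \forall H\in\mathcal{A},f_j\in S\}$, $D^0=S$. $\overline{S}=S/\alpha_HS$; $\mathcal{A}^H=\{L\cap H:L\in\mathcal{A}'\}$ with $D^q(\mathcal{A}^H)\subset\wedge^q\operatorname{Der}\overline{S}$ analogous, $D^{-1}(\mathcal{A}^H)=0$. $\overline{B}=\overline{Q(\mathcal{A}')}/Q(\mathcal{A}^H)\in\overline{S}$, where $Q(\mathcal{A}^H)$ is the product of defining forms of $\mathcal{A}^H$. $\overline{\partial^p}:D^p(\mathcal{A}')\to D^{p-1}(\mathcal{A}^H)\overline{B}$, $\overline{\partial^p}(\theta)(\overline{f_2},\dots,\overline{f_p})=\overline{\theta(\alpha_H,f_2,\dots,f_p)}$ ($\overline{\partial^0}=0$); its kernel is $D^p(\mathcal{A})$. *)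

(* Defs.v *)
From HB Require Import structures.
From mathcomp Require Import all_boot all_order all_algebra.
From mathcomp Require Import finmap.
From mathcomp Require Import boolp classical_sets functions.
From mathcomp Require Import mpoly.

Set Implicit Arguments.
Unset Strict Implicit.
Unset Printing Implicit Defensive.

Import GRing.Theory.
Local Open Scope ring_scope.
Local Open Scope quotient_scope.

Section Modules.
Context (R : nzRingType).
Implicit Types (V M : lmodType R).

Record submod V (N : submodClosed V) :=
  Submod { submod_val : V; _ : submod_val \in N }.

HB.instance Definition _ V (N : submodClosed V) :=
  [isSub for @submod_val V N].
HB.instance Definition _ V (N : submodClosed V) := [Choice of submod N by <:].
HB.instance Definition _ V (N : submodClosed V) :=
  [SubChoice_isSubLmodule of submod N by <:].

Definition basis M (I : eqType) (b : I -> M) : Prop :=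
  (forall (s : seq I) (c : I -> R), uniq s ->
     \sum_(i <- s) c i *: b i = 0 -> forall i, i \in s -> c i = 0) /\
  (forall x : M, exists (s : seq I) (c : I -> R), x = \sum_(i <- s) c i *: b i).

Definition free_module M : Prop := exists (I : eqType) (b : I -> M), basis b.

Definition projective (P : lmodType R) : Prop :=
  forall (X Y : lmodType R) (g : {linear X -> Y}) (f : {linear P -> Y}),
    (forall y, exists x, g x = y) ->
    exists h : {linear P -> X}, forall x, g (h x) = f x.

(* A resolution 0 -> P_n -> ... -> P_0 -> M -> 0, padded with P_i = 0 beyond n. *)
Definition projective_resolution M (n : nat) (P : nat -> lmodType R)
    (d : forall i, {linear P i.+1 -> P i}) (eps : {linear P 0%N -> M}) : Prop :=
  [/\ forall i, projective (P i),
      forall i, (n < i)%N -> forall x : P i, x = 0,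
      forall y, exists x, eps x = y,
      forall x, eps x = 0 <-> exists y, d 0%N y = x
    & forall i x, d i x = 0 <-> exists y, d i.+1 y = x].

Definition has_projective_resolution M (n : nat) : Prop :=
  exists (P : nat -> lmodType R) (d : forall i, {linear P i.+1 -> P i})
    (eps : {linear P 0%N -> M}), projective_resolution n d eps.

(* The projective dimension, with None standing for infinity; the zero module *)
(* gets dimension 0. *)
Definition pd M : option nat :=
  match pselect (exists n, `[< has_projective_resolution M n >]) with
  | left ex_n => Some (ex_minn ex_n)
  | right _ => None
  end.

Definition span_of V (s : nat) (b : 'I_s -> V) (J : {set 'I_s}) (x : V) : Prop :=
  exists c : 'I_s -> R, x = \sum_(i in J) c i *: b i.

Definition generates V (N : V -> Prop) (s : nat) (b : 'I_s -> V)
    (J : {set 'I_s}) : Prop :=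
  forall x, N x <-> span_of b J x.

Definition minimal_generators V (N : V -> Prop) (s : nat) (b : 'I_s -> V) :
    Prop :=
  generates N b [set: 'I_s] /\
  (forall J : {set 'I_s}, generates N b J -> J = [set: 'I_s]).

End Modules.

Section Multiderivations.
Context (K : fieldType) (R : comAlgType K).

Definition derivation (d : R -> R) : Prop :=
  linear d /\ forall f g, d (f * g) = d f * g + f * d g.

Definition wedge (p : nat) (d : 'I_p -> R -> R) : ('I_p -> R) -> R^o :=
  fun f => \det (\matrix_(i, j) d i (f j)).

(* The p-th exterior power of Der R, realized inside the R-module of all maps *)
(* R^p -> R through (d_1 /\ ... /\ d_p)(f_1, ..., f_p) = det (d_i f_j). *)
Definition is_Der (p : nat) (theta : ('I_p -> R) -> R^o) : Prop :=
  exists (n : nat) (c : 'I_n -> R) (d : 'I_n -> 'I_p -> R -> R),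
    (forall k i, derivation (d k i)) /\
    theta = \sum_(k < n) c k *: wedge (d k).

(* D^p for the forms listed in s: theta (a, f_2, ..., f_p) is divisible by a *)
(* for every a in s. For p = 0 there is no first argument, so D^0 = R. *)
Definition is_logder (p : nat) (s : seq R) (theta : ('I_p -> R) -> R^o) : Prop :=
  is_Der theta /\
  forall a, a \in s -> forall (f : 'I_p -> R) (i : 'I_p),
    val i = 0%N -> f i = a -> exists g, theta f = g * a.

Definition D (p : nat) (s : seq R) : {pred ('I_p -> R) -> R^o} :=
  fun theta => `[< is_logder s theta >].
Arguments D : clear implicits.

(* D^(p-1), with D^(-1) = 0. *)
Definition Dprev (p : nat) (s : seq R) : {pred ('I_p.-1 -> R) -> R^o} :=
  fun theta => if p is 0%N then theta == 0 else theta \in D p.-1 s.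
Arguments Dprev : clear implicits.

Lemma is_Der0 p : is_Der (0 : ('I_p -> R) -> R^o).
Proof.
exists 0%N, (fun _ => 0), (fun _ _ _ => 0); split; last by rewrite big_ord0.
by case.
Qed.

Lemma is_DerZD p (a : R) (t u : ('I_p -> R) -> R^o) :
  is_Der t -> is_Der u -> is_Der (a *: t + u).
Proof.
move=> [m [c [d [hd ->]]]] [n [e [h [hh ->]]]].
pose k (T : Type) (x : 'I_m -> T) (y : 'I_n -> T) (i : 'I_(m + n)) : T :=
  match fintype.split i with inl j => x j | inr j => y j end.
exists (m + n)%N, (k _ (fun j => a * c j) e), (k _ d h); split.
  by move=> i; rewrite /k; case: (fintype.split i).
rewrite big_split_ord /= scaler_sumr; congr (_ + _); apply: eq_bigr => i _.
  by rewrite /k (unsplitK (inl i)) scalerA.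
by rewrite /k (unsplitK (inr i)).
Qed.

Fact D_submod_closed p s : submod_closed (D p s).
Proof.
split=> [|a t u /asboolP[dt ht] /asboolP[du hu]]; apply/asboolP; split.
- exact: is_Der0.
- by move=> a _ f i _ _; exists 0; rewrite mul0r.
- exact: is_DerZD.
move=> b bs f i i0 fi; have [g tg] := ht b bs f i i0 fi.
have [h uh] := hu b bs f i i0 fi; exists (a * g + h).
by rewrite mulrDl -mulrA -tg -uh.
Qed.

HB.instance Definition _ p s :=
  GRing.isSubmodClosed.Build R (('I_p -> R) -> R^o) (D p s) (D_submod_closed p s).

Fact Dprev_submod_closed p s : submod_closed (Dprev p s).
Proof.
case: p => [|p]; last exact: D_submod_closed.
split=> [|a t u]; first exact: eqxx.
by move=> /eqP-> /eqP->; rewrite scaler0 addr0; exact: eqxx.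
Qed.

HB.instance Definition _ p s :=
  GRing.isSubmodClosed.Build R (('I_p.-1 -> R) -> R^o) (Dprev p s)
    (Dprev_submod_closed p s).

End Multiderivations.

Arguments D {K R} p s.
Arguments Dprev {K R} p s.

Section Quotient.
Context (K : fieldType) (l : nat).
Local Notation S := {mpoly K[l]}.

Definition linform := dhomog l K 1.

Context (a : linform).

Definition principal : {pred S} := fun f => `[< exists g, f = g * (a : S) >].

Fact principal_idealr : idealr_closed principal.
Proof.
split.
- by apply/asboolP; exists 0; rewrite mul0r.
- apply/asboolP => -[g /(congr1 (meval (fun _ => 0)))].
  have a0 : (a : S).@[fun _ => 0] = 0.
    rewrite mevalE big_seq big1 // => m ma.
    have := dhomogP _ _ _ (dhomog_is_dhomog a) m ma.
    have [/existsP[i im] _|] := boolP [exists i, m i != 0%N]; last first.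
      rewrite negb_exists => /forallP m0 /= /eqP.
      by rewrite mdegE big1 // => i _; apply/eqP; move: (m0 i); rewrite negbK.
    by rewrite (bigD1 i) //= expr0n (negPf im) mul0r mulr0.
  by rewrite meval1 mevalM a0 mulr0 => /eqP; rewrite oner_eq0.
move=> c f g /asboolP[x ->] /asboolP[y ->]; apply/asboolP.
by exists (c * x + y); rewrite mulrDl mulrA.
Qed.

HB.instance Definition _ := isIdealr.Build S principal principal_idealr.

Definition Sbar := {ideal_quot principal}.
HB.instance Definition _ := EqQuotient.on Sbar.
HB.instance Definition _ := GRing.ComNzRing.on Sbar.

Definition proj (f : S) : Sbar := \pi_(Sbar) f.

Lemma projE : proj = \pi_({ideal_quot principal}). Proof. by []. Qed.

Fact proj_is_zmod_morphism : zmod_morphism proj.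
Proof. by rewrite projE; exact: rmorphB. Qed.
Fact proj_is_monoid_morphism : monoid_morphism proj.
Proof. by rewrite projE; split; [exact: rmorph1 | exact: rmorphM]. Qed.
HB.instance Definition _ :=
  GRing.isZmodMorphism.Build S Sbar proj proj_is_zmod_morphism.
HB.instance Definition _ :=
  GRing.isMonoidMorphism.Build S Sbar proj proj_is_monoid_morphism.

Lemma proj_repr (x : Sbar) : proj (repr x) = x. Proof. exact: reprK. Qed.

Lemma proj_eq0 f : proj f = 0 <-> exists g, f = g * (a : S).
Proof.
rewrite -(rmorph0 proj) projE; split.
  by move=> /eqP; rewrite -Quotient.idealrBE subr0 => /asboolP.
by move=> fa; apply/eqP; rewrite -Quotient.idealrBE subr0; apply/asboolP.
Qed.

Definition Sbar_scale (c : K) (x : Sbar) : Sbar := proj c%:MP * x.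

Fact Sbar_scaleA c d x : Sbar_scale c (Sbar_scale d x) = Sbar_scale (c * d) x.
Proof. by rewrite /Sbar_scale mpolyCM rmorphM mulrA. Qed.
Fact Sbar_scale1 : left_id 1 Sbar_scale.
Proof. by move=> x; rewrite /Sbar_scale mpolyC1 rmorph1 mul1r. Qed.
Fact Sbar_scaleDr : right_distributive Sbar_scale +%R.
Proof. by move=> c x y; rewrite /Sbar_scale mulrDr. Qed.
Fact Sbar_scaleDl x : {morph Sbar_scale^~ x : c d / c + d}.
Proof. by move=> c d; rewrite /Sbar_scale mpolyCD rmorphD mulrDl. Qed.
HB.instance Definition _ := GRing.Zmodule_isLmodule.Build K Sbar
  Sbar_scaleA Sbar_scale1 Sbar_scaleDr Sbar_scaleDl.
Fact Sbar_scaleAl c (x y : Sbar) : c *: (x * y) = c *: x * y.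
Proof. exact: mulrA. Qed.
HB.instance Definition _ :=
  GRing.Lmodule_isLalgebra.Build K Sbar Sbar_scaleAl.
HB.instance Definition _ := GRing.Lalgebra_isComAlgebra.Build K Sbar.

Definition cons_arg (T : Type) (q : nat) (x : T) (f : 'I_q -> T) :
    'I_q.+1 -> T :=
  fun i => oapp f x (unlift ord0 i).

(* The choice of the representatives repr (g j) is immaterial, see dbarE. *)
Definition dbar (p : nat) :
    (('I_p -> S) -> S^o) -> (('I_p.-1 -> Sbar) -> Sbar^o) :=
  match p with
  | 0%N => fun _ => 0
  | q.+1 => fun theta g =>
      proj (theta (cons_arg (a : S) (fun j => repr (g j))))
  end.

Lemma dbarE (q : nat) (theta : ('I_q.+1 -> S) -> S^o) (f : 'I_q -> S) :
  is_Der theta ->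
  dbar theta (fun j => proj (f j)) = proj (theta (cons_arg (a : S) f)).
Proof.
move=> [n [c [d [hd ->]]]]; rewrite /dbar.
rewrite !fct_sumE !rmorph_sum /=; apply: eq_bigr => k _.
rewrite !rmorphM; congr (_ * _).
rewrite /wedge -!det_map_mx.
have fg j : exists g, repr (proj (f j)) = f j + g * (a : S).
  have /proj_eq0[g hg] : proj (repr (proj (f j)) - f j) = 0.
    by rewrite rmorphB /= proj_repr subrr.
  by exists g; rewrite -hg addrC subrK.
have /choice[g hg] := fg.
pose T : 'M[Sbar]_q.+1 := \matrix_(i, j)
  ((i == j)%:R + (if j == ord0 then 0 else (i == ord0)%:R * proj (cons_arg 0 g j))).
have dT : \det T = 1.
  rewrite -det_tr det_trig; last first.
    apply/is_trig_mxP => i j ij; rewrite !mxE.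
    case: eqVneq => [e|_]; first by rewrite e ltnn in ij.
    case: ifP => [_|_]; first by rewrite addr0.
    case: eqVneq => [j0|_]; first by rewrite j0 in ij.
    by rewrite mul0r addr0.
  rewrite big1 // => i _; rewrite !mxE eqxx; case: ifPn => [_|/negPf->].
    by rewrite addr0.
  by rewrite mul0r addr0.
rewrite -[RHS]mulr1 -dT -det_mulmx; congr (\det _).
apply/matrixP => i j; rewrite !mxE; under eq_bigr do rewrite !mxE.
case: (hd k i) => dlin dmul.
pose w := cons_arg (a : S) f.
rewrite -/w.
transitivity (proj (d k i (w j)) +
  (if j == ord0 then 0 else proj (d k i (w ord0)) * proj (cons_arg 0 g j))).
  rewrite /w /cons_arg; case: (unliftP ord0 j) => [j' ->|->] /=.
    rewrite unlift_none /= hg.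
    have dD x y : d k i (x + y) = d k i x + d k i y.
      by rewrite -[x]scale1r dlin !scale1r.
    rewrite dD dmul !rmorphD !rmorphM /=.
    have -> : proj (a : S) = 0 by apply/proj_eq0; exists 1; rewrite mul1r.
    by rewrite mulr0 add0r mulrC.
  by rewrite addr0.
under eq_bigr do rewrite mulrDr.
rewrite big_split /=; congr (_ + _).
  rewrite (bigD1 j) //= eqxx mulr1 big1 ?addr0 // => x /negPf->.
  by rewrite mulr0.
case: ifP => _; first by rewrite big1 // => x _; rewrite mulr0.
rewrite (bigD1 ord0) //= mul1r big1 ?addr0 // => x /negPf->.
by rewrite mul0r mulr0.
Qed.

End Quotient.

Arguments dbar {K l} a {p} theta _.

Section Arrangements.
Context (K : fieldType) (l : nat).
Local Notation subspace := {vspace 'rV[K]_l}.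
Local Notation S := {mpoly K[l]}.
Implicit Types (A : {fset subspace}) (H X : subspace).

Definition arrangement A : Prop := forall H, H \in A -> (\dim H).+1 = l.

Definition defining_form H (a : linform K l) : Prop :=
  forall v : 'rV[K]_l, v \in H <-> (a : S).@[fun i => v 0 i] = 0.

(* A^H; its members are recorded as subspaces of K^l contained in H. *)
Definition restriction A H : {fset subspace} :=
  [fset (L :&: H)%VS | L in (A `\ H)%fset]%fset.

(* The degree 1 part of Sbar = S / aS is the dual of H when a defines H, so a *)
(* defining form of a hyperplane X of H is the class of a linear form of K^l  *)
(* cutting out X in H. *)
Definition defining_form_in H (a : linform K l) X (b : Sbar a) : Prop :=
  exists2 c : linform K l, b = proj a c &
    forall v : 'rV[K]_l, v \in H -> (v \in X <-> (c : S).@[fun i => v 0 i] = 0).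

Definition forms (R : nzRingType) (alpha : subspace -> R) A : seq R :=
  [seq alpha L | L <- A].

Definition Q (R : comNzRingType) (alpha : subspace -> R) A : R :=
  \prod_(L <- A) alpha L.

(* The unique B with B * Q(A^H) = Q(A') in the domain Sbar. *)
Definition Bbar (alpha : subspace -> linform K l) H
    (beta : subspace -> Sbar (alpha H)) A : Sbar (alpha H) :=
  xget 0 (fun B => B * Q beta (restriction A H) =
                   proj (alpha H) (Q (fun L => (alpha L : S)) (A `\ H)%fset)).

End Arrangements.

(* Main.v *)
(* Write S for the polynomial ring, Sbar = S / a S with a = alpha H, A' = A \ H.
   The boundary map maps D^p(A') into Bbar D^(p-1)(A^H) with kernel D^p(A).

   It is onto as soon as D^p(A) is free. For X in A^H put f_X = prod_(Y <> X) beta_Y.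
   Choosing L0 in A' with L0 /\ H = X and a vector w in L0 with a(w) = 1, the
   multiderivation prod_(L <> L0) alpha_L * (d_w /\ eta~), for a lift eta~ of eta,
   shows that f_X psi is in the image for every psi = Bbar eta, say
   f_X psi = dbar(theta_X). In a basis of D^p(A) the coordinates c_X of
   a theta_X satisfy f_Y c_X = f_X c_Y modulo a; as the beta_X are pairwise
   non-associated primes of the domain Sbar, c_X = f_X v modulo a. The element of
   D^p(A) with coordinates v is divisible by a, and its quotient by a is a
   preimage of psi in D^p(A').

   The resulting exact sequence 0 -> D^p(A) -> D^p(A') -> D^(p-1)(A^H) -> 0 gives the
   generators, and pd D^p(A') <= n + 1 iff pd_S D^(p-1)(A^H) <= n + 1. Since
   S -> Sbar has a section, the latter is equivalent to
   pd_Sbar D^(p-1)(A^H) <= n. Finally, D^p(A') is graded and finitely generated,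
   so it is not projective when it is not free. *)

(* That the boundary map lands in Bbar D^(p-1)(A^H) is a count of prime factors. Suppose m
   hyperplanes of A' cut H in X, and fix one of them, L0. Every other alpha_L is a combination of
   alpha_L0 and a with a nonzero coefficient at a, so theta(a, ...) is, up to a multiple of a,
   divisible by the other m - 1 forms. This gives beta_X^(m-1) modulo a, and Bbar is the product of
   these powers up to a nonzero constant. When beta_X is a further argument, alternation supplies
   the missing m-th factor, which is the logarithmic condition along X. Surjectivity compares
   coordinates of a theta_X because theta_X itself need not lie in D^p(A); the price is the final
   division by a. The quotient stays logarithmic along L because alpha_L does not divide f_X for X =
   L /\ H. The exact sequence compares dimensions only from 1 upwards. Non-freeness of D^p(A')
   enters the dimension formula just to exclude dimension 0, and a graded form of Nakayama's lemma
   is what turns projective into free. *)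
Require Import Defs.
From HB Require Import structures.
From mathcomp Require Import all_boot all_order all_algebra.
From mathcomp Require Import perm.
From mathcomp Require Import finmap.
From mathcomp Require Import boolp classical_sets functions.
From mathcomp Require Import mpoly.

Set Implicit Arguments.
Unset Strict Implicit.
Unset Printing Implicit Defensive.

Import GRing.Theory.
Local Open Scope ring_scope.

(** * Projective modules and projective dimension *)

Section LinearMaps.
Context (R : nzRingType).
Implicit Types (U V W : lmodType R).

(** The proof of linearity is a phantom argument, from which the bundled linear structure is
    inferred. *)
Definition lin_of U V (f : U -> V) of linear f := f.
HB.instance Definition _ U V (f : U -> V) (hf : linear f) :=
  GRing.isLinear.Build R U V *:%R (lin_of hf) hf.

Definition kerp U V (f : {linear U -> V}) : {pred U} := fun x => f x == 0.

Fact kerp_submod_closed U V (f : {linear U -> V}) : submod_closed (kerp f).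
Proof.
split=> [|a x y]; rewrite -!topredE /= /kerp ?linear0 //.
by move=> /eqP fx /eqP fy; rewrite linearP fx fy scaler0 addr0.
Qed.
HB.instance Definition _ U V (f : {linear U -> V}) :=
  GRing.isSubmodClosed.Build R U (kerp f) (kerp_submod_closed f).

Lemma kerpP U V (f : {linear U -> V}) x : reflect (f x = 0) (x \in kerp f).
Proof. exact: eqP. Qed.

Lemma submod_valP V (N : submodClosed V) (x : submod N) : submod_val x \in N.
Proof. by case: x. Qed.

Lemma submod_inj V (N : submodClosed V) : injective (@submod_val R V N).
Proof. exact: val_inj. Qed.

Fact submod_val_linear V (N : submodClosed V) : linear (@submod_val R V N).
Proof. by []. Qed.

Fact corestrict_linear U V (N : submodClosed V) (f : {linear U -> V})
  (hf : forall x, f x \in N) : linear (fun x => Submod (hf x)).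
Proof. by move=> a x y; apply: submod_inj; rewrite /= linearP. Qed.

Lemma submod_valD V (N : submodClosed V) (x y : submod N) :
  submod_val (x + y) = submod_val x + submod_val y.
Proof. by []. Qed.
Lemma submod_valB V (N : submodClosed V) (x y : submod N) :
  submod_val (x - y) = submod_val x - submod_val y.
Proof. by []. Qed.
Lemma submod_valZ V (N : submodClosed V) c (x : submod N) :
  submod_val (c *: x) = c *: submod_val x.
Proof. by []. Qed.

Lemma fct_scaleE (T : Type) (c : R) (F : T -> R^o) x : (c *: F) x = c * F x.
Proof. by []. Qed.

Definition incl V (N : submodClosed V) : {linear submod N -> V} :=
  lin_of (@submod_val_linear V N).

Definition corestrict U V (N : submodClosed V) (f : {linear U -> V}) hf :
  {linear U -> submod N} := lin_of (@corestrict_linear U V N f hf).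

Lemma linear_inj U V (f : {linear U -> V}) :
  (forall x, f x = 0 -> x = 0) -> injective f.
Proof.
by move=> f0 x y fxy; apply/subr0_eq/f0; rewrite linearB fxy subrr.
Qed.

Fact inverse_linear U V (f : {linear U -> V}) (g : V -> U) :
  injective f -> cancel g f -> linear g.
Proof. by move=> fI gK a x y; apply: fI; rewrite linearP !gK. Qed.

Definition surj (U V : Type) (f : U -> V) : Prop := forall y, exists x, f x = y.

Lemma linear_inverse U V (f : {linear U -> V}) :
  injective f -> surj f ->
  exists g : {linear V -> U}, cancel g f /\ cancel f g.
Proof.
move=> fI /choice[g gK]; exists (lin_of (inverse_linear fI gK)); split=> // x.
exact/fI/gK.
Qed.

Fact fst_linear U V : linear (fst : (U * V)%type -> U). Proof. by []. Qed.
Fact snd_linear U V : linear (snd : (U * V)%type -> V). Proof. by []. Qed.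
Fact pair0_linear U V : linear (fun x : U => (x, 0 : V)).
Proof. by move=> a x y; congr pair; rewrite /= scaler0 addr0. Qed.
Fact pair1_linear U V : linear (fun y : V => (0 : U, y)).
Proof. by move=> a x y; congr pair; rewrite /= scaler0 addr0. Qed.
Fact copair_linear U V W (f : {linear U -> W}) (g : {linear V -> W}) :
  linear (fun x : (U * V)%type => f x.1 + g x.2).
Proof. by move=> a x y; rewrite /= !linearP scalerDr addrACA. Qed.
Fact pairf_linear U V W (f : {linear W -> U}) (g : {linear W -> V}) :
  linear (fun x => (f x, g x)).
Proof. by move=> a x y; rewrite !linearP. Qed.

Definition lfst U V : {linear (U * V)%type -> U} := lin_of (@fst_linear U V).
Definition lsnd U V : {linear (U * V)%type -> V} := lin_of (@snd_linear U V).
Definition linl U V : {linear U -> (U * V)%type} := lin_of (@pair0_linear U V).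
Definition linr U V : {linear V -> (U * V)%type} := lin_of (@pair1_linear U V).
Definition copair U V W (f : {linear U -> W}) (g : {linear V -> W}) :
  {linear (U * V)%type -> W} := lin_of (copair_linear f g).
Definition pairf U V W (f : {linear W -> U}) (g : {linear W -> V}) :
  {linear W -> (U * V)%type} := lin_of (pairf_linear f g).

Definition ses U V W (i : {linear U -> V}) (e : {linear V -> W}) : Prop :=
  [/\ injective i, surj e & forall x, e x = 0 <-> exists y, i y = x].

Lemma ses_ker U V (e : {linear U -> V}) : surj e -> ses (incl (kerp e)) e.
Proof.
move=> eS; split=> // [|x]; first exact: val_inj.
split=> [ex|[y <-]]; last exact/kerpP/submod_valP.
have xk : x \in kerp e by apply/kerpP.
by exists (Submod xk).
Qed.

End LinearMaps.

(** * Projective modules, split sequences and bases *)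

Section Projective.
Context (R : nzRingType).
Implicit Types (P U V W M X Y Z : lmodType R).

Lemma projective_retract P M (r : {linear P -> M}) (i : {linear M -> P}) :
  projective P -> cancel i r -> projective M.
Proof.
move=> pP iK X Y g f gS; have [h hE] := pP X Y g (f \o r) gS.
by exists (h \o i) => x /=; rewrite hE /= iK.
Qed.

Lemma projective_iso P M (f : {linear P -> M}) :
  injective f -> surj f -> projective P -> projective M.
Proof.
move=> fI fS pP; have [g [gK _]] := linear_inverse fI fS.
exact: projective_retract pP gK.
Qed.

Lemma projective_prod P M : projective P -> projective M -> projective (P * M)%type.
Proof.
move=> pP pM X Y g f gS.
have [h hE] := pP X Y g (f \o linl _ _) gS.
have [k kE] := pM X Y g (f \o linr _ _) gS.
exists (copair h k) => -[x y]; rewrite linearD /= hE kE /= -linearD /=.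
by congr (f (_, _)); rewrite ?addr0 ?add0r.
Qed.

Lemma projective_zero M : (forall x : M, x = 0) -> projective M.
Proof.
move=> M0 X Y g f _; have zl : linear (fun _ : M => 0 : X).
  by move=> a x y; rewrite scaler0 addr0.
by exists (lin_of zl) => x; rewrite (M0 x) !linear0.
Qed.

Lemma ses_split U V W (i : {linear U -> V}) (e : {linear V -> W}) :
  projective W -> ses i e -> exists s : {linear W -> V}, cancel s e.
Proof. by move=> pW [_ eS _]; have [s sE] := pW V W e idfun eS; exists s. Qed.

Lemma ses_retraction U V W (i : {linear U -> V}) (e : {linear V -> W})
    (s : {linear W -> V}) :
  ses i e -> cancel s e ->
  exists r : {linear V -> U},
    [/\ cancel i r, forall x, r (s x) = 0 & forall x, x = i (r x) + s (e x)].
Proof.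
move=> [iI eS eK] sK.
have ex x : exists y, i y = x - s (e x).
  by apply/eK; rewrite linearB sK subrr.
have [r rE] := choice ex.
have rl : linear r.
  move=> a x y; apply: iI; rewrite linearP !rE !linearP.
  by rewrite /= addrACA -scalerDr.
exists (lin_of rl); split=> x; rewrite /lin_of.
- have ei : e (i x) = 0 by apply/eK; exists x.
  by apply: iI; rewrite rE ei linear0 subr0.
- by apply: iI; rewrite rE sK subrr linear0.
- by rewrite rE subrK.
Qed.

(** Both sums reduce to the indices with nonzero coefficient, so the list carrying a finitely
    supported combination is immaterial. *)
Lemma sum_supp (I : eqType) (X : lmodType R) (c : I -> R) (v : I -> X)
    (s t : seq I) : uniq s -> uniq t ->
  (forall i, i \notin s -> c i = 0) -> (forall i, i \notin t -> c i = 0) ->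
  \sum_(i <- s) c i *: v i = \sum_(i <- t) c i *: v i.
Proof.
move=> us ut sz tz.
have red (r : seq I) : \sum_(i <- r) c i *: v i
    = \sum_(i <- r | c i != 0) c i *: v i.
  rewrite [LHS](bigID (fun i => c i != 0)) /= [X in _ + X]big1 ?addr0 //.
  by move=> i /negPn/eqP->; rewrite scale0r.
rewrite red [RHS]red -big_filter -[RHS]big_filter; apply: perm_big.
apply: uniq_perm; rewrite ?filter_uniq // => i.
rewrite !mem_filter; have [//|/= nz] := eqVneq (c i) 0.
have -> : i \in s by apply: contraT => /sz/eqP; rewrite (negPf nz).
by have -> : i \in t by apply: contraT => /tz/eqP; rewrite (negPf nz).
Qed.

Section Basis.
Context (M : lmodType R) (I : eqType) (b : I -> M) (bB : Defs.basis b).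

Lemma basis_coords (x : M) : exists co : I -> R, exists2 s : seq I, uniq s &
  (forall i, i \notin s -> co i = 0) /\ x = \sum_(i <- s) co i *: b i.
Proof.
have [s [c ->]] := bB.2 x.
(* The spanning list may repeat an index; its coefficient is then counted with multiplicity. *)
exists (fun i => c i *+ count_mem i s), (undup s); first exact: undup_uniq.
split=> [i|]; first by rewrite mem_undup => /count_memPn->.
rewrite -big_undup_iterop_count; apply: eq_bigr => i _.
by rewrite Monoid.iteropE iter_addr addr0 scalerMnl.
Qed.

Lemma basis_sum_eq (s t : seq I) (c d : I -> R) : uniq s -> uniq t ->
  (forall i, i \notin s -> c i = 0) -> (forall i, i \notin t -> d i = 0) ->
  \sum_(i <- s) c i *: b i = \sum_(i <- t) d i *: b i -> c =1 d.
Proof.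
case: bB => ind _ us ut cs dt cd i.
pose u := undup (s ++ t).
have uu : uniq u by exact: undup_uniq.
have uP j : j \notin u -> c j = 0 /\ d j = 0.
  by rewrite mem_undup mem_cat negb_or => /andP[/cs-> /dt->].
have [iu|/uP[-> ->]//] := boolP (i \in u).
apply/subr0_eq/(ind u (fun i => c i - d i) uu) => //.
under eq_bigr do rewrite scalerBl.
rewrite sumrB (sum_supp b uu us) ?(sum_supp b uu ut) ?cd ?subrr //.
  by move=> j /uP[].
by move=> j /uP[].
Qed.

(** The value at x is specified against every duplicate-free list containing the support, so that
    sums for x, y and a x + y can be compared over one common list. *)
Lemma basis_lift (X : lmodType R) (v : I -> X) :
  exists h : {linear M -> X}, forall i, h (b i) = v i.
Proof.
have [co coP] := choice basis_coords.
have ex x : exists y, forall (s : seq I), uniq s ->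
    (forall i, i \notin s -> co x i = 0) -> y = \sum_(i <- s) co x i *: v i.
  have [s us [sz _]] := coP x; exists (\sum_(i <- s) co x i *: v i) => t ut tz.
  exact: sum_supp.
have [h hE] := choice ex.
have coE x (t : seq I) (d : I -> R) : uniq t -> (forall i, i \notin t -> d i = 0) ->
    x = \sum_(i <- t) d i *: b i -> co x =1 d.
  move=> ut dt xE; have [s us [sz sE]] := coP x.
  by apply: (basis_sum_eq us ut sz dt); rewrite -sE.
have hl : linear h.
  move=> a x y.
  have [s us [sz sE]] := coP x; have [t ut [tz tE]] := coP y.
  pose u := undup (s ++ t).
  have uu : uniq u by exact: undup_uniq.
  have ux i : i \notin u -> co x i = 0.
    by rewrite mem_undup mem_cat negb_or => /andP[/sz].
  have uy i : i \notin u -> co y i = 0.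
    by rewrite mem_undup mem_cat negb_or => /andP[_ /tz].
  have E : co (a *: x + y) =1 (fun i => a * co x i + co y i).
    apply: (coE _ u) => // [i iu|]; first by rewrite ux // uy // mulr0 addr0.
    rewrite {1}sE {1}tE (sum_supp b us uu) ?(sum_supp b ut uu) //.
    rewrite scaler_sumr -big_split /=; apply: eq_bigr => i _.
    by rewrite scalerDl scalerA.
  rewrite (hE _ u) //; last by move=> i iu; rewrite E ux // uy // mulr0 addr0.
  rewrite (hE x u) ?(hE y u) // scaler_sumr -big_split /=; apply: eq_bigr => i _.
  by rewrite E scalerDl scalerA.
exists (lin_of hl) => i; rewrite -[LHS]/(h (b i)).
have E : co (b i) =1 (fun j => (j == i)%:R).
  apply: (coE _ [:: i]) => // [j|]; first by rewrite inE => /negPf->.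
  by rewrite big_seq1 eqxx scale1r.
rewrite (hE _ [:: i]) // ?big_seq1 ?E ?eqxx ?scale1r // => j.
by rewrite inE E => /negPf->.
Qed.

(** The coordinate functionals are the lifts of the Kronecker deltas; the support stays a list
    because the basis may be infinite. *)
Lemma basis_coord_forms : exists h : I -> {linear M -> R^o},
  forall x, exists2 s : seq I, uniq s &
    (forall i, i \notin s -> h i x = 0) /\ x = \sum_(i <- s) h i x *: b i.
Proof.
have [h hE] := choice (fun i => basis_lift (fun j => (j == i)%:R : R^o)).
exists h => x; have [c [s us [cz cE]]] := basis_coords x.
have hx i : h i x = c i.
  rewrite cE linear_sum; have [is_|is_] := boolP (i \in s).
    rewrite (bigD1_seq i) //= linearZ_LR hE eqxx big1 => [|j ji].
      by rewrite addr0 -[LHS]/(c i * 1) mulr1.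
    by rewrite linearZ_LR hE (negPf ji) scaler0.
  rewrite cz // big_seq big1 // => j js; rewrite linearZ_LR hE.
  by case: eqVneq => [ji|]; rewrite ?scaler0 //; rewrite -ji js in is_.
exists s => //; split=> [i /cz|]; first by rewrite hx.
by rewrite {1}cE; apply: eq_bigr => i _; rewrite hx.
Qed.

Lemma basis_projective : projective M.
Proof.
move=> X Y g f gS; have [v vE] := choice (fun i => gS (f (b i))).
have [h hE] := basis_lift v; exists h => x.
have [s [c ->]] := bB.2 x; rewrite !linear_sum; apply: eq_bigr => i _.
by rewrite !linearZ /= hE vE.
Qed.

End Basis.

Lemma free_module_projective M : free_module M -> projective M.
Proof. by case=> I [b bB]; exact: basis_projective bB. Qed.

End Projective.

(** * Free modules as finitely supported functions *)

Section FreeOn.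
Context (R : nzRingType) (T : choiceType).

Definition finsupp_pred : {pred T -> R^o} :=
  fun f => `[< exists s : seq T, forall x, x \notin s -> f x = 0 >].

Fact finsupp_submod_closed : submod_closed finsupp_pred.
Proof.
split=> [|a f g /asboolP[s sf] /asboolP[t tg]]; apply/asboolP; first by exists [::].
exists (s ++ t) => x; rewrite mem_cat negb_or => /andP[xs xt].
by rewrite -[LHS]/(a *: f x + g x) sf // tg // scaler0 addr0.
Qed.
HB.instance Definition _ :=
  GRing.isSubmodClosed.Build R (T -> R^o) finsupp_pred finsupp_submod_closed.

Local Notation free_on := (submod finsupp_pred).

Lemma free_scaleE (c : R) (x : free_on) t :
  submod_val (c *: x) t = c * submod_val x t.
Proof. by []. Qed.
Lemma free_addE (x y : free_on) t :
  submod_val (x + y) t = submod_val x t + submod_val y t.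
Proof. by []. Qed.
Lemma free_subE (x y : free_on) t :
  submod_val (x - y) t = submod_val x t - submod_val y t.
Proof. by []. Qed.

Lemma free_ext (x y : free_on) :
  (forall t, submod_val x t = submod_val y t) -> x = y.
Proof. by move=> xy; apply: submod_inj; exact/funext. Qed.

Fact delta_finsupp t : (fun x => (x == t)%:R : R^o) \in finsupp_pred.
Proof. by apply/asboolP; exists [:: t] => x; rewrite inE => /negPf->. Qed.

Definition free_delta t : free_on := Submod (delta_finsupp t).

Lemma submod_val_sum (V : lmodType R) (N : submodClosed V) (I : Type) (s : seq I)
    (F : I -> submod N) :
  submod_val (\sum_(i <- s) F i) = \sum_(i <- s) submod_val (F i).
Proof. exact: (linear_sum (incl N)). Qed.

Lemma free_on_sumE (s : seq T) (c : T -> R) x : uniq s ->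
  submod_val (\sum_(t <- s) c t *: free_delta t) x = if x \in s then c x else 0.
Proof.
move=> us; rewrite submod_val_sum fct_sumE.
have E t : submod_val (c t *: free_delta t) x = c t * (x == t)%:R by [].
under eq_bigr do rewrite E.
have [xs|xs] := ifPn.
  rewrite (bigD1_seq x) //= eqxx mulr1 big1 ?addr0 // => t /negPf tx.
  by rewrite eq_sym tx mulr0.
rewrite big_seq big1 // => t ts; case: eqVneq => [xt|]; last by rewrite mulr0.
by rewrite xt ts in xs.
Qed.

Lemma free_on_basis : Defs.basis free_delta.
Proof.
split=> [s c us cs i si|x].
  by have := free_on_sumE c i us; rewrite cs si => <-.
have /asboolP[s sx] := submod_valP x.
exists (undup s), (submod_val x); apply: submod_inj; apply/funext => t.
rewrite /= free_on_sumE ?undup_uniq // mem_undup.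
by case: ifPn => // /sx.
Qed.

Lemma free_on_projective : projective free_on.
Proof. exact: basis_projective free_on_basis. Qed.

End FreeOn.

Notation free_on R T := (submod (@finsupp_pred R T)).

Lemma free_cover (R : nzRingType) (M : lmodType R) :
  exists e : {linear free_on R M -> M}, surj e.
Proof.
have [h hE] := basis_lift (@free_on_basis R M) id.
by exists h => x; exists (free_delta R x).
Qed.

(** * Projective dimension through syzygies *)

Section ProjectiveDimension.
Context (R : nzRingType).
Implicit Types (P F U V W M N K X Y Z : lmodType R).

(** The bound on projective dimension in syzygy form, suited to induction;
    [has_projective_resolutionE] translates it back to resolutions. *)
Fixpoint pdle (n : nat) M : Prop :=
  if n is m.+1 then
    exists (P K : lmodType R) (i : {linear K -> P}) (e : {linear P -> M}),
      [/\ projective P, ses i e & pdle m K]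
  else projective M.

Lemma pdle0_zero n M : (forall x : M, x = 0) -> pdle n M.
Proof.
elim: n M => [|n IHn] M M0; first exact: projective_zero.
pose z : {linear M -> M} := idfun.
exists M, (submod (kerp z)), (incl (kerp z)), z; split.
- exact: projective_zero.
- by apply: ses_ker => x; exists x.
- by apply: IHn => x; apply: submod_inj; exact: M0.
Qed.

Lemma projective_pdle n M : projective M -> pdle n M.
Proof.
case: n => // n pM; pose z : {linear M -> M} := idfun.
exists M, (submod (kerp z)), (incl (kerp z)), z; split=> //.
  by apply: ses_ker => x; exists x.
by apply: pdle0_zero => x; apply: submod_inj; have /kerpP := submod_valP x.
Qed.

Lemma pdle_iso n M V (f : {linear M -> V}) :
  injective f -> surj f -> pdle n M -> pdle n V.
Proof.
case: n => [|n] fI fS; first exact: (projective_iso fI fS).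
move=> [P [K [i [e [pP [iI eS eK] pK]]]]].
exists P, K, i, (f \o e); split=> //; split=> // [y|x].
  by have [x <-] := fS y; have [z <-] := eS x; exists z.
rewrite -eK /=; split=> [|->]; last by rewrite linear0.
by rewrite -(linear0 f) => /fI.
Qed.

(** The horseshoe lemma: the cover of W lifts to V, so the product of the covers of U and W covers
    V, and its kernel is an extension of the two syzygies. *)
Lemma pdle_ext n U V W (i : {linear U -> V}) (e : {linear V -> W}) :
  ses i e -> pdle n U -> pdle n W -> pdle n V.
Proof.
elim: n U V W i e => [|n IHn] U V W i e /= iex.
  move=> pU pW; have [s sK] := ses_split pW iex.
  have [r [rK _ dec]] := ses_retraction iex sK.
  apply: (projective_retract (r := copair i s) (i := pairf r e)).
    exact: projective_prod.
  by move=> x; rewrite [RHS]dec.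
move=> [P [KU [iU [eU [pP [iUI eUS eUK] pKU]]]]].
move=> [Q [KW [iW [eW [pQ [iWI eWS eWK] pKW]]]]].
have [iI eS eK] := iex; have [h hE] := pQ V W e eW eS.
have ei x : e (i x) = 0 by apply/eK; exists x.
pose c := copair (i \o eU) h.
have cE x y : c (x, y) = i (eU x) + h y by [].
have cS : surj c.
  move=> v; have [y ey] := eWS (e v).
  have [u uE] : exists u, i u = v - h y.
    by apply/eK; rewrite linearB hE ey subrr.
  by have [x xE] := eUS u; exists (x, y); rewrite cE xE uE subrK.
exists (P * Q)%type, (submod (kerp c)), (incl (kerp c)), c.
split; [exact: projective_prod | exact: ses_ker |].
have jP x : (linl P Q \o iU) x \in kerp c.
  by apply/kerpP; rewrite cE linear0 addr0 (_ : eU _ = 0) ?linear0 //; apply/eUK; exists x.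
have lP (x : submod (kerp c)) : exists y, iW y = (submod_val x).2.
  apply/eWK; rewrite -hE; have /kerpP := submod_valP x.
  case: x => -[x y] ?; rewrite /= cE => /eqP; rewrite addrC addr_eq0 => /eqP->.
  by rewrite linearN ei oppr0.
have [l lE] := choice lP.
have ll : linear l.
  by move=> a x y; apply: iWI; rewrite linearP !lE.
apply: (IHn KU _ KW (corestrict jP) (lin_of ll)) => //; split.
- move=> x y /(congr1 val) xy; apply: iUI; exact: (congr1 fst xy).
- move=> y; have /eK[u uE] : e (h (iW y)) = 0 by rewrite hE; apply/eWK; exists y.
  have [x xE] := eUS (- u).
  have xk : (x, iW y) \in kerp c by apply/kerpP; rewrite cE xE linearN uE addNr.
  by exists (Submod xk); apply: iWI; rewrite lE.
move=> x; split=> [lx|[y <-]]; last first.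
  by apply: iWI; rewrite linear0 [LHS]lE.
have := lE x; rewrite [l x]lx linear0 => x20.
have /kerpP := submod_valP x.
rewrite [submod_val x]surjective_pairing -x20 cE linear0 addr0 -(linear0 i).
move=> /iI/eUK[z zE]; exists z; apply: submod_inj.
by rewrite [RHS]surjective_pairing /= zE -x20.
Qed.

(** The kernel of the retraction is the image of the section, a copy of W. *)
Lemma ses_projr_retraction U V W (i : {linear U -> V}) (e : {linear V -> W}) :
  ses i e -> projective W ->
  exists2 r : {linear V -> U}, cancel i r & projective (submod (kerp r)).
Proof.
move=> iex pW; have [s sK] := ses_split pW iex.
have [r [rK rs dec]] := ses_retraction iex sK; exists r => //.
have sP x : s x \in kerp r by apply/kerpP.
apply: (projective_retract (r := corestrict sP) (i := e \o incl (kerp r))) pW _.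
move=> x; apply: submod_inj; rewrite /= [RHS]dec.
have /kerpP-> := submod_valP x.
by rewrite linear0 add0r.
Qed.

(** A cover of V also covers U through the retraction r, and the new kernel is an extension of the
    projective module [kerp r] by the old syzygy. *)
Lemma pdle_ses_projr n U V W (i : {linear U -> V}) (e : {linear V -> W}) :
  ses i e -> projective W -> pdle n V -> pdle n U.
Proof.
move=> iex /(ses_projr_retraction iex)[r rK pr].
case: n => [|n]; first by move=> pV; exact: projective_retract pV rK.
move=> [P [K [j [f [pP [jI fS fK] pK]]]]].
have cS : surj (r \o f).
  by move=> u; have [x xE] := fS (i u); exists x; rewrite /= xE.
exists P, (submod (kerp (r \o f))), (incl _), (r \o f).
split=> //; first exact: ses_ker.
have fj x : f (j x) = 0 by apply/fK; exists x.
have jP x : j x \in kerp (r \o f) by apply/kerpP; rewrite /= fj linear0.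
have gP (x : submod (kerp (r \o f))) : (f \o incl _) x \in kerp r.
  by apply/kerpP; have /kerpP := submod_valP x.
apply: (pdle_ext (i := corestrict jP) (e := corestrict gP)) => //.
  split.
  - by move=> x y /(congr1 val); exact: jI.
  - move=> y; have [x xE] := fS (submod_val y).
    have xk : x \in kerp (r \o f).
      by apply/kerpP; rewrite /= xE; have /kerpP := submod_valP y.
    by exists (Submod xk); apply: submod_inj.
  move=> x; split=> [/(congr1 val)/fK[y yE]|[y <-]].
    by exists y; apply: submod_inj.
  by apply: submod_inj; exact: fj.
exact: projective_pdle.
Qed.

(* Schanuel's lemma: both kernels are kernels of the fibre product's split
   projections. *)
Lemma pdle_syzygy n K P M (i : {linear K -> P}) (e : {linear P -> M}) :
  projective P -> ses i e -> pdle n.+1 M -> pdle n K.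
Proof.
move=> pP [iI eS eK] [P0 [K0 [i0 [e0 [pP0 [i0I e0S e0K] pK0]]]]].
pose d := copair e (e0 \o -%R).
have dE x y : d (x, y) = e x - e0 y by rewrite -linearN.
pose p1 := lfst P P0 \o incl (kerp d); pose p2 := lsnd P P0 \o incl (kerp d).
have dP (x : submod (kerp d)) : e (p1 x) = e0 (p2 x).
  have /kerpP := submod_valP x.
  by rewrite [submod_val x]surjective_pairing dE => /subr0_eq.
have ei x : e (i x) = 0 by apply/eK; exists x.
have e0i x : e0 (i0 x) = 0 by apply/e0K; exists x.
have jP x : (linl P P0 \o i) x \in kerp d.
  by apply/kerpP; rewrite [LHS](dE (i x) 0) ei linear0 subr0.
have j0P x : (linr P P0 \o i0) x \in kerp d.
  by apply/kerpP; rewrite [LHS](dE 0 (i0 x)) e0i linear0 subr0.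
have pQ : pdle n (submod (kerp d)).
  apply: (pdle_ext (i := corestrict j0P) (e := p1)) => //.
    split.
    - by move=> x y /(congr1 val) xy; apply: i0I; exact: (congr1 snd xy).
    - move=> x; have [y yE] := e0S (e x).
      have k : (x, y) \in kerp d by apply/kerpP; rewrite dE yE subrr.
      by exists (Submod k).
    move=> x; split=> [x0|[y <-]//].
    have /e0K[y yE] : e0 (p2 x) = 0 by rewrite -dP; rewrite -(linear0 e); congr (e _).
    exists y.
    have x1 : (submod_val x).1 = 0 := x0.
    have x2 : i0 y = (submod_val x).2 := yE.
    by apply: submod_inj; rewrite [RHS]surjective_pairing /= x1 -x2.
  exact: projective_pdle.
apply: (pdle_ses_projr (i := corestrict jP) (e := p2)) pQ => //; split.
- by move=> x y /(congr1 val) xy; apply: iI; exact: (congr1 fst xy).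
- move=> y; have [x xE] := eS (e0 y).
  have k : (x, y) \in kerp d by apply/kerpP; rewrite dE xE subrr.
  by exists (Submod k).
move=> x; split=> [x0|[y <-]//].
have /eK[y yE] : e (p1 x) = 0 by rewrite dP; rewrite -(linear0 e0); congr (e0 _).
exists y.
have x1 : (submod_val x).2 = 0 := x0.
have x2 : i y = (submod_val x).1 := yE.
by apply: submod_inj; rewrite [RHS]surjective_pairing /= x1 -x2.
Qed.

(** Rotation of a short exact sequence: a free cover of V also covers W, and the larger kernel
    modulo the smaller one is U. Questions about W or U thus move down one syzygy. *)
Lemma ses_cover U V W (i : {linear U -> V}) (e : {linear V -> W}) :
  ses i e ->
  exists (P KV KW : lmodType R) (iV : {linear KV -> P}) (eV : {linear P -> V})
    (iW : {linear KW -> P}) (j : {linear KV -> KW}) (f : {linear KW -> U}),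
    [/\ projective P, ses iV eV, ses iW (e \o eV) & ses j f].
Proof.
move=> [iI eS eK]; have [q qS] := free_cover V.
have eqS : surj (e \o q).
  by move=> y; have [x <-] := eS y; have [z <-] := qS x; exists z.
have ei x : e (i x) = 0 by apply/eK; exists x.
have jP (x : submod (kerp q)) : incl _ x \in kerp (e \o q).
  by apply/kerpP; rewrite /=; have /kerpP-> := submod_valP x; rewrite linear0.
have fP (x : submod (kerp (e \o q))) : exists y, i y = q (incl _ x).
  by apply/eK; have /kerpP := submod_valP x.
have [f fE] := choice fP.
have fl : linear f by move=> a x y; apply: iI; rewrite linearP !fE -linearP.
exists (free_on R V), (submod (kerp q)), (submod (kerp (e \o q))), (incl _), q,
  (incl _), (corestrict jP), (lin_of fl).
split; [exact: free_on_projective | exact: ses_ker | exact: ses_ker |].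
split.
- by move=> x y /(congr1 val) xy; apply: submod_inj; exact: xy.
- move=> u; have [x xE] := qS (i u).
  have xk : x \in kerp (e \o q) by apply/kerpP; rewrite /= xE ei.
  by exists (Submod xk); apply: iI; rewrite [LHS]fE.
move=> x; split=> [x0|[y <-]].
  have := fE x; rewrite [f x]x0 linear0 => qx.
  have xk : incl _ x \in kerp q by apply/kerpP.
  by exists (Submod xk); apply: submod_inj.
by apply: iI; rewrite [LHS]fE linear0; have /kerpP := submod_valP y.
Qed.

(** The syzygy of W is an extension of U by the syzygy of V, and both have dimension at most n. *)
Lemma pdle_quotient n U V W (i : {linear U -> V}) (e : {linear V -> W}) :
  ses i e -> pdle n U -> pdle n.+1 V -> pdle n.+1 W.
Proof.
move=> iex pU pV.
have [P [KV [KW [iV [eV [iW [j [f [pP sV sW sj]]]]]]]]] := ses_cover iex.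
exists P, KW, iW, (e \o eV); split=> //.
exact: pdle_ext sj (pdle_syzygy pP sV pV) pU.
Qed.

(** For n = 0, U is a syzygy of W. Otherwise rotation presents U as a quotient of the syzygy of W by
    that of V. *)
Lemma pdle_sub n U V W (i : {linear U -> V}) (e : {linear V -> W}) :
  ses i e -> pdle n V -> pdle n.+1 W -> pdle n U.
Proof.
case: n => [|n] iex pV pW; first exact: pdle_syzygy pV iex pW.
have [P [KV [KW [iV [eV [iW [j [f [pP sV sW sj]]]]]]]]] := ses_cover iex.
exact: pdle_quotient sj (pdle_syzygy pP sV pV) (pdle_syzygy pP sW pW).
Qed.

Lemma pdle_monotone n M : pdle n M -> pdle n.+1 M.
Proof.
elim: n M => [|n IHn] M; first exact: (@projective_pdle 1).
by case=> P [K [i [e [pP iex /IHn pK]]]]; exists P, K, i, e.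
Qed.

(** With separate free covers of U and V, the kernel over U is a retract of the kernel over the
    product, which is projective by Schanuel. *)
Lemma pdle1_summand U V : pdle 1 (U * V)%type -> pdle 1 U.
Proof.
move=> pUV; have [q qS] := free_cover U; have [r rS] := free_cover V.
exists (free_on R U), (submod (kerp q)), (incl _), q.
split; [exact: free_on_projective | exact: ses_ker |].
pose c := pairf (q \o lfst _ _) (r \o lsnd (free_on R U) (free_on R V)).
have cS : surj c.
  by move=> [x y]; have [u <-] := qS x; have [v <-] := rS y; exists (u, v).
have pK : projective (submod (kerp c)).
  apply: (pdle_syzygy (n := 0) _ (ses_ker cS) pUV).
  by apply: projective_prod; exact: free_on_projective.
have aP (x : submod (kerp c)) : (lfst _ _ \o incl _) x \in kerp q.
  by apply/kerpP; have /kerpP[] := submod_valP x.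
have bP (x : submod (kerp q)) : (linl _ (free_on R V) \o incl _) x \in kerp c.
  apply/kerpP; congr pair; last by rewrite /= linear0.
  by have /kerpP := submod_valP x.
apply: (projective_retract (r := corestrict aP) (i := corestrict bP)) pK _.
by move=> x; apply: submod_inj.
Qed.

(** The shift in the index matters: for M projective, N may still have dimension 1. *)
Lemma pdle_middle n F M N (i : {linear F -> M}) (e : {linear M -> N}) :
  projective F -> ses i e -> pdle n.+1 M <-> pdle n.+1 N.
Proof.
move=> pF iex; split; last exact: pdle_ext iex (projective_pdle _ pF).
by move=> pM; apply: pdle_quotient iex (projective_pdle _ pF) pM.
Qed.

Lemma has_projective_resolutionE M n : has_projective_resolution M n <-> pdle n M.
Proof.
split.
  elim: n M => [|n IHn] M [P [d [eps [pP P0 epsS epsK dK]]]].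
    apply: (projective_iso (f := eps)) (pP 0%N) => //.
    apply: linear_inj => x /epsK[y <-].
    by rewrite (P0 1%N isT y) linear0.
  exists (P 0%N), (submod (kerp eps)), (incl _), eps; split=> //.
    exact: ses_ker.
  have dP x : d 0%N x \in kerp eps by apply/kerpP/epsK; exists x.
  apply: IHn; exists (fun i => P i.+1), (fun i => d i.+1), (corestrict dP).
  split=> // [i ni|y|x]; first exact: P0.
    have /kerpP/epsK[x xE] := submod_valP y.
    by exists x; apply: submod_inj.
  rewrite -dK; split=> [/(congr1 val)//|dx]; exact: val_inj.
elim: n M => [|n IHn] M.
  (* The kernel [Z] of the identity is the zero module that pads the resolution. *)
  move=> pM; pose z : {linear M -> M} := idfun; pose Z := submod (kerp z).
  have Z0 (x : Z) : x = 0 by apply: submod_inj; have /kerpP := submod_valP x.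
  pose P i := if i is 0%N then M else Z.
  have zl (U : lmodType R) : linear (fun _ : Z => 0 : U).
    by move=> a x y; rewrite scaler0 addr0.
  exists P, (fun i => lin_of (zl (P i))), z; split.
  - by case=> [//|i]; exact: projective_zero.
  - by case.
  - by move=> y; exists y.
  - by move=> x; split=> [x0|[y <-]//]; exists 0; exact: esym x0.
  by move=> i x; split=> // _; exists 0; rewrite linear0 [RHS]Z0.
move=> [P0 [K [i [e [pP0 [iI eS eK] pK]]]]].
have [P [d [eps [pP Pz epsS epsK dK]]]] := IHn K pK.
pose P' j := if j is k.+1 then P k else P0.
(* The splice: the first differential is the augmentation onto the syzygy followed by its
   inclusion. *)
pose d' j : {linear P' j.+1 -> P' j} :=
  match j return {linear P' j.+1 -> P' j} with
  | 0%N => i \o eps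
  | k.+1 => d k
  end.
exists P', d', e; split=> //.
- by case.
- by case=> // j; exact: Pz.
- move=> x; rewrite eK; split=> [[y <-]|[y <-]].
    by have [z <-] := epsS y; exists z.
  by exists (eps y).
case=> [|j] x; last exact: dK.
rewrite -epsK /=; split=> [|->]; last by rewrite linear0.
by rewrite -(linear0 i) => /iI.
Qed.

End ProjectiveDimension.

(** As M is not projective, its minimal length is a successor, so the two minima differ by exactly
    1; infinite dimensions correspond as well. *)
Lemma pd_shift (R R' : nzRingType) (M : lmodType R) (N : lmodType R') :
  ~ projective M -> (forall n, pdle n.+1 M <-> pdle n N) ->
  pd M = omap succn (pd N).
Proof.
move=> nM MN; rewrite /pd.
have MN' n : has_projective_resolution M n.+1 <-> has_projective_resolution N n.
  by rewrite !has_projective_resolutionE.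
case: pselect => [exM|nex]; case: pselect => [exN|nexN] //=.
- case: ex_minnP => m /asboolP mM mmin; case: ex_minnP => k /asboolP kN kmin.
  congr Some; apply/eqP; rewrite eqn_leq; apply/andP; split.
    by apply: mmin; apply/asboolP; exact: (MN' k).2 kN.
  case: m mM {mmin} => [mM|m mM].
    by case: nM; exact: (has_projective_resolutionE M 0).1 mM.
  by apply: kmin; apply/asboolP; exact: (MN' m).1 mM.
- exfalso; case: exM => -[|n] /asboolP nM'.
    by case: nM; exact: (has_projective_resolutionE M 0).1 nM'.
  by case: nexN; exists n; apply/asboolP/MN'.
- exfalso; case: exN => n /asboolP nN; 
  by case: nex; exists n.+1; apply/asboolP/MN'.
Qed.

Lemma pd_le (R : nzRingType) (M : lmodType R) n :
  pdle n M -> exists2 m, pd M = Some m & (m <= n)%N.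
Proof.
move=> /has_projective_resolutionE/asboolP nM; rewrite /pd.
case: pselect => [ex|[]]; last by exists n.
by case: ex_minnP => m _ mmin; exists m => //; exact: mmin.
Qed.

(** * Change of rings along a split quotient by a regular element *)

Section Restriction.
Context (R R' : comNzRingType) (f : {rmorphism R -> R'}).

(** An alias of the carrier, on which R can act through f without clashing with the action of R'. *)
Definition restr_scalars (M : lmodType R') : Type := M.
HB.instance Definition _ (M : lmodType R') := GRing.Zmodule.on (restr_scalars M).

Section OneModule.
Context (M : lmodType R').
Definition rscale (a : R) (x : restr_scalars M) : restr_scalars M :=
  f a *: (x : M).
Fact rscaleA a b x : rscale a (rscale b x) = rscale (a * b) x.
Proof. by rewrite /rscale rmorphM scalerA. Qed.
Fact rscale1 : left_id 1 rscale.
Proof. by move=> x; rewrite /rscale rmorph1 scale1r. Qed.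
Fact rscaleDr : right_distributive rscale +%R.
Proof. by move=> a x y; rewrite /rscale scalerDr. Qed.
Fact rscaleDl x : {morph rscale^~ x : a b / a + b}.
Proof. by move=> a b; rewrite /rscale rmorphD scalerDl. Qed.
HB.instance Definition _ := GRing.Zmodule_isLmodule.Build R (restr_scalars M)
  rscaleA rscale1 rscaleDr rscaleDl.
End OneModule.

Definition restr (M : lmodType R') : lmodType R := restr_scalars M.

Lemma restr_scaleE (M : lmodType R') (a : R) (x : restr M) :
  a *: x = (f a *: (x : M) : M).
Proof. by []. Qed.

Fact restr_linear (M N : lmodType R') (g : {linear M -> N}) :
  linear (g : restr M -> restr N).
Proof. by move=> a x y; rewrite !restr_scaleE -linearP. Qed.

Definition restr_lin (M N : lmodType R') (g : {linear M -> N}) :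
  {linear restr M -> restr N} := lin_of (restr_linear g).

Lemma ses_restr (U V W : lmodType R') (i : {linear U -> V}) (e : {linear V -> W}) :
  ses i e -> ses (restr_lin i) (restr_lin e).
Proof. by []. Qed.

End Restriction.

Lemma pdle_leq (R : nzRingType) (M : lmodType R) m n :
  (m <= n)%N -> pdle m M -> pdle n M.
Proof.
move=> /subnK<-; elim: (n - m)%N => // k IHk /IHk pM.
exact: pdle_monotone.
Qed.

Section ChangeOfRings.
Context (R R' : comNzRingType) (f : {rmorphism R -> R'}) (s : {rmorphism R' -> R}).
Context (a : R) (sK : cancel s f).
Context (kerf : forall x, f x = 0 <-> exists y, x = y * a).
Context (areg : forall x, x * a = 0 -> x = 0).

Lemma kerf_gen : f a = 0.
Proof. by apply/kerf; exists 1; rewrite mul1r. Qed.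

Lemma subr_section x : exists y, x - s (f x) = a * y.
Proof.
have /kerf[y ->] : f (x - s (f x)) = 0 by rewrite rmorphB /= sK subrr.
by exists y; rewrite mulrC.
Qed.

Section FreeModule.
Context (T : choiceType).

Fact free_reduce_finsupp (x : free_on R T) :
  (f \o submod_val x : T -> R'^o) \in @finsupp_pred R' T.
Proof.
have /asboolP[t tx] := submod_valP x; apply/asboolP; exists t => y yt.
by rewrite /= tx // rmorph0.
Qed.

Definition free_reduce (x : free_on R T) : restr f (free_on R' T) :=
  Submod (free_reduce_finsupp x).

Fact free_reduce_linear : linear free_reduce.
Proof.
move=> c x y; apply: free_ext => t.
rewrite -[LHS]/(f (submod_val (c *: x + y) t)) free_addE free_scaleE.
by rewrite (rmorphD f) (rmorphM f).
Qed.

Fact scale_linear : linear (fun x : free_on R T => a *: x).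
Proof. by move=> c x y; rewrite scalerDr !scalerA mulrC. Qed.

Lemma free_scale_reg (x : free_on R T) : a *: x = 0 -> x = 0.
Proof.
move=> ax; apply: free_ext => t; apply: areg.
have E : a * submod_val x t = 0 by rewrite -free_scaleE ax.
by rewrite mulrC.
Qed.

Lemma free_divisible (x : free_on R T) :
  (forall t, exists y, submod_val x t = a * y) -> exists y, x = a *: y.
Proof.
move=> /choice[g gE].
have gs : (g : T -> R^o) \in @finsupp_pred R T.
  have /asboolP[u ux] := submod_valP x; apply/asboolP; exists u => t tu.
  by apply: areg; rewrite mulrC -gE ux.
exists (Submod gs); apply: free_ext => t.
by rewrite free_scaleE gE.
Qed.

(** In each coordinate f is onto, by way of s, with kernel the multiples of the regular element a.
    This is the length one resolution over R of a free R'-module. *)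
Lemma free_reduce_ses : ses (lin_of scale_linear) (lin_of free_reduce_linear).
Proof.
split.
- by apply: linear_inj => x; exact: free_scale_reg.
- move=> y.
  have ys : (s \o submod_val y : T -> R^o) \in @finsupp_pred R T.
    have /asboolP[u uy] := submod_valP y; apply/asboolP; exists u => t tu.
    by rewrite /= uy // rmorph0.
  exists (Submod ys); apply: free_ext => t; exact: sK.
move=> x; split=> [x0|[y <-]]; last first.
  apply: free_ext => t.
  by rewrite -[LHS]/(f (submod_val (a *: y) t)) free_scaleE (rmorphM f) kerf_gen mul0r.
have [y ->] : exists y, x = a *: y; last by exists y.
apply: free_divisible => t.
have x0' : free_reduce x = 0 := x0.
have /kerf[y ->] : f (submod_val x t) = 0.
  by rewrite -[LHS]/(submod_val (free_reduce x) t) x0'.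
by exists y; rewrite mulrC.
Qed.

Lemma free_section (x : free_on R T) : exists tx y : free_on R T,
  (forall t, submod_val tx t = s (f (submod_val x t))) /\ x - tx = a *: y.
Proof.
have xs : (fun t => s (f (submod_val x t)) : R^o) \in @finsupp_pred R T.
  have /asboolP[u ux] := submod_valP x; apply/asboolP; exists u => t tu.
  by rewrite ux // !rmorph0.
have [|y yE] := @free_divisible (x - Submod xs).
  by move=> t; rewrite free_subE; exact: subr_section.
by exists (Submod xs), y.
Qed.

End FreeModule.

Lemma restr_free_pdle1 (T : choiceType) : pdle 1 (restr f (free_on R' T)).
Proof.
exists (free_on R T), (free_on R T), (lin_of (@scale_linear T)),
  (lin_of (@free_reduce_linear T)).
split; [exact: free_on_projective | exact: free_reduce_ses |].
exact: free_on_projective.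
Qed.

(** G is a summand of a free R'-module, whose restriction has the resolution above. *)
Lemma restr_projective_pdle1 (G : lmodType R') :
  projective G -> pdle 1 (restr f G).
Proof.
move=> pG; have [q qS] := free_cover G.
have qex := ses_ker qS; have [t tK] := ses_split pG qex.
have [r [rK rt dec]] := ses_retraction qex tK.
apply: (@pdle1_summand _ _ (restr f (submod (kerp q)))).
apply: (pdle_iso (f := pairf (restr_lin f q) (restr_lin f r))) (restr_free_pdle1 G).
  apply: linear_inj => x [qx rx]; rewrite [x]dec.
  by rewrite [r x]rx [q x]qx !linear0 addr0.
move=> [y z]; exists (t y + incl _ z); congr pair.
  rewrite -[LHS]/(q (t y + incl _ z)) linearD tK.
  by have /kerpP-> := submod_valP z; rewrite addr0.
by rewrite -[LHS]/(r (t y + incl _ z)) linearD rt rK add0r.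
Qed.

Lemma pdle_restr n (G : lmodType R') : pdle n G -> pdle n.+1 (restr f G).
Proof.
elim: n G => [|n IHn] G; first exact: restr_projective_pdle1.
case=> P [K [i [e [pP iex /IHn pK]]]].
apply: pdle_quotient (ses_restr f iex) pK _.
exact: pdle_leq (restr_projective_pdle1 pP).
Qed.

(* With K the kernel of a free cover e of G, the map sending
   k = s (f k) + a k' to e k' is a retraction of the embedding of G into K / a K
   given by multiplication by a. *)
Lemma restr_pdle1_projective (G : lmodType R') :
  pdle 1 (restr f G) -> projective G.
Proof.
move=> pG X Y g h gS; have [e eS] := free_cover (restr f G).
have pK : projective (submod (kerp e)).
  exact: (pdle_syzygy (n := 0) (@free_on_projective _ _) (ses_ker eS) pG).
have ea x : e (a *: x) = 0.
  by rewrite linearZ /= restr_scaleE kerf_gen scale0r.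
have exq (k : free_on R (restr f G)) : exists z : G,
    forall tk y : free_on R (restr f G),
    (forall t, submod_val tk t = s (f (submod_val k t))) -> k - tk = a *: y ->
    z = e y.
  have [tk [y [tE yE]]] := free_section k; exists (e y) => tk' y' tE' yE'.
  have -> : y = y'; last by [].
  apply/subr0_eq/free_scale_reg; rewrite scalerBr -yE -yE'.
  have -> : tk = tk'; last by rewrite subrr.
  by apply: free_ext => t; rewrite /= tE tE'.
have [q qE] := choice exq.
(* Linearity holds on the kernel of e only: writing c = s (f c) + a c', the extra term c' (e k)
   vanishes there. *)
have ql : linear (fun k : submod (kerp e) => q (submod_val k) : restr f G).
  move=> c k k'.
  have [tk [y [tE yE]]] := free_section (submod_val k).
  have [tk' [y' [tE' yE']]] := free_section (submod_val k').
  have [c' cE] := subr_section c.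
  rewrite (qE (submod_val k) _ _ tE yE) (qE (submod_val k') _ _ tE' yE').
  rewrite (qE _ (s (f c) *: tk + tk') (c' *: submod_val k + (s (f c) *: y) + y')).
  - rewrite !linearD !linearZ /=; have /kerpP-> := submod_valP k.
    by rewrite scaler0 add0r !restr_scaleE sK.
  - move=> t.
    rewrite free_addE free_scaleE tE tE'.
    rewrite -[submod_val (c *: k + k')]/(c *: submod_val k + submod_val k').
    rewrite free_addE free_scaleE.
    by rewrite (rmorphD f) (rmorphM f) (rmorphD s) (rmorphM s).
  - rewrite !scalerDr !scalerA -cE (mulrC a (s _)) -scalerA -yE -yE'.
    rewrite scalerBl scalerBr opprD.
    rewrite -[LHS]/(c *: submod_val k + submod_val k' + (- (s (f c) *: tk) - tk')).
    by rewrite !addrA subrK -!addrA; congr (_ + _); rewrite addrCA.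
(* Projectivity over R lifts h after the retraction q; the values of this lift on multiples of a
   define the lift of h. *)
have [k kE] := pK _ _ (restr_lin f g) (restr_lin f h \o lin_of ql) gS.
have aP x : a *: x \in kerp e by apply/kerpP; exact: ea.
(* Since a acts as zero on X, the value at a x depends only on e x, whatever preimage p y is
   chosen. *)
have ka x : e x = 0 -> k (Submod (aP x)) = 0.
  move=> /kerpP ex; have -> : Submod (aP x) = a *: Submod ex by exact: val_inj.
  by rewrite linearZ /= restr_scaleE kerf_gen scale0r.
have [p pE] := choice eS.
have hl : linear (fun y : G => k (Submod (aP (p y))) : X).
  move=> c y z; apply/subr0_eq.
  have -> : c *: (k (Submod (aP (p y))) : X) = s c *: k (Submod (aP (p y))).
    by rewrite restr_scaleE sK.
  rewrite -linearP -linearB -[RHS](ka (p (c *: y + z) - (s c *: p y + p z))).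
    congr (k _); apply: submod_inj.
    rewrite -[LHS]/(a *: p (c *: y + z) - (s c *: (a *: p y) + a *: p z)).
    rewrite -[RHS]/(a *: (p (c *: y + z) - (s c *: p y + p z))).
    by rewrite scalerBr scalerDr !scalerA mulrC.
  rewrite linearB linearP !pE restr_scaleE sK; exact: subrr.
exists (lin_of hl) => y; rewrite -[LHS]/(restr_lin f g (k (Submod (aP (p y))))).
rewrite kE -[LHS]/(h (q (a *: p y))); congr (h _).
rewrite (qE _ 0 (p y)) ?pE ?subr0 // => t.
by rewrite free_scaleE (rmorphM f) kerf_gen mul0r rmorph0.
Qed.

(** In a free cover of G the middle term restricts to dimension at most 1, so [pdle_sub] lowers the
    bound when passing to the kernel. *)
Lemma restr_pdle n (G : lmodType R') : pdle n.+1 (restr f G) -> pdle n G.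
Proof.
elim: n G => [|n IHn] G pG; first exact: restr_pdle1_projective.
have [q qS] := free_cover G.
exists (free_on R' G), (submod (kerp q)), (incl _), q.
split; [exact: free_on_projective | exact: ses_ker |].
apply: IHn; apply: pdle_sub (ses_restr f (ses_ker qS)) _ pG.
exact: pdle_leq (restr_free_pdle1 G).
Qed.

End ChangeOfRings.

(** * Noetherian modules *)

(** The ascending chain condition without submodules: in every sequence some term depends linearly
    on the earlier ones. *)
Definition noetherian (R : nzRingType) (M : lmodType R) : Prop :=
  forall a : nat -> M, exists (n : nat) (c : nat -> R),
    a n = \sum_(i < n) c i *: a i.

Section Noetherian.
Context (R : nzRingType) (M : lmodType R).

Lemma span_trans (a b : nat -> M) (m n : nat) (c : nat -> R) :
  (forall i, (i < n)%N -> exists d : nat -> R, b i = \sum_(j < m) d j *: a j) ->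
  exists d : nat -> R, \sum_(i < n) c i *: b i = \sum_(j < m) d j *: a j.
Proof.
elim: n => [|n IHn] bs.
  by exists (fun _ => 0); rewrite big_ord0 big1 // => i _; rewrite scale0r.
have [i in_|d dE] := IHn; first by apply: bs; exact: ltnW.
have [e eE] := bs n (ltnSn n); exists (fun j => d j + c n * e j).
rewrite big_ord_recr /= dE eE scaler_sumr -big_split /=; apply: eq_bigr => j _.
by rewrite scalerDl scalerA.
Qed.

(** Finite powers of R are noetherian, phrased with functionals. Consecutive blocks of the sequence
    give combinations whose first r coordinates vanish; noetherianity of R applied to their next
    coordinate removes it too. *)
Lemma noetherian_coords (lam : nat -> {linear M -> R^o}) :
  noetherian R^o -> forall r (a : nat -> M), exists n (c : nat -> R),
    forall i, (i < r)%N -> lam i (a n - \sum_(j < n) c j *: a j) = 0.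
Proof.
move=> nR; elim=> [|r IHr] a; first by exists 0%N, (fun _ => 0).
have ex N : exists nc : nat * (nat -> R), forall i, (i < r)%N ->
    lam i (a (N + nc.1)%N - \sum_(j < nc.1) nc.2 j *: a (N + j)%N) = 0.
  by have [n [c cE]] := IHr (fun j => a (N + j)%N); exists (n, c).
have [F FE] := choice ex.
(* [N k] is where block k starts and [t k] where it ends; a (t k) has coefficient 1 in [b k], and
   the blocks are disjoint. *)
pose N k := iter k (fun N => (N + (F N).1).+1) 0%N.
pose t k := (N k + (F (N k)).1)%N.
pose b k := a (t k) - \sum_(j < (F (N k)).1) (F (N k)).2 j *: a (N k + j)%N.
have NS k : N k.+1 = (t k).+1 by [].
have Nle k k' : (k <= k')%N -> (N k <= N k')%N.
  move=> /subnK<-; elim: (k' - k)%N => // m IHm; rewrite addSn NS.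
  by apply: (leq_trans IHm); rewrite ltnW // ltnS leq_addr.
have shift (m N' : nat) (c : nat -> R) : exists d : nat -> R,
    \sum_(j < m) c j *: a (N' + j)%N = \sum_(j < N' + m) d j *: a j.
  apply: (@span_trans a (fun j => a (N' + j)%N)) => i im; exists (fun j => (j == N' + i)%:R).
  have lt : (N' + i < N' + m)%N by rewrite ltn_add2l.
  rewrite (bigD1 (Ordinal lt)) //= eqxx scale1r big1 ?addr0 // => j jN.
  by rewrite (negPf (jN : (j : nat) != _)) scale0r.
have bs k : exists d : nat -> R, b k = \sum_(j < (t k).+1) d j *: a j.
  have [d dE] := shift (F (N k)).1 (N k) (F (N k)).2.
  exists (fun j => if j == t k then 1 else - d j).
  rewrite big_ord_recr /= eqxx scale1r addrC /b dE; congr (_ + _).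
  rewrite -sumrN; apply: eq_bigr => j _.
  by rewrite ltn_eqF ?scaleNr // ltn_ord.
have [k [c cE]] := nR (fun k => lam r (b k)).
have [d dE] : exists d : nat -> R,
    b k - \sum_(j < k) c j *: b j = a (t k) - \sum_(j < t k) d j *: a j.
  have [d1 d1E] := shift (F (N k)).1 (N k) (F (N k)).2.
  have [d2 d2E] : exists d : nat -> R,
      \sum_(j < k) c j *: b j = \sum_(j < t k) d j *: a j.
    apply: span_trans => i ik; have [d dE] := bs i.
    have le : ((t i).+1 <= t k)%N.
      by rewrite -NS (leq_trans (Nle _ _ ik)) // leq_addr.
    exists (fun j => if (j < (t i).+1)%N then d j else 0).
    rewrite dE (big_ord_widen _ (fun j => d j *: a j) le) big_mkcond.
    by apply: eq_bigr => j _; case: ifP => // _; rewrite scale0r.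
  exists (fun j => d1 j + d2 j); rewrite /b d1E d2E -addrA -opprD -big_split.
  by congr (_ - _); apply: eq_bigr => j _; rewrite scalerDl.
exists (t k), d => i; rewrite -dE linearB linear_sum ltnS leq_eqVlt => /predU1P[->|ir].
  by rewrite cE -sumrB big1 // => j _; rewrite linearZ_LR subrr.
rewrite [lam i (b k)]FE // big1 ?subr0 // => j _.
by rewrite linearZ_LR [lam i (b j)]FE // scaler0.
Qed.

Lemma noetherian_sub (r : nat) (lam : 'I_r -> {linear M -> R^o}) :
  noetherian R^o -> (forall x, (forall i, lam i x = 0) -> x = 0) ->
  noetherian M.
Proof.
move=> nR lamI a.
have zl : linear (fun _ : M => 0 : R^o) by move=> c x y; rewrite scaler0 addr0.
pose lam' i := if insub i is Some j then lam j else lin_of zl.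
have [n [c cE]] := noetherian_coords lam' nR r a; exists n, c.
apply/subr0_eq/lamI => i; have := cE i (ltn_ord i).
by rewrite /lam' valK.
Qed.

(** Otherwise one could forever append an element outside the span of the list built so far. *)
Lemma noetherian_fg : noetherian M -> exists (n : nat) (b : 'I_n -> M),
  forall x, span_of b [set: 'I_n] x.
Proof.
move=> nM; apply: contrapT => nfg.
have ex (s : seq M) : exists x, ~ exists c : nat -> R,
    x = \sum_(i < size s) c i *: nth 0 s i.
  apply: contrapT => /forallNP h; apply: nfg.
  exists (size s), (fun i => nth 0 s i) => x.
  have [c cE] := contrapT (h x); exists (fun i => c i).
  by rewrite cE; apply: eq_bigl => i; rewrite inE.
have [F FE] := choice ex.
pose s n := iter n (fun s => rcons s (F s)) [::].
have ss n : size (s n) = n by elim: n => //= n IHn; rewrite size_rcons IHn.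
have sn n i : (i < n)%N -> nth 0 (s n) i = F (s i).
  elim: n => // n IHn; rewrite ltnS leq_eqVlt => /predU1P[->|in_] /=.
    by rewrite nth_rcons ss ltnn eqxx.
  by rewrite nth_rcons ss in_ IHn.
have [n [c cE]] := nM (fun n => F (s n)); apply: (FE (s n)); exists c.
by rewrite cE ss; apply: eq_bigr => i _; rewrite sn.
Qed.

(** A generating subset of least cardinality is irredundant; its enumeration is the subfamily. *)
Lemma irredundant_generators (n : nat) (b : 'I_n -> M) (N : M -> Prop) :
  generates N b [set: 'I_n] ->
  exists (s : nat) (h : 'I_s -> 'I_n), minimal_generators N (b \o h).
Proof.
move=> gen; pose P (J : {set 'I_n}) := `[< generates N b J >].
have PT : P [set: 'I_n] by apply/asboolP.
case: (@arg_minnP _ [set: 'I_n] P (fun J => #|J|) PT) => J /asboolP gJ Jmin.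
pose h (i : 'I_#|J|) : 'I_n := enum_val i.
have hI : injective h by exact: enum_val_inj.
have spanE (I : {set 'I_#|J|}) x : span_of (b \o h) I x <-> span_of b (h @: I) x.
  split=> [[c ->]|[c ->]]; last first.
    exists (c \o h); rewrite big_imset //= => i j _ _; exact: hI.
  exists (fun i => odflt 0 (omap c [pick j | h j == i])).
  rewrite big_imset /=; last by move=> i j _ _; exact: hI.
  apply: eq_bigr => i _; case: pickP => [j /eqP/hI->//|/(_ i)].
  by rewrite eqxx.
have hT : h @: [set: 'I_#|J|] = J.
  apply/setP => i; apply/imsetP/idP => [[j _ ->]|iJ]; first exact: enum_valP.
  by exists (enum_rank_in iJ i); rewrite ?inE // /h enum_rankK_in.
exists #|J|, h; split=> [x|I gI]; first by rewrite gJ spanE hT.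
have PI : P (h @: I) by apply/asboolP => x; rewrite gI spanE.
apply/eqP; rewrite eqEcard finset.subsetT cardsT card_ord.
by rewrite -(card_imset _ hI) Jmin.
Qed.

End Noetherian.

Lemma noetherian_field (K : fieldType) : noetherian K^o.
Proof.
move=> a; have [a0|a0] := eqVneq (a 0%N) 0.
  by exists 0%N, (fun _ => 0); rewrite big_ord0.
exists 1%N, (fun _ => a 1%N / a 0%N); rewrite big_ord1.
by rewrite -[RHS]/(a 1%N / a 0%N * a 0%N) mulfVK.
Qed.

Lemma noetherian_image (R R' : nzRingType) (f : {rmorphism R -> R'}) :
  surj f -> noetherian R^o -> noetherian R'^o.
Proof.
move=> fS nR a; have [b bE] := choice (fun n => fS (a n)).
have [n [c cE]] := nR b; exists n, (f \o c).
rewrite -bE cE rmorph_sum; apply: eq_bigr => i _.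
by rewrite -bE -[LHS]/(f (c i * b i)) rmorphM.
Qed.

(* Hilbert's basis theorem, by elements of minimal degree. *)
Lemma noetherian_poly (R : comNzRingType) :
  noetherian R^o -> noetherian {poly R}^o.
Proof.
move=> nR a; apply: contrapT => nspan.
pose inspan (p : {poly R}) (s : seq {poly R}) :=
  exists c : nat -> {poly R}, p = \sum_(i < size s) c i *: (s`_i : {poly R}^o).
(* The ideal generated by all terms of the sequence. *)
pose I (p : {poly R}) := exists n, inspan p (mkseq a n).
have spanE (p : {poly R}) n : inspan p (mkseq a n) <->
    exists c : nat -> {poly R}, p = \sum_(i < n) c i *: (a i : {poly R}^o).
  rewrite /inspan size_mkseq.
  by split=> -[c ->]; exists c; apply: eq_bigr => i _; rewrite nth_mkseq.
have Iadd c p q : I p -> I q -> I (p - c * q).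
  move=> [m /spanE[d ->]] [n /spanE[e ->]]; exists (m + n)%N; apply/spanE.
  exists (fun i => (if (i < m)%N then d i else 0) - (if (i < n)%N then c * e i else 0)).
  under [RHS]eq_bigr do rewrite scalerBl.
  rewrite sumrB; congr (_ - _).
    rewrite (big_ord_widen (m + n) (fun i => d i *: (a i : {poly R}^o))) ?leq_addr //.
    by rewrite big_mkcond; apply: eq_bigr => i _; case: ifP => // _; rewrite scale0r.
  rewrite mulr_sumr.
  rewrite (big_ord_widen (m + n) (fun i => c * (e i *: (a i : {poly R}^o)))) ?leq_addl //.
  rewrite big_mkcond; apply: eq_bigr => i _; case: ifP => // _; last by rewrite scale0r.
  by rewrite -[LHS]/(c * (e i * a i)) mulrA.
(* The greedy choice of an element of I of least size outside the span of s. One exists: if s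
   spanned I, it would lie in the span of the first N terms of a, and so would the term a N, against
   [nspan]. *)
have ex (s : seq {poly R}) : exists p, (forall x, x \in s -> I x) ->
    [/\ I p, ~ inspan p s & forall q, I q -> ~ inspan q s -> (size p <= size q)%N].
  have [sI|nsI] := pselect (forall x, x \in s -> I x); last by exists 0.
  have [p0 [p0I p0s]] : exists p, I p /\ ~ inspan p s.
    apply: contrapT => /forallNP h.
    have Is p : I p -> inspan p s.
      by move=> pI; apply: contrapT => ps; apply: (h p).
    have [N sN] : exists N, forall x, x \in s -> inspan x (mkseq a N).
      elim: s sI {h Is} => [|x s IHs] sI; first by exists 0%N.
      have [|N1 h1] := IHs; first by move=> y ys; apply: sI; rewrite inE ys orbT.
      have [N2 h2] := sI x (mem_head _ _).
      have mono (m n : nat) y : (m <= n)%N -> inspan y (mkseq a m) -> inspan y (mkseq a n).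
        move=> mn /spanE[c ->]; apply/spanE.
        exists (fun i => if (i < m)%N then c i else 0).
        rewrite (big_ord_widen n (fun i => c i *: (a i : {poly R}^o))) //.
        by rewrite big_mkcond; apply: eq_bigr => i _; case: ifP => // _; rewrite scale0r.
      exists (maxn N1 N2) => y; rewrite inE => /predU1P[->|/h1].
        by apply: mono h2; rewrite leq_maxr.
      by apply: mono; rewrite leq_maxl.
    have /Is[c cE] : I (a N).
      exists N.+1; apply/spanE; exists (fun i => (i == N)%:R).
      rewrite big_ord_recr /= eqxx scale1r big1 ?add0r // => i _.
      by rewrite ltn_eqF // scale0r.
    apply: nspan; have := @span_trans {poly R} {poly R}^o a (nth 0 s) N (size s) c.
    case=> [i is_|d dE]; first by apply/spanE/sN; rewrite mem_nth.
    by exists N, d; rewrite cE dE.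
  have exn : exists n, `[< exists p, [/\ I p, ~ inspan p s & size p = n] >].
    by exists (size p0); apply/asboolP; exists p0.
  case: (ex_minnP exn) => n /asboolP[p [pI ps pn]] nmin; exists p => _; split=> //.
  by move=> q qI qs; rewrite pn; apply: nmin; apply/asboolP; exists q.
have [F FE] := choice ex.
pose s n := iter n (fun s => rcons s (F s)) [::].
pose f n := F (s n).
have ss n : size (s n) = n by elim: n => //= n IHn; rewrite size_rcons IHn.
have sn n i : (i < n)%N -> (s n)`_i = f i.
  elim: n => // n IHn; rewrite ltnS leq_eqVlt => /predU1P[->|in_] /=.
    by rewrite nth_rcons ss ltnn eqxx.
  by rewrite nth_rcons ss in_ IHn.
have sI n : forall x, x \in s n -> I x.
  elim: n => //= n IHn x; rewrite mem_rcons inE => /predU1P[->|/IHn//].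
  by have [] := FE (s n) IHn.
have fI n : I (f n) by have [] := FE _ (@sI n).
have fs n : ~ inspan (f n) (s n) by have [] := FE _ (@sI n).
have fmin n q : I q -> ~ inspan q (s n) -> (size (f n) <= size q)%N.
  by have [_ _] := FE _ (@sI n); apply.
have spanS (p : {poly R}) n : inspan p (s n) <->
    exists c : nat -> {poly R}, p = \sum_(i < n) c i * f i.
  rewrite /inspan ss.
  by split=> -[c ->]; exists c; apply: eq_bigr => i _; rewrite sn.
have fle i n : (i < n)%N -> (size (f i) <= size (f n))%N.
  move=> in_; apply: fmin => // /spanS[c cE]; apply: (fs n); apply/spanS.
  exists (fun j => if (j < i)%N then c j else 0).
  rewrite cE (big_ord_widen n (fun j => c j * f j)) ?(ltnW in_) //.
  by rewrite big_mkcond; apply: eq_bigr => j _; case: ifP => // _; rewrite mul0r.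
have [n [c cE]] := nR (fun n => lead_coef (f n)).
have f0 k : f k != 0.
  apply/eqP => fk; apply: (fs k); apply/spanS; exists (fun _ => 0).
  by rewrite fk big1 // => i _; rewrite mul0r.
(* Multiplication by X^(d i) aligns f i with the top degree of f n, the subtraction being exact by
   [fle]. So g loses the leading term of f n but stays outside the span, against minimality. *)
pose d i := (size (f n) - size (f i))%N.
pose g := f n - \sum_(i < n) (c i *: 'X^(d i)) * f i.
have gI : I g.
  suff gen k : I (f n - \sum_(i < k) (c i *: 'X^(d i)) * f i) by exact: gen.
  elim: k => [|k IHk]; first by rewrite big_ord0 subr0.
  by rewrite big_ord_recr /= opprD addrA; exact: Iadd.
have gs : ~ inspan g (s n).
  move=> /spanS[e eE]; apply: (fs n); apply/spanS.
  exists (fun i => e i + c i *: 'X^(d i)).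
  under eq_bigr do rewrite mulrDl.
  by rewrite big_split /= -eE subrK.
have := fmin n g gI gs; rewrite leqNgt => /negP; apply.
have sf : (0 < size (f n))%N by rewrite size_poly_gt0.
rewrite -(ltn_predK sf) ltnS; apply/leq_sizeP => j.
rewrite leq_eqVlt coefB coef_sum => /predU1P[<-|jn].
  rewrite -[(f n)`_ _]/(lead_coef (f n)) cE -sumrB big1 // => i _.
  rewrite -scalerAl coefZ coefXnM.
  have -> : ((size (f n)).-1 < d i)%N = false.
    by rewrite ltnNge -ltnS (ltn_predK sf) ltn_subrL sf size_poly_gt0 f0.
  have -> : ((size (f n)).-1 - d i)%N = (size (f i)).-1.
    have := fle i n (ltn_ord i); have : (0 < size (f i))%N by rewrite size_poly_gt0.
    by rewrite /d; case: (size (f i)) => // a'; case: (size (f n)) sf => // b _ _ /=;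
      rewrite ltnS => ab; rewrite subSS subKn.
  exact: subrr.
have nj : (size (f n) <= j)%N by rewrite -(ltn_predK sf).
rewrite nth_default // big1 ?subr0 // => i _.
rewrite -scalerAl coefZ coefXnM; case: ifP => _; rewrite ?mulr0 //.
rewrite nth_default ?mulr0 // -(subKn (fle i n (ltn_ord i))).
exact: leq_sub2r.
Qed.

(** Polynomials in one variable over {mpoly K[n]} map onto {mpoly K[n.+1]} by sending that variable
    to the last one, and noetherianity passes to images. *)
Lemma noetherian_mpoly (K : fieldType) (n : nat) :
  @noetherian {mpoly K[n]} {mpoly K[n]}^o.
Proof.
elim: n => [|n IHn].
  pose f : {rmorphism K -> {mpoly K[0]}} := @mpolyC 0 K.
  apply: (@noetherian_image K {mpoly K[0]} f _ (@noetherian_field K)).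
  move=> p; exists p@_0%MM; apply/mpolyP => m.
  rewrite mcoeffC (_ : m = 0%MM) ?eqxx ?mulr1 //.
  by apply/mnmP; case.
pose h : {rmorphism {poly {mpoly K[n]}} -> {mpoly K[n.+1]}} :=
  horner_eval 'X_ord_max \o map_poly (mwiden (n := n) (R := K)).
apply: (@noetherian_image {poly {mpoly K[n]}} {mpoly K[n.+1]} h _
  (noetherian_poly IHn)).
have hC p : h p%:P = mwiden p by rewrite /= map_polyC /= /horner_eval hornerC.
have hX i : exists q, h q = 'X_i.
  case: (unliftP ord_max i) => [j ->|->].
    exists ('X_j)%:P; rewrite hC mwidenX mnmwiden1.
    congr 'X_[U_(_)]; apply: val_inj; rewrite /= /bump leqNgt.
    by rewrite (ltn_ord j : (j < n)%N).
  by exists 'X; rewrite /= map_polyX /horner_eval hornerX.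
elim/mpolyind => [|c m p _ _ [q <-]]; first by exists 0; rewrite rmorph0.
suff [r <-] : exists r, h r = 'X_[m].
  exists ((c%:MP)%:P * r + q); rewrite rmorphD rmorphM hC.
  by rewrite mwidenC mul_mpolyC.
have [g gE] := choice hX; exists (\prod_(i < n.+1) g i ^+ m i).
by rewrite rmorph_prod mpolyXE_id; apply: eq_bigr => i _; rewrite rmorphXn gE.
Qed.

(** * Graded projective modules are free *)

Lemma pihomog0E (K : fieldType) (l : nat) (p : {mpoly K[l]}) :
  pihomog mdeg 0 p = (p@_0%MM)%:MP.
Proof.
apply/mpolyP => m; rewrite mcoeffC.
have [m0|m0] := eqVneq 0%MM m; last first.
  rewrite mulr0; apply: (dhomog_nemf_coeff (pihomogP mdeg 0 p)).
  by rewrite mdeg_eq0 eq_sym.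
rewrite -m0 mulr1.
rewrite pihomogE raddf_sum /= [p in RHS]mpolyE raddf_sum /= big_mkcond /=.
apply: eq_bigr => n _; rewrite mdeg_eq0; case: eqVneq => [//|n0].
by rewrite mcoeffZ mcoeffX (negPf n0) mulr0.
Qed.

Section GradedModule.
Context (K : fieldType) (l : nat).
Local Notation S := {mpoly K[l]}.
(** The grading is encoded by its component projections; homogeneous elements of degree e are the
    values of [cmp e]. *)
Context (M : lmodType S) (cmp : nat -> M -> M).
Context (cmpD : forall d, {morph cmp d : x y / x + y}).
Context (cmpZ : forall d e (c : S) x, cmp d (c *: cmp e x) =
  if (e <= d)%N then pihomog mdeg (d - e) c *: cmp e x else 0).
Context (cmp_dec : forall x, exists n, forall m, (n <= m)%N ->
  x = \sum_(d < m) cmp d x).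

Lemma cmp0 d : cmp d 0 = 0.
Proof. by apply: (addIr (cmp d 0)); rewrite -cmpD !add0r. Qed.

(** The components of finitely many generators, in degrees below a common bound, generate M and can
    be pruned. *)
Lemma homogeneous_generators : noetherian M ->
  exists (s : nat) (e : 'I_s -> M) (dg : 'I_s -> nat),
    (forall i, exists x, e i = cmp (dg i) x) /\
    minimal_generators (fun _ => True) e.
Proof.
move=> /noetherian_fg[n [b bE]].
have [N NE] : exists N, forall i, b i = \sum_(d < N) cmp d (b i).
  have [N NE] := choice (fun i => cmp_dec (b i)).
  by exists (\max_i N i) => i; apply: NE; exact: leq_bigmax.
pose T := ('I_n * 'I_N)%type.
pose g (k : 'I_#|{: T}|) := cmp (enum_val k).2 (b (enum_val k).1).
have gen : generates (fun _ => True) g [set: 'I_#|{: T}|].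
  move=> x; split=> // _; have [c ->] := bE x.
  exists (fun k => c (enum_val k).1); rewrite (eq_bigl xpredT); last first.
    by move=> i; rewrite inE.
  under [LHS]eq_bigr do rewrite NE scaler_sumr.
  rewrite pair_big /= [RHS](eq_bigl xpredT); last by move=> i; rewrite inE.
  rewrite (reindex (fun k : 'I_#|{: T}| => enum_val k)) //=.
  by exists enum_rank => k _; rewrite ?enum_valK ?enum_rankK.
have [s [h hmin]] := irredundant_generators gen.
exists s, (g \o h), (fun i => val (enum_val (h i)).2); split=> // i.
by exists (b (enum_val (h i)).1).
Qed.

(** In the component of degree dg i of the relation, e i has the constant term of c i as
    coefficient. Were it nonzero, e i would be a combination of the other generators. *)
Lemma relation_const0 (s : nat) (e : 'I_s -> M) (dg : 'I_s -> nat) (c : 'I_s -> S) :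
  (forall i, exists x, e i = cmp (dg i) x) ->
  minimal_generators (fun _ => True) e ->
  \sum_i c i *: e i = 0 -> forall i, (c i)@_0%MM = 0.
Proof.
move=> eh [egen emin] ce i; apply/eqP/negP => /negP ci.
pose c' k := if (dg k <= dg i)%N then pihomog mdeg (dg i - dg k) (c k) else 0.
have c'E : \sum_k c' k *: e k = 0.
  transitivity (cmp (dg i) (\sum_k c k *: e k)); last by rewrite ce cmp0.
  rewrite (big_morph _ (cmpD (dg i)) (cmp0 (dg i))).
  apply: eq_bigr => k _; have [x ->] := eh k; rewrite cmpZ /c'.
  by case: ifP => // _; rewrite scale0r.
have c'i : c' i = ((c i)@_0%MM)%:MP by rewrite /c' leqnn subnn pihomog0E.
pose u : S := (- ((c i)@_0%MM)^-1)%:MP.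
have ei : e i = \sum_(k in [set~ i]) (u * c' k) *: e k.
  move: c'E; rewrite (bigD1 i) //= c'i => /eqP; rewrite addr_eq0 => /eqP c'e.
  have -> : e i = - (u *: (((c i)@_0%MM)%:MP *: e i)).
    by rewrite scalerA -mpolyCM mulNr mulVf // mpolyCN scaleNr opprK scale1r.
  rewrite c'e scalerN opprK scaler_sumr; apply: eq_big => [k|k _].
    by rewrite !inE.
  by rewrite scalerA.
have : i \in [set~ i]; last by rewrite !inE eqxx.
rewrite (emin [set~ i]) ?inE // => x; split=> // _.
have [/(_ I)[d ->] _] := egen x.
exists (fun k => d k + d i * (u * c' k)).
rewrite (eq_bigl xpredT) => [|k]; last by rewrite inE.
rewrite (bigD1 i) //= ei scaler_sumr addrC.
rewrite (eq_bigl (fun k => k \in [set~ i])) => [|k]; last by rewrite !inE.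
rewrite -big_split /=; apply: eq_bigr => k _.
by rewrite scalerDl !scalerA mulrA.
Qed.

(** Graded Nakayama. Let h split the cover by minimal homogeneous generators. The rows of E = 1 - (h
    (e i)) are relations, so E has no constant terms and det (1 - E) has constant term 1. A relation
    v satisfies v (1 - E) = h (ep v) = 0, hence v = 0. *)
Lemma graded_projective_free : noetherian M -> projective M -> free_module M.
Proof.
move=> /homogeneous_generators[s [e [dg [eh emin]]]] pM.
pose ep (v : 'rV[S]_s) := \sum_i v 0 i *: e i.
have epl : linear ep.
  move=> a u v; rewrite /ep scaler_sumr -big_split /=; apply: eq_bigr => i _.
  by rewrite !mxE scalerDl scalerA.
have epS : surj (lin_of epl).
  move=> x; have [/(_ I)[c ->] _] := emin.1 x.
  exists (\row_i c i); rewrite -[LHS]/(ep (\row_i c i)).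
  by apply: eq_big => [i|i _]; rewrite ?inE ?mxE.
have [h hE] := pM _ _ (lin_of epl) idfun epS.
pose E : 'M[S]_s := 1%:M - \matrix_i h (e i).
have E0 i j : (E i j)@_0%MM = 0.
  apply: (relation_const0 eh emin (c := fun j => E i j)).
  under eq_bigr do rewrite mxE scalerDl.
  rewrite big_split /= (bigD1 i) //= mxE eqxx scale1r big1 ?addr0; last first.
    by move=> k ki; rewrite mxE eq_sym (negPf ki) scale0r.
  under eq_bigr do rewrite !mxE scaleNr.
  by rewrite sumrN; apply/eqP; rewrite subr_eq0 eq_sym; apply/eqP; exact: hE.
have dE : \det (1%:M - E) != 0.
  apply: contraTneq (oner_neq0 K) => dE.
  have := congr1 (mcoeff 0%MM) dE; rewrite -det_map_mx.
  have -> : map_mx (mcoeff 0%MM) (1%:M - E) = 1%:M.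
    apply/matrixP => i j; rewrite !mxE mcoeffB.
    have -> : ((i == j)%:R - h (e i) 0 j)@_0%MM = 0 by rewrite -(E0 i j) !mxE.
    rewrite subr0; case: (i == j); rewrite ?mcoeff0 // mcoeff1 eqxx //.
  by rewrite det1 mcoeff0 => ->; rewrite eqxx.
have inj v : ep v = 0 -> v = 0.
  move=> v0; have : v *m (1%:M - E) = 0.
    rewrite /E opprB addrC subrK.
    have -> : v *m \matrix_i h (e i) = h (ep v).
      rewrite mulmx_sum_row linear_sum; apply: eq_bigr => i _.
      by rewrite rowK linearZ.
    by rewrite v0 linear0.
  move=> /(congr1 (mulmx^~ (\adj (1%:M - E)))).
  rewrite -mulmxA mul_mx_adj mul0mx mul_mx_scalar => /rowP dv.
  apply/rowP => i; have /eqP := dv i; rewrite !mxE mulf_eq0 (negPf dE).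
  by move/eqP.
exists 'I_s, e; split=> [t c ut ct i it|x]; last first.
  have [/(_ I)[c ->] _] := emin.1 x; exists (index_enum 'I_s), c.
  by apply: eq_bigl => i; rewrite inE.
have /rowP/(_ i) : \row_i (if i \in t then c i else 0) = 0.
  apply: inj; rewrite -ct /ep [RHS]big_uniq //= [RHS]big_mkcond /=.
  by apply: eq_bigr => j _; rewrite mxE; case: ifP; rewrite ?scale0r.
by rewrite !mxE it.
Qed.

End GradedModule.

(** * Multiderivations in coordinates *)

Section MultiDer.
Context (K : fieldType) (R : comAlgType K).

Lemma is_DerD p (t u : ('I_p -> R) -> R^o) : is_Der t -> is_Der u -> is_Der (t + u).
Proof. by move=> tD uD; rewrite -[t]scale1r; exact: is_DerZD. Qed.

Lemma is_DerZ p a (t : ('I_p -> R) -> R^o) : is_Der t -> is_Der (a *: t).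
Proof. by move=> dt; rewrite -[_ *: _]addr0; apply: is_DerZD dt (is_Der0 _ _). Qed.

Lemma is_Der_sum p (I : Type) (s : seq I) (F : I -> ('I_p -> R) -> R^o) :
  (forall i, is_Der (F i)) -> is_Der (\sum_(i <- s) F i).
Proof.
by move=> FD; elim/big_ind: _ => //; [exact: is_Der0 | exact: is_DerD].
Qed.

Lemma is_Der_wedge p (d : 'I_p -> R -> R) :
  (forall i, derivation (d i)) -> is_Der (wedge d).
Proof.
by move=> dd; exists 1%N, (fun _ => 1), (fun _ => d); rewrite big_ord1 scale1r.
Qed.

Lemma Der_ind p (P : (('I_p -> R) -> R^o) -> Prop) :
  P 0 -> (forall a t u, P t -> P u -> P (a *: t + u)) ->
  (forall d : 'I_p -> R -> R, (forall i, derivation (d i)) -> P (wedge d)) ->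
  forall t, is_Der t -> P t.
Proof.
move=> P0 PZ Pw t [n [c [d [hd ->]]]]; elim/big_ind: _ => // [x y Px Py|i _].
  by rewrite -[x]scale1r; exact: PZ.
by rewrite -[_ *: _]addr0; apply: PZ => //; exact: Pw.
Qed.

Lemma Der_alternate p (t : ('I_p -> R) -> R^o) (f : 'I_p -> R) i j :
  is_Der t -> i != j -> f i = f j -> t f = 0.
Proof.
move=> tD ij fij; move: t tD; apply: Der_ind => //.
  by move=> a t u tf uf; rewrite -[LHS]/(a * t f + u f) tf uf mulr0 addr0.
move=> d _; rewrite /wedge -det_tr (determinant_alternate ij) // => k.
by rewrite !mxE fij.
Qed.

Lemma Der_perm p (t : ('I_p -> R) -> R^o) (f : 'I_p -> R) (s : 'S_p) :
  is_Der t -> t (f \o s) = (-1) ^+ s * t f.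
Proof.
move: t; apply: Der_ind => [|a t u tf uf|d _].
- by rewrite mulr0.
- rewrite -[LHS]/(a * t (f \o s) + u (f \o s)) tf uf mulrDr.
  by rewrite mulrCA.
rewrite /wedge (_ : (\matrix_(i, j) d i ((f \o s) j)) =
  col_perm s (\matrix_(i, j) d i (f j))).
  by rewrite col_permE det_mulmx det_perm mulrC odd_permV.
by apply/matrixP => i j; rewrite !mxE.
Qed.

(** Expanding the determinant along its first column writes the contraction of a wedge as a
    combination of wedges. *)
Lemma Der_contract q (a : R) (t : ('I_q.+1 -> R) -> R^o) :
  is_Der t -> is_Der (fun f => t (cons_arg a f)).
Proof.
move: t; apply: Der_ind => [|b t u tD uD|d hd]; first exact: is_Der0.
  exact: is_DerZD.
rewrite (_ : (fun f => _) = \sum_(i < q.+1) (d i a * (-1) ^+ i) *: wedge (d \o lift i)).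
  apply: is_Der_sum => i; apply: is_DerZ; apply: is_Der_wedge => j; exact: hd.
apply/funext => f; rewrite fct_sumE /wedge (expand_det_col _ ord0).
apply: eq_bigr => i _; rewrite mxE /cofactor /= addn0 mulrA.
rewrite /cons_arg unlift_none /=; congr (_ * \det _).
by apply/matrixP => j k; rewrite !mxE liftK.
Qed.

Section Coordinates.
Context (n : nat) (y : 'I_n -> R) (dy : 'I_n -> R -> R).
Context (dyD : forall i, derivation (dy i)).
Context (dyP : forall d, derivation d -> forall f, d f = \sum_i d (y i) * dy i f).

(** All index maps J occur, not only increasing ones, so that coordinates are compared without
    sorting; [expand_Der] regroups them. *)
Definition expand p (e : {ffun 'I_p -> 'I_n} -> R) : ('I_p -> R) -> R^o :=
  fun f => \sum_(J : {ffun 'I_p -> 'I_n}) (\prod_j dy (J j) (f j)) * e J.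

Lemma Der_expand p (t : ('I_p -> R) -> R^o) :
  is_Der t -> t = expand (fun J => t (y \o J)).
Proof.
move: t; apply: Der_ind => [|a t u tE uE|d hd]; apply/funext => f; rewrite /expand.
- by rewrite big1 // => J _; rewrite mulr0.
- rewrite -[LHS]/(a * t f + u f) {1}tE {1}uE /expand mulr_sumr -big_split /=.
  by apply: eq_bigr => J _; rewrite mulrDr mulrCA.
transitivity (\sum_(s : 'S_p) (-1) ^+ s * \sum_(J : {ffun 'I_p -> 'I_n})
    \prod_j (d (s j) (y (J j)) * dy (J j) (f j))).
  rewrite /wedge -det_tr; apply: eq_bigr => s _; congr (_ * _).
  rewrite -(bigA_distr_bigA (fun j k => d (s j) (y k) * dy k (f j))).
  by apply: eq_bigr => j _; rewrite !mxE (dyP (hd _)).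
under eq_bigr do rewrite mulr_sumr.
rewrite exchange_big /=; apply: eq_bigr => J _.
rewrite /wedge -det_tr mulr_sumr; apply: eq_bigr => s _.
rewrite big_split /= mulrA [RHS]mulrC; congr (_ * _); congr (_ * _).
by apply: eq_bigr => j _; rewrite !mxE.
Qed.

(** Group the injective index maps by their image A and fix one J0 for each A. The others are J0
    after a permutation, so the sign rule collects the group into a single wedge. *)
Lemma expand_Der p (e : {ffun 'I_p -> 'I_n} -> R) :
  (forall J : {ffun 'I_p -> 'I_n}, ~~ injectiveb J -> e J = 0) ->
  (forall (J : {ffun 'I_p -> 'I_n}) (s : 'S_p),
     e [ffun j => J (s j)] = (-1) ^+ s * e J) ->
  is_Der (expand e).
Proof.
move=> e0 es.
pose im (J : {ffun 'I_p -> 'I_n}) := [set J j | j : 'I_p].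
pose rep A := [pick J : {ffun 'I_p -> 'I_n} | injectiveb J && (im J == A)].
rewrite (_ : expand e = \sum_(A : {set 'I_n})
    (if rep A is Some J then e J *: wedge (fun j => dy (J j)) else 0)); last first.
  apply/funext => f; rewrite fct_sumE /expand.
  rewrite (bigID (fun J => injectiveb (J : {ffun _ -> _}))) /=.
  rewrite [X in _ + X]big1 ?addr0; last by move=> J /e0->; rewrite mulr0.
  rewrite (partition_big im predT) //=; apply: eq_bigr => A _.
  rewrite /rep; case: pickP => [J0 /andP[/injectiveP J0I /eqP J0A]|h]; last first.
    by rewrite big_pred0 // => J; exact: h.
  have mem (J : {ffun 'I_p -> 'I_n}) j : injectiveb J && (im J == A) -> J j \in codom J0.
    move=> /andP[_ /eqP JA]; have : J j \in im J by apply/imsetP; exists j.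
    by rewrite JA -J0A => /imsetP[k _ ->]; exact: codom_f.
  have exs (J : {ffun 'I_p -> 'I_n}) : injectiveb J && (im J == A) ->
      exists s : 'S_p, [ffun j => J0 (s j)] = J.
    move=> JP; pose t j := iinv (mem J j JP).
    have tE j : J0 (t j) = J j by exact: f_iinv.
    have tI : injective t.
      have /andP[/injectiveP JI _] := JP.
      by move=> i j ij; apply: JI; rewrite -!tE ij.
    by exists (perm tI); apply/ffunP => j; rewrite ffunE permE.
  pose h (s : 'S_p) := [ffun j => J0 (s j)].
  pose h' (J : {ffun 'I_p -> 'I_n}) := odflt 1%g [pick s : 'S_p | h s == J].
  have hI : injective h.
    move=> s s' /ffunP ss; apply/permP => j; apply: J0I.
    by have := ss j; rewrite !ffunE.
  rewrite (reindex_onto h h') /=; last first.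
    move=> J /exs[s <-]; rewrite /h'; case: pickP => [s' /eqP//|/(_ s)].
    by rewrite eqxx.
  rewrite (eq_bigl xpredT) => [|s]; last first.
    have -> : injectiveb (h s).
      by apply/injectiveP => i j; rewrite !ffunE => /J0I/perm_inj.
    have -> : im (h s) == A.
      rewrite -J0A; apply/eqP/setP => x; apply/imsetP/imsetP => -[j _ ->].
        by exists (s j); rewrite ?ffunE.
      by exists ((s^-1)%g j); rewrite // ffunE permKV.
    rewrite /h'; case: pickP => [s' /eqP/hI->|/(_ s)]; rewrite eqxx //.
  rewrite -[RHS]/(e J0 * wedge (fun j => dy (J0 j)) f) /wedge -det_tr mulr_sumr.
  apply: eq_bigr => s _; rewrite es mulrA mulrC; congr (_ * _).
  by rewrite mulrC; congr (_ * _); apply: eq_bigr => j _; rewrite !mxE ffunE.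
apply: is_Der_sum => A; case: (rep A) => [J|]; last exact: is_Der0.
by apply: is_DerZ; apply: is_Der_wedge.
Qed.

(** Cancelling the regular element b preserves the vanishing and sign rules, so the divided
    coordinates again define a multiderivation. *)
Lemma Der_divide p (b : R) (e : {ffun 'I_p -> 'I_n} -> R) (t : ('I_p -> R) -> R^o) :
  (forall x, b * x = 0 -> x = 0) -> t = expand e ->
  (forall J : {ffun 'I_p -> 'I_n}, ~~ injectiveb J -> e J = 0) ->
  (forall (J : {ffun 'I_p -> 'I_n}) (s : 'S_p),
     e [ffun j => J (s j)] = (-1) ^+ s * e J) ->
  (forall J, exists x, e J = b * x) ->
  exists2 u : ('I_p -> R) -> R^o, is_Der u & t = b *: u.
Proof.
move=> breg tE e0 es /choice[u uE]; exists (expand u).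
  apply: expand_Der => [J J0|J s]; first by apply: breg; rewrite -uE e0.
  by apply/subr0_eq/breg; rewrite mulrBr -uE es uE mulrCA subrr.
apply/funext => f; rewrite tE -[RHS]/(b * expand u f) /expand mulr_sumr.
by apply: eq_bigr => J _; rewrite uE mulrCA.
Qed.

Lemma Der_coords_alternate p (t : ('I_p -> R) -> R^o) (J : {ffun 'I_p -> 'I_n}) :
  is_Der t -> ~~ injectiveb J -> t (y \o J) = 0.
Proof.
move=> tD /injectivePn[i [j ij Jij]]; apply: Der_alternate tD ij _.
by rewrite /= Jij.
Qed.

Lemma Der_coords_perm p (t : ('I_p -> R) -> R^o) (J : {ffun 'I_p -> 'I_n}) (s : 'S_p) :
  is_Der t -> t (y \o [ffun j => J (s j)]) = (-1) ^+ s * t (y \o J).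
Proof.
move=> tD; rewrite -Der_perm //; congr (t _).
by apply/funext => j; rewrite /= ffunE.
Qed.

End Coordinates.

End MultiDer.

(** * Prime elements *)

Section PrimeElements.
Context (R : comNzRingType).
Implicit Types (a b x y z : R).

Definition divides a x : Prop := exists g, x = g * a.

(** A property instead of a structure, because [Sbar a] is built only as a commutative ring. *)
Definition integral : Prop := forall x y : R, x * y = 0 -> x = 0 \/ y = 0.

Definition prime_elt a : Prop :=
  [/\ a <> 0, ~ divides a 1 &
      forall x y, divides a (x * y) -> divides a x \/ divides a y].

Lemma divides_mulr a x y : divides a x -> divides a (x * y).
Proof. by move=> [g ->]; exists (g * y); rewrite mulrAC. Qed.

Lemma divides_mull a x y : divides a y -> divides a (x * y).
Proof. by rewrite mulrC; exact: divides_mulr. Qed.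

Lemma divides_add a x y : divides a x -> divides a y -> divides a (x + y).
Proof. by move=> [g ->] [h ->]; exists (g + h); rewrite mulrDl. Qed.

Lemma divides_trans b a x : divides a b -> divides b x -> divides a x.
Proof. by move=> [g ->] [h ->]; exists (h * g); rewrite mulrA. Qed.

Lemma prime_hom (R' : comNzRingType) (f : {rmorphism R -> R'}) a :
  (forall x y : R', x * y = 0 -> x = 0 \/ y = 0) -> a <> 0 ->
  (forall x, f x = 0 <-> divides a x) -> prime_elt a.
Proof.
move=> iR' a0 fP; split=> // [/fP|x y /fP].
  by rewrite rmorph1 => /eqP; rewrite oner_eq0.
by rewrite rmorphM => /iR'[/fP|/fP]; [left | right].
Qed.

Lemma prime_prod a (I : eqType) (s : seq I) (P : pred I) (F : I -> R) :
  prime_elt a -> divides a (\prod_(i <- s | P i) F i) ->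
  exists i, [/\ i \in s, P i & divides a (F i)].
Proof.
move=> [_ a1 aM]; elim: s => [|i s IHs]; first by rewrite big_nil.
rewrite big_cons; case: ifP => Pi; last first.
  by move=> /IHs[j [js Pj aj]]; exists j; rewrite inE js orbT.
move=> /aM[ai|/IHs[j [js Pj aj]]]; first by exists i; rewrite mem_head.
by exists j; rewrite inE js orbT.
Qed.

Context (iR : integral).

Lemma integral_mulIf a x y : a <> 0 -> x * a = y * a -> x = y.
Proof.
move=> a0 xy; apply/subr0_eq.
have E : (x - y) * a = 0 by rewrite mulrBl xy subrr.
by case: (iR E).
Qed.

Lemma integral_expf_neq0 a k : a <> 0 -> a ^+ k <> 0.
Proof.
move=> a0; elim: k => [|k IHk]; first by apply/eqP; rewrite expr0 oner_eq0.
by rewrite exprS => /iR[].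
Qed.

Lemma integral_prod_neq0 (I : eqType) (s : seq I) (P : pred I) (F : I -> R) :
  (forall i, i \in s -> F i <> 0) -> \prod_(i <- s | P i) F i <> 0.
Proof.
move=> F0; rewrite big_seq_cond; elim/big_ind: _ => [|x y x0 y0 /iR[]//|i].
  by apply/eqP; rewrite oner_eq0.
by case/andP=> /F0.
Qed.

Lemma prime_pow_cancel a k x z : prime_elt a -> ~ divides a x ->
  divides (a ^+ k) (x * z) -> divides (a ^+ k) z.
Proof.
move=> [a0 a1 aM] ax; elim: k => [|k IHk]; first by exists z; rewrite mulr1.
move=> [g gE]; have [|h hE] := IHk; first by exists (g * a); rewrite gE exprS mulrA.
have : x * h = g * a.
  apply: (integral_mulIf (@integral_expf_neq0 a k a0)).
  by rewrite -[LHS]mulrA -hE gE exprS mulrA.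
move=> xh; have /aM[//|[u uE]] : divides a (x * h) by exists g.
by exists u; rewrite hE uE exprS mulrA.
Qed.

(** Peel off one prime at a time: F i divides no other F j, so its power must divide the cofactor
    g. *)
Lemma prod_primes_divides (I : eqType) (s : seq I) (P : pred I) (F : I -> R)
    (k : I -> nat) z : uniq s ->
  (forall i, i \in s -> prime_elt (F i)) ->
  (forall i j, i \in s -> j \in s -> i != j -> ~ divides (F i) (F j)) ->
  (forall i, i \in s -> P i -> divides (F i ^+ k i) z) ->
  divides (\prod_(i <- s | P i) F i ^+ k i) z.
Proof.
elim: s => [|i s IHs] /=; first by exists z; rewrite big_nil mulr1.
move=> /andP[is_ us] pF nF dF.
have [||j js|g gE] := IHs us.
- by move=> j js; apply: pF; rewrite inE js orbT.
- by move=> j j' js js'; apply: nF; rewrite inE ?js ?js' orbT.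
- by apply: dF; rewrite inE js orbT.
rewrite big_cons; case: ifP => Pi; last by exists g.
have [h hE] : divides (F i ^+ k i) g.
  apply: (@prime_pow_cancel _ _ (\prod_(j <- s | P j) F j ^+ k j)).
  - exact/pF/mem_head.
  - move=> /(prime_prod (pF i (mem_head _ _)))[j [js _]].
    elim: (k j) => [|m IHm].
      by rewrite expr0; have [_ h1 _] := pF i (mem_head _ _).
    rewrite exprS; have [_ _ h] := pF i (mem_head _ _); move=> /h[|//].
    apply: nF; rewrite ?mem_head ?inE ?js ?orbT //.
    by apply: contraNneq is_ => ->.
  by rewrite mulrC -gE; apply: dF => //; exact: mem_head.
by exists h; rewrite gE hE -mulrA.
Qed.

(** For j other than i0, F j divides f i0, hence f j * c i0, but it does not divide f j. So f i0
    divides c i0, and the quotient v serves every i by cross-multiplication. *)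
Lemma compatible_quotients (I : eqType) (s : seq I) (F c : I -> R) (i0 : I) :
  uniq s -> i0 \in s ->
  (forall i, i \in s -> prime_elt (F i)) ->
  (forall i j, i \in s -> j \in s -> i != j -> ~ divides (F i) (F j)) ->
  let f i := \prod_(j <- s | j != i) F j in
  (forall i j, i \in s -> j \in s -> f j * c i = f i * c j) ->
  exists v, forall i, i \in s -> c i = v * f i.
Proof.
move=> us i0s pF nF f fc.
have F0 i : i \in s -> F i <> 0 by move=> /pF[].
have [v vE] : divides (f i0) (c i0).
  have := @prod_primes_divides _ s (fun j => j != i0) F (fun _ => 1%N) (c i0) us pF nF.
  under eq_bigr do rewrite expr1.
  apply=> j js ji0; rewrite expr1.
  have : divides (F j) (f j * c i0).
    rewrite fc //; apply: divides_mulr; rewrite /f (big_rem j) //= ji0.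
    exact/divides_mulr/(ex_intro _ 1 (esym (mul1r _))).
  have [_ _ /[apply]] := pF j js; case=> //.
  move=> /(prime_prod (pF j js))[i [is_ ij]].
  by have := nF j i js is_; rewrite eq_sym ij => /(_ isT).
exists v => i is_; apply: (integral_mulIf (a := f i0)).
  by apply: integral_prod_neq0 => j; exact: F0.
by rewrite mulrC fc // vE mulrCA mulrA.
Qed.

End PrimeElements.

(** * Linear forms *)

Section Polynomials.
Context (K : fieldType) (l : nat).
Local Notation S := {mpoly K[l]}.
Local Notation ev b v := ((b : S).@[fun i => v 0 i]).
Implicit Types (a b : linform K l) (c : K) (v w : 'rV[K]_l).

Lemma mpoly_gen_ind (P : S -> Prop) :
  (forall c, P c%:MP) -> (forall i, P 'X_i) ->
  (forall p q, P p -> P q -> P (p + q)) ->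
  (forall p q, P p -> P q -> P (p * q)) -> forall p, P p.
Proof.
move=> PC PX PD PM; elim/mpolyind => [|c m p _ _ Pp]; first by rewrite -mpolyC0.
apply: (PD) => //; rewrite -mul_mpolyC; apply: (PM) => //.
rewrite mpolyXE_id; elim/big_ind: _ => [|p1 p2 P1 P2|i _]; [by rewrite -mpolyC1 | exact: PM |].
elim: (m i) => [|k IHk]; first by rewrite expr0 -mpolyC1.
by rewrite exprS; exact: PM.
Qed.

Lemma mpoly_rmorph_ext (B : nzRingType) (f g : {rmorphism S -> B}) :
  (forall c, f c%:MP = g c%:MP) -> (forall i, f 'X_i = g 'X_i) -> f =1 g.
Proof.
move=> fgC fgX; apply: mpoly_gen_ind => // p q pE qE.
  by rewrite !rmorphD pE qE.
by rewrite !rmorphM pE qE.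
Qed.

Lemma mderivXU (i j : 'I_l) : ('X_j : S)^`M(i) = (j == i)%:R.
Proof.
rewrite mderivX mnm1E; case: eqVneq => [->|_]; last by rewrite scale0r.
rewrite scale1r (_ : (U_(i) - U_(i))%MM = 0%MM) ?mpolyX0 //.
by apply/mnmP => k; rewrite mnmBE subnn mnm0E.
Qed.

(** Stated for derivations along a ring map, to cover derivations of S, derivations of [Sbar a]
    composed with [proj a], and composites with [shear]. *)
Lemma chain_rule (B : comNzRingType) (f : {rmorphism S -> B}) (d : S -> B) :
  {morph d : x y / x + y} -> (forall c, d c%:MP = 0) ->
  (forall x y, d (x * y) = d x * f y + f x * d y) ->
  forall x, d x = \sum_i d 'X_i * f (x^`M(i)).
Proof.
move=> dD dC dM; apply: mpoly_gen_ind => [c|i|p q pE qE|p q pE qE].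
- by rewrite dC big1 // => i _; rewrite mderivC rmorph0 mulr0.
- rewrite (bigD1 i) //= big1 ?addr0 => [|j ji].
    by rewrite mderivXU eqxx rmorph1 mulr1.
  by rewrite mderivXU eq_sym (negPf ji) rmorph0 mulr0.
- rewrite dD pE qE -big_split; apply: eq_bigr => i _ /=.
  by rewrite mderivD rmorphD mulrDr.
rewrite dM pE qE mulr_suml mulr_sumr -big_split; apply: eq_bigr => i _ /=.
by rewrite mderivM rmorphD !rmorphM mulrDr !mulrA (mulrC (f p)).
Qed.

Lemma derivationC (B : comAlgType K) (d : B -> B) (c : K) :
  derivation d -> d c%:A = 0.
Proof.
move=> [dl dM]; have d1 : d 1 = 0.
  by have := dM 1 1; rewrite !mulr1 mul1r => /eqP; rewrite -subr_eq0 opprD addrA subrr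
    sub0r oppr_eq0 => /eqP.
have d0 : d 0 = 0 by have := dl (-1) 0 0; rewrite scaler0 addr0 scaleN1r addNr.
by have := dl c 1 0; rewrite addr0 d1 d0 scaler0 addr0.
Qed.

Lemma derivationD (B : comAlgType K) (d : B -> B) : derivation d ->
  {morph d : x y / x + y}.
Proof. by move=> [dl _] x y; have := dl 1 x y; rewrite !scale1r. Qed.

Lemma mderiv_derivation (i : 'I_l) : derivation (fun x : S => x^`M(i)).
Proof. by split=> [c x y|x y]; [exact: mderiv_is_linear | exact: mderivM]. Qed.

Lemma derivation_coords (d : S -> S) : derivation d ->
  forall x, d x = \sum_i d 'X_i * x^`M(i).
Proof.
move=> dd x; have := @chain_rule S idfun d.
apply; [exact: derivationD | | exact: dd.2].
by move=> c; rewrite -alg_mpolyC; exact: derivationC.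
Qed.

Lemma linformE a : (a : S) = \sum_i ((a : S)@_U_(i))%:MP * 'X_i.
Proof.
apply/mpolyP => m; rewrite raddf_sum /=.
have E i : (((a : S)@_U_(i))%:MP * 'X_i)@_m = (a : S)@_U_(i) * (U_(i)%MM == m)%:R.
  by rewrite mul_mpolyC mcoeffZ mcoeffX.
under eq_bigr do rewrite E.
have [m1|m1] := eqVneq (mdeg m) 1%N; last first.
  rewrite (dhomog_nemf_coeff (dhomog_is_dhomog a) m1) big1 // => i _.
  by case: eqVneq => [mi|]; rewrite ?mulr0 //; rewrite -mi mdeg1 eqxx in m1.
move/eqP: m1; rewrite mdeg_eq1 => /existsP[j /eqP->].
rewrite (bigD1 j) //= eqxx mulr1 big1 ?addr0 // => i ij.
case: eqVneq; rewrite ?mulr0 // => /mnmP/(_ j); rewrite !mnm1E eqxx (negPf ij).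
by [].
Qed.

Lemma evE a v : ev a v = \sum_i (a : S)@_U_(i) * v 0 i.
Proof.
rewrite {1}linformE raddf_sum /=; apply: eq_bigr => i _.
by rewrite mevalM mevalC mevalXU.
Qed.

Lemma ev_linear a (c : K) v w : ev a (c *: v + w) = c * ev a v + ev a w.
Proof.
rewrite !evE mulr_sumr -big_split; apply: eq_bigr => i _ /=.
by rewrite !mxE mulrDr mulrCA.
Qed.

Lemma ev_delta a i : ev a (delta_mx 0 i : 'rV[K]_l) = (a : S)@_U_(i).
Proof.
rewrite evE (bigD1 i) //= mxE !eqxx mulr1 big1 ?addr0 // => j ji.
by rewrite mxE (negPf ji) andbF mulr0.
Qed.

Lemma linform_ext a b : (forall v, ev a v = ev b v) -> (a : S) = b.
Proof.
move=> ab; rewrite (linformE a) (linformE b); apply: eq_bigr => i _.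
by rewrite -!ev_delta ab.
Qed.

Lemma linform_dual a : (a : S) <> 0 -> exists w, ev a w = 1.
Proof.
move=> a0; have [i ai] : exists i, (a : S)@_U_(i) != 0.
  apply: contrapT => /forallNP h; apply: a0; rewrite linformE big1 // => i _.
  by have /negP := h i; rewrite negbK => /eqP->; rewrite mpolyC0 mul0r.
exists (((a : S)@_U_(i))^-1 *: delta_mx 0 i : 'rV[K]_l).
have := ev_linear a ((a : S)@_U_(i))^-1 (delta_mx 0 i) 0; rewrite addr0 => ->.
rewrite ev_delta mulVf // evE big1 ?addr0 // => j _.
by rewrite mxE mulr0.
Qed.

(** If b(w) = 1 then v - b(v) w lies in the kernel of b, so a(v) = a(w) b(v). *)
Lemma linform_prop a b :
  (b : S) <> 0 -> (forall v, ev b v = 0 -> ev a v = 0) ->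
  exists x : K, (a : S) = x%:MP * b.
Proof.
move=> /linform_dual[w bw] ba; exists (ev a w).
rewrite mul_mpolyC; apply: (@linform_ext a (ev a w *: b)) => v.
have /ba : ev b (- ev b v *: w + v) = 0 by rewrite ev_linear bw mulr1 addNr.
rewrite ev_linear => /eqP; rewrite mulNr addrC subr_eq0 => /eqP->.
by rewrite mevalZ mulrC.
Qed.

Lemma mderiv_linform a i : (a : S)^`M(i) = ((a : S)@_U_(i))%:MP.
Proof.
rewrite {1}linformE linear_sum /= (bigD1 i) //= big1 ?addr0 => [|j ji].
  by rewrite mderiv_mulC mderivXU eqxx mulr1.
by rewrite mderiv_mulC mderivXU (negPf ji) mulr0.
Qed.

Definition dirder w (x : S) : S := \sum_i (w 0 i)%:MP * x^`M(i).

Lemma dirder_derivation w : derivation (dirder w).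
Proof.
split=> [c x y|x y]; rewrite /dirder.
  rewrite scaler_sumr -big_split; apply: eq_bigr => i _ /=.
  by rewrite mderivD mderivZ mulrDr scalerAr.
rewrite mulr_suml mulr_sumr -big_split; apply: eq_bigr => i _ /=.
by rewrite mderivM mulrDr; congr (_ + _); [exact: mulrA | exact: mulrCA].
Qed.

Lemma dirder_linform w a : dirder w a = (ev a w)%:MP.
Proof.
rewrite evE raddf_sum; apply: eq_bigr => i _ /=.
by rewrite mderiv_linform mpolyCM mulrC.
Qed.

(* Substitution along the projection v |-> v - a(v) w onto the kernel of a. *)
Definition shear a w : S -> S :=
  mmap (@mpolyC l K) (fun i => 'X_i - (w 0 i)%:MP * (a : S)).
HB.instance Definition _ a w := GRing.RMorphism.on (shear a w).

Lemma shearC a w c : shear a w c%:MP = c%:MP.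
Proof. exact: mmapC. Qed.

Lemma shearX a w i : shear a w 'X_i = 'X_i - (w 0 i)%:MP * (a : S).
Proof. by rewrite /shear mmapX mmap1U. Qed.

Lemma shear_linform a w b : shear a w b = (b : S) - (ev b w)%:MP * (a : S).
Proof.
rewrite {1 2}(linformE b) rmorph_sum /= evE raddf_sum mulr_suml -sumrB.
apply: eq_bigr => i _ /=.
by rewrite rmorphM /= shearC shearX mulrBr mpolyCM mulrA.
Qed.

Lemma proj_gen a : proj a (a : S) = 0.
Proof. by apply/proj_eq0; exists 1; rewrite mul1r. Qed.

Lemma proj_shear a w x : proj a (shear a w x) = proj a x.
Proof.
apply: (mpoly_rmorph_ext (f := proj a \o shear a w)) => [c|i] /=.
  by rewrite shearC.
by rewrite shearX rmorphB rmorphM /= proj_gen mulr0 subr0.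
Qed.

Lemma shear_eq0 a w x : ev a w = 1 -> shear a w x = 0 <-> divides (a : S) x.
Proof.
move=> aw; split=> [sx|[g ->]].
  by apply/proj_eq0; rewrite -(proj_shear a w) sx rmorph0.
by rewrite rmorphM /= shear_linform aw mpolyC1 mul1r subrr mulr0.
Qed.

Lemma mpoly_integral (x y : S) : x * y = 0 -> x = 0 \/ y = 0.
Proof.
by move=> /eqP; rewrite mulf_eq0 => /orP[/eqP|/eqP]; [left | right].
Qed.

Lemma linform_prime a : (a : S) <> 0 -> prime_elt (a : S).
Proof.
move=> a0; have [w aw] := linform_dual a0.
apply: (prime_hom (f := shear a w)) => //; first exact: mpoly_integral.
by move=> x; exact: shear_eq0.
Qed.

Section QuotientSection.
Context a w (aw : ev a w = 1).

(** The ring section of [proj a]: the shear kills multiples of a, so the representative is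
    immaterial. The phantom argument makes the morphism structure inferable. *)
Definition sec of ev a w = 1 : Sbar a -> S := fun x => shear a w (repr x).

Lemma sec_proj x : sec aw (proj a x) = shear a w x.
Proof.
apply/subr0_eq; rewrite /sec -rmorphB; apply/(shear_eq0 _ aw)/proj_eq0.
by rewrite rmorphB /= proj_repr subrr.
Qed.

Lemma secK : cancel (sec aw) (proj a).
Proof. by move=> x; rewrite /sec proj_shear proj_repr. Qed.

Fact sec_is_zmod_morphism : zmod_morphism (sec aw).
Proof.
by move=> x y; rewrite -{1}(proj_repr x) -{1}(proj_repr y) -rmorphB /= sec_proj rmorphB.
Qed.
Fact sec_is_monoid_morphism : monoid_morphism (sec aw).
Proof.
split; first by rewrite -(rmorph1 (proj a)) sec_proj rmorph1.
by move=> x y; rewrite -{1}(proj_repr x) -{1}(proj_repr y) -rmorphM /= sec_proj rmorphM.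
Qed.
HB.instance Definition _ :=
  GRing.isZmodMorphism.Build (Sbar a) S (sec aw) sec_is_zmod_morphism.
HB.instance Definition _ :=
  GRing.isMonoidMorphism.Build (Sbar a) S (sec aw) sec_is_monoid_morphism.

Lemma Sbar_integral : integral (Sbar a).
Proof.
move=> x y /(congr1 (sec aw)); rewrite rmorphM rmorph0 => /mpoly_integral.
by case=> h; [left; rewrite -(secK x) | right; rewrite -(secK y)];
  rewrite h rmorph0.
Qed.

(** The section sends the class of b to the form b' with b'(w) = 0. Followed by the shear along b',
    it is a map to a domain whose kernel is generated by that class. *)
Lemma proj_linform_prime b : proj a b <> 0 -> prime_elt (proj a b).
Proof.
move=> b0; pose b' : linform K l := b - ev b w *: a.
have b'E : (b' : S) = (b : S) - (ev b w)%:MP * (a : S) by rewrite mul_mpolyC.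
have b'p : proj a b' = proj a b.
  by rewrite b'E rmorphB rmorphM /= proj_gen mulr0 subr0.
have b'0 : (b' : S) <> 0 by move=> h; apply: b0; rewrite -b'p h rmorph0.
have [w' bw'] := linform_dual b'0.
have secb : sec aw (proj a b) = b' by rewrite sec_proj shear_linform -b'E.
apply: (prime_hom (f := shear b' w' \o sec aw)) => //; first exact: mpoly_integral.
move=> x; rewrite /=; split=> [/(shear_eq0 _ bw')[g gE]|[g ->]].
  by exists (proj a g); rewrite -[LHS]secK gE rmorphM -b'p.
by apply/(shear_eq0 _ bw'); exists (sec aw g); rewrite rmorphM /= secb.
Qed.

End QuotientSection.

Lemma ev_shear a w v x : (shear a w x).@[fun i => v 0 i]
  = x.@[fun i => (v - ev a v *: w) 0 i].
Proof.
pose f : {rmorphism S -> K} := meval (fun i => v 0 i) \o shear a w.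
pose g : {rmorphism S -> K} := meval (fun i => (v - ev a v *: w) 0 i).
apply: (mpoly_rmorph_ext (f := f) (g := g)) => [c|i]; rewrite /f /g /=.
  by rewrite shearC !mevalC.
by rewrite shearX mevalB mevalM !mevalXU mevalC !mxE mulrC.
Qed.

(** Shearing along a evaluates forms at points v - a(v) w of the kernel of a, which reduces the
    claim to [linform_prop]. *)
Lemma proj_linform_assoc a b (c : linform K l) : (a : S) <> 0 -> proj a c <> 0 ->
  (forall v, ev a v = 0 -> ev c v = 0 -> ev b v = 0) ->
  exists x : K, proj a b = proj a x%:MP * proj a c.
Proof.
move=> /linform_dual[w aw] c0 cb.
pose sh (d : linform K l) : linform K l := d - ev d w *: a.
have shE d : (sh d : S) = shear a w d by rewrite shear_linform mul_mpolyC.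
have sh0 : (sh c : S) <> 0.
  by rewrite shE => h; apply: c0; rewrite -(proj_shear _ w) h rmorph0.
have [v|x xE] := @linform_prop (sh b) (sh c) sh0.
  rewrite !shE !ev_shear; apply: cb.
  by rewrite addrC -scaleNr ev_linear aw mulr1 addNr.
exists x; rewrite -(proj_shear _ w b) -(proj_shear _ w c) -!shE xE rmorphM.
by [].
Qed.

(** Some v in the kernel of a has b(v) nonzero, since b is no multiple of a; correcting w0 by a
    multiple of v kills b and keeps a. *)
Lemma linform_dual2 a b : (a : S) <> 0 -> proj a b <> 0 ->
  exists w, ev a w = 1 /\ ev b w = 0.
Proof.
move=> a0 b0; have [w0 aw0] := linform_dual a0.
have : exists v : 'rV[K]_l, ev a v = 0 /\ ev b v <> 0.
  apply: contrapT => /forallNP h; apply: b0.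
  have [|x xE] := @linform_prop b a a0.
    by move=> v av; apply: contrapT => bv; apply: (h v).
  by rewrite xE rmorphM /= proj_gen mulr0.
move=> [v [av bv]]; exists (- (ev b w0 / ev b v) *: v + w0).
rewrite !ev_linear av mulr0 add0r aw0; split=> //.
by rewrite mulNr mulfVK ?addNr //; exact/eqP.
Qed.

End Polynomials.

(** * Multiderivations of the quotient by a linear form *)

Section QuotientDerivations.
Context (K : fieldType) (l : nat).
Local Notation S := {mpoly K[l]}.
Local Notation ev b v := ((b : S).@[fun i => v 0 i]).

Lemma cons_arg0 (T : Type) q (x : T) (f : 'I_q -> T) : cons_arg x f ord0 = x.
Proof. by rewrite /cons_arg unlift_none. Qed.

Lemma cons_argS (T : Type) q (x : T) (f : 'I_q -> T) i :
  cons_arg x f (lift ord0 i) = f i.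
Proof. by rewrite /cons_arg liftK. Qed.

Lemma cons_argE (T : Type) q (f : 'I_q.+1 -> T) :
  f = cons_arg (f ord0) (f \o lift ord0).
Proof.
apply/funext => i; case: (unliftP ord0 i) => [j ->|->].
  by rewrite cons_argS.
by rewrite cons_arg0.
Qed.

Lemma Der_coords p (t : ('I_p -> S) -> S^o) : is_Der t ->
  t = expand (fun i x => x^`M(i)) (fun J => t ((fun i => 'X_i) \o J)).
Proof. by apply: Der_expand => d; exact: derivation_coords. Qed.

Lemma Der_contract_divides q (t : ('I_q.+1 -> S) -> S^o) (b c : S) : is_Der t ->
  (forall J : {ffun 'I_q -> 'I_l},
     divides c (t (cons_arg b (fun j => 'X_(J j))))) ->
  forall f, divides c (t (cons_arg b f)).
Proof.
move=> tD tJ f; have /Der_coords/(congr1 (fun u => u f)) := Der_contract b tD.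
rewrite /expand => ->; elim/big_ind: _ => [|x y|J _].
- by exists 0; rewrite mul0r.
- exact: divides_add.
- exact/divides_mull/tJ.
Qed.

Lemma Der_arg0_derivation (R : comAlgType K) q (t : ('I_q.+1 -> R) -> R^o)
    (g : 'I_q -> R) : is_Der t -> derivation (fun x => t (cons_arg x g) : R).
Proof.
move: t; apply: Der_ind => [|b t u tD uD|e eD].
- by split=> [c x y|x y]; rewrite -!/(0 : R) ?scaler0 ?mul0r ?mulr0 addr0.
- have E x : (b *: t + u) (cons_arg x g) = b * t (cons_arg x g) + u (cons_arg x g).
    by [].
  split=> [c x y|x y]; rewrite !E.
    have /= -> := tD.1 c x y; have /= -> := uD.1 c x y.
    by rewrite mulrDr scalerDr -scalerAr addrACA.
  have /= -> := tD.2 x y; have /= -> := uD.2 x y.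
  by rewrite !mulrDr !mulrDl !mulrA (mulrC x b) addrACA.
(* Cofactors along the first column do not involve the first argument, so 0 can stand there. *)
pose C i := cofactor (\matrix_(i, j) e i (cons_arg 0 g j)) i ord0.
have wE x : wedge e (cons_arg x g) = \sum_i e i x * C i.
  rewrite /wedge (expand_det_col _ ord0); apply: eq_bigr => i _.
  rewrite mxE cons_arg0; congr (_ * _); rewrite /C /cofactor.
  by congr (_ * \det _); apply/matrixP => j k; rewrite !mxE !cons_argS.
split=> [c x y|x y]; rewrite !wE.
  rewrite scaler_sumr -big_split; apply: eq_bigr => i _ /=.
  by rewrite (eD i).1 mulrDl scalerAl.
rewrite mulr_suml mulr_sumr -big_split; apply: eq_bigr => i _ /=.
by rewrite (eD i).2 mulrDl mulrAC mulrA.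
Qed.

Section WithSection.
Context (a : linform K l) (w : 'rV[K]_l) (aw : ev a w = 1).

(** Partial derivatives transported through the section. They are dependent, as their combination
    with coefficients w_i vanishes, but they still serve as the derivations in [expand]. *)
Definition dsec (i : 'I_l) (x : Sbar a) : Sbar a := proj a ((sec aw x)^`M(i)).

Lemma scaleSbarE (c : K) (x : Sbar a) : c *: x = proj a c%:MP * x.
Proof. by []. Qed.

Lemma dsec_derivation i : derivation (dsec i).
Proof.
split=> [c x y|x y]; rewrite /dsec.
  rewrite !scaleSbarE rmorphD rmorphM /= sec_proj shearC mderivD mderiv_mulC.
  by rewrite rmorphD rmorphM.
by rewrite rmorphM /= mderivM rmorphD !rmorphM /= !secK.
Qed.

Lemma proj_derivation_chain (d : Sbar a -> Sbar a) : derivation d ->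
  forall x, d (proj a x) = \sum_i d (proj a 'X_i) * proj a (x^`M(i)).
Proof.
move=> dd; apply: (@chain_rule _ _ _ (proj a) (d \o proj a)) => [x y|c|x y] /=.
- by rewrite rmorphD /= derivationD.
- rewrite (_ : proj a c%:MP = c%:A); first exact: derivationC.
  by rewrite scaleSbarE mulr1.
- by rewrite rmorphM /= dd.2.
Qed.

Lemma dbar_expand q (t : ('I_q.+1 -> S) -> S^o) : is_Der t ->
  dbar a t = expand dsec (fun J => proj a (t (cons_arg (a : S) (fun j => 'X_(J j))))).
Proof.
move=> tD; apply/funext => g.
have gE : g = (fun j => proj a (sec aw (g j))) by apply/funext => j; rewrite secK.
rewrite {1}gE dbarE //.
have /Der_coords/(congr1 (fun u => u (fun j => sec aw (g j)))) := Der_contract (a : S) tD.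
rewrite /= => ->; rewrite /expand rmorph_sum /=; apply: eq_bigr => J _.
by rewrite rmorphM rmorph_prod.
Qed.

Section Lift.
Context (d : Sbar a -> Sbar a) (dD : derivation d).

(** Coefficients in the image of the section make this lift kill a and commute with the section
    exactly, not just modulo a. *)
Definition lift_der (x : S) : S := \sum_i sec aw (d (proj a 'X_i)) * x^`M(i).

Lemma lift_derD : {morph lift_der : x y / x + y}.
Proof.
move=> x y; rewrite /lift_der -big_split; apply: eq_bigr => i _ /=.
by rewrite mderivD mulrDr.
Qed.

Lemma lift_derC c x : lift_der (c%:MP * x) = c%:MP * lift_der x.
Proof.
by rewrite /lift_der mulr_sumr; apply: eq_bigr => i _; rewrite mderiv_mulC mulrCA.
Qed.

Lemma lift_derM x y : lift_der (x * y) = lift_der x * y + x * lift_der y.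
Proof.
rewrite /lift_der mulr_suml mulr_sumr -big_split; apply: eq_bigr => i _ /=.
by rewrite mderivM mulrDr; congr (_ + _); [exact: mulrA | exact: mulrCA].
Qed.

Lemma lift_der_derivation : derivation lift_der.
Proof.
split=> [c x y|]; last exact: lift_derM.
by rewrite lift_derD -!mul_mpolyC lift_derC.
Qed.

Lemma proj_lift_der x : proj a (lift_der x) = d (proj a x).
Proof.
rewrite (proj_derivation_chain dD) rmorph_sum /=; apply: eq_bigr => i _.
by rewrite rmorphM /= secK.
Qed.

(** The partial derivatives of a are constants, fixed by the section, so the value is the section of
    d applied to the class of a, which is 0. *)
Lemma lift_der_gen : lift_der a = 0.
Proof.
have d0 : d 0 = 0 by apply: (addIr (d 0)); rewrite -derivationD // !add0r.
have -> : lift_der a = sec aw (d (proj a (a : S))).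
  rewrite (proj_derivation_chain dD) rmorph_sum; apply: eq_bigr => i _.
  by rewrite rmorphM /= mderiv_linform sec_proj shearC.
by rewrite proj_gen d0 rmorph0.
Qed.

Lemma lift_der_shearX i : lift_der (shear a w 'X_i) = lift_der 'X_i.
Proof.
rewrite shearX -mulNr -mpolyCN lift_derD lift_derC lift_der_gen.
by rewrite mulr0 addr0.
Qed.

Lemma lift_der_shear x : lift_der (shear a w x) = sec aw (d (proj a x)).
Proof.
rewrite -[LHS]/((lift_der \o shear a w) x).
rewrite (@chain_rule _ _ _ (shear a w) (lift_der \o shear a w)) /=.
- rewrite (proj_derivation_chain dD) rmorph_sum; apply: eq_bigr => i _ /=.
  rewrite rmorphM /= sec_proj lift_der_shearX; congr (_ * _).
  rewrite /lift_der (bigD1 i) //= mderivXU eqxx mulr1 big1 ?addr0 // => j ji.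
  by rewrite mderivXU eq_sym (negPf ji) mulr0.
- by move=> y z /=; rewrite rmorphD /= lift_derD.
- move=> c /=; rewrite shearC -alg_mpolyC; exact: (derivationC _ lift_der_derivation).
- by move=> y z /=; rewrite rmorphM /= lift_derM.
Qed.

End Lift.

Lemma wedge_sec q (d : 'I_q -> Sbar a -> Sbar a) (f : 'I_q -> S) :
  (forall i, derivation (d i)) ->
  wedge (fun i => lift_der (d i)) (fun j => shear a w (f j)) =
  sec aw (wedge d (fun j => proj a (f j))).
Proof.
move=> dD; rewrite /wedge -det_map_mx; congr (\det _).
by apply/matrixP => i j; rewrite !mxE lift_der_shear.
Qed.

(** A variable and its shear have the same image under [lift_der], so both kinds of argument may be
    mixed. *)
Lemma wedge_shearX q (d : 'I_q -> Sbar a -> Sbar a) (f g : 'I_q -> S) :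
  (forall i, derivation (d i)) ->
  (forall j, g j = shear a w (f j) \/ exists i, f j = 'X_i /\ g j = 'X_i) ->
  wedge (fun i => lift_der (d i)) g = sec aw (wedge d (fun j => proj a (f j))).
Proof.
move=> dD gf; rewrite -wedge_sec // /wedge; congr (\det _).
apply/matrixP => i j; rewrite !mxE.
by have [->//|[k [-> ->]]] := gf j; rewrite lift_der_shearX.
Qed.

(** The first column is (1, 0, ..., 0): d_w(a) = 1 and the lifts kill a. *)
Lemma wedge_cons_gen q (d : 'I_q -> Sbar a -> Sbar a) (f : 'I_q -> S) :
  (forall i, derivation (d i)) ->
  wedge (cons_arg (dirder w) (fun i => lift_der (d i))) (cons_arg (a : S) f) =
  wedge (fun i => lift_der (d i)) f.
Proof.
move=> dD; rewrite /wedge (expand_det_col _ ord0) (bigD1 ord0) //= big1 ?addr0.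
  rewrite mxE !cons_arg0 dirder_linform aw mpolyC1 mul1r /cofactor /= expr0 mul1r.
  by congr (\det _); apply/matrixP => i j; rewrite !mxE !cons_argS.
move=> i i0; case: (unliftP ord0 i) i0 => [j ->|->]; last by rewrite eqxx.
by rewrite mxE cons_argS cons_arg0 lift_der_gen // mul0r.
Qed.

Lemma wedge_cons_row q (d : 'I_q -> Sbar a -> Sbar a) (f : 'I_q.+1 -> S) :
  wedge (cons_arg (dirder w) (fun i => lift_der (d i))) f =
  \sum_j (dirder w (f j) * (-1) ^+ j) *
    wedge (fun i => lift_der (d i)) (f \o lift j).
Proof.
rewrite /wedge (expand_det_row _ ord0); apply: eq_bigr => j _.
rewrite mxE cons_arg0 /cofactor add0n mulrA; congr (_ * \det _).
by apply/matrixP => i k; rewrite !mxE !cons_argS.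
Qed.

(** The lift is u = d_w /\ v, where v lifts t. Expanding along the row of d_w, the term where d_w
    meets b vanishes because b(w) = 0, and in the others b is still the first argument of v. *)
Lemma Der_lift q (t : ('I_q -> Sbar a) -> (Sbar a)^o) : is_Der t ->
  exists u : ('I_q.+1 -> S) -> S^o,
    [/\ is_Der u, dbar a u = t &
      forall b : linform K l, ev b w = 0 ->
        (forall g (i : 'I_q), val i = 0%N -> g i = proj a b ->
           divides (proj a b) (t g)) ->
        forall (f : 'I_q.+1 -> S) (i : 'I_q.+1), val i = 0%N -> f i = b ->
          divides (b : S) (u f)].
Proof.
move=> [n [c [d [dD tE]]]].
pose u := \sum_(k < n) sec aw (c k) *:
  wedge (cons_arg (dirder w) (fun i => lift_der (d k i))).
pose v : ('I_q -> S) -> S^o :=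
  \sum_(k < n) sec aw (c k) *: wedge (fun i => lift_der (d k i)).
have uE f : u f = \sum_(k < n) sec aw (c k) *
    wedge (cons_arg (dirder w) (fun i => lift_der (d k i))) f.
  by rewrite /u fct_sumE.
have vE f : v f = \sum_(k < n) sec aw (c k) *
    wedge (fun i => lift_der (d k i)) f.
  by rewrite /v fct_sumE.
have tE' g : t g = \sum_(k < n) c k * wedge (d k) g by rewrite tE fct_sumE.
have uD : is_Der u.
  apply: is_Der_sum => k; apply: is_DerZ; apply: is_Der_wedge => i.
  case: (unliftP ord0 i) => [j ->|->]; rewrite ?cons_argS ?cons_arg0.
    exact: lift_der_derivation.
  exact: dirder_derivation.
have vD : is_Der v.
  apply: is_Der_sum => k; apply: is_DerZ; apply: is_Der_wedge => i.
  exact: lift_der_derivation.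
exists u; split=> //.
  apply/funext => g.
  have gE : g = (fun j => proj a (sec aw (g j))) by apply/funext => j; rewrite secK.
  rewrite {1}gE dbarE // uE tE' rmorph_sum; apply: eq_bigr => k _ /=.
  rewrite rmorphM /= secK wedge_cons_gen //; congr (_ * _).
  rewrite /wedge -det_map_mx; congr (\det _); apply/matrixP => i j.
  by rewrite !mxE /= proj_lift_der // secK.
move=> b bw tb.
have vb (f : 'I_q -> S) (i : 'I_q) : val i = 0%N -> f i = b -> divides (b : S) (v f).
  case: q c d dD t tE {u uE uD} v vE tE' vD tb f i => [|q] c d dD t tE v vE tE' vD tb f i.
    by case: i.
  move=> i0; have {i i0}-> : i = ord0 by exact: val_inj.
  move=> f0; rewrite (cons_argE f) f0; move: (f \o lift ord0) => {f f0}.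
  (* It suffices to put variables in the other slots; there v is the section of a value of t. *)
  apply: Der_contract_divides => // J.
  pose f := cons_arg (b : S) (fun j : 'I_q => 'X_(J j)).
  have sb : shear a w b = b by rewrite shear_linform bw mpolyC0 mul0r subr0.
  have -> : v f = sec aw (t (fun j => proj a (f j))).
    rewrite vE tE' rmorph_sum; apply: eq_bigr => k _ /=.
    rewrite rmorphM /=; congr (_ * _).
    apply: wedge_shearX => // j; case: (unliftP ord0 j) => [j' ->|->].
      by right; exists (J j'); rewrite /f cons_argS.
    by left; rewrite /f cons_arg0 sb.
  have [||g ->] := tb (fun j => proj a (f j)) ord0 => //.
    by rewrite /f cons_arg0.
  by exists (sec aw g); rewrite rmorphM /= sec_proj sb.
move=> f i i0; have {i i0}-> : i = ord0 by exact: val_inj.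
move=> f0.
have -> : u f = \sum_j (dirder w (f j) * (-1) ^+ j) * v (f \o lift j).
  rewrite uE; under eq_bigr do rewrite wedge_cons_row mulr_sumr.
  rewrite exchange_big /=; apply: eq_bigr => j _.
  by rewrite vE mulr_sumr; apply: eq_bigr => k _; rewrite mulrCA.
elim/big_ind: _ => [|x y|j _]; [by exists 0; rewrite mul0r | exact: divides_add |].
case: (unliftP ord0 j) => [j' ->|->]; last first.
  by rewrite f0 dirder_linform bw mpolyC0 !mul0r; exists 0; rewrite mul0r.
(* Deleting a slot other than the first keeps b in slot 0, which exists in 'I_q because j' does. *)
apply: divides_mull; apply: (vb _ (Ordinal (leq_ltn_trans (leq0n j') (ltn_ord j')))).
  by [].
by rewrite /= -f0; congr (f _); exact: val_inj.
Qed.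

End WithSection.

End QuotientDerivations.

(** * The boundary map of an arrangement *)

Section Linearity.
Context (K : fieldType) (l : nat).
Local Notation S := {mpoly K[l]}.

Lemma Der_linear0_alg (R : comAlgType K) q (t : ('I_q.+1 -> R) -> R^o) (c d : K)
    (x y : R) (g : 'I_q -> R) :
  is_Der t -> t (cons_arg (c%:A * x + d%:A * y) g) =
    c%:A * t (cons_arg x g) + d%:A * t (cons_arg y g).
Proof.
move=> tD; have dD := Der_arg0_derivation g tD.
have dZ (z : K) v : t (cons_arg (z%:A * v) g) = z%:A * t (cons_arg v g).
  by rewrite [LHS]dD.2 (derivationC _ dD) mul0r add0r.
by rewrite (derivationD dD) !dZ.
Qed.

Lemma Der_linear0 q (t : ('I_q.+1 -> S) -> S^o) (c d : K) (x y : S) (g : 'I_q -> S) :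
  is_Der t -> t (cons_arg (c%:MP * x + d%:MP * y) g) =
    c%:MP * t (cons_arg x g) + d%:MP * t (cons_arg y g).
Proof. by move=> tD; rewrite -!alg_mpolyC Der_linear0_alg. Qed.

Lemma Der_swap q (t : ('I_q.+2 -> S) -> S^o) (x y : S) (g : 'I_q -> S) :
  is_Der t -> t (cons_arg x (cons_arg y g)) = - t (cons_arg y (cons_arg x g)).
Proof.
move=> tD; pose s : 'S_q.+2 := tperm ord0 (lift ord0 ord0).
have -> : cons_arg x (cons_arg y g) = cons_arg y (cons_arg x g) \o s.
  apply/funext => i; rewrite /s /=.
  case: (unliftP ord0 i) => [j ->|->].
    case: (unliftP ord0 j) => [k ->|->].
      by rewrite tpermD // !cons_argS.
    by rewrite tpermR !cons_argS !cons_arg0.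
  by rewrite tpermL cons_argS !cons_arg0.
by rewrite Der_perm // odd_tperm expr1 mulN1r.
Qed.

End Linearity.

Section Arrangement.
Context (K : fieldType) (l : nat).
Local Notation S := {mpoly K[l]}.
Local Notation subspace := {vspace 'rV[K]_l}.
Local Notation ev b v := ((b : S).@[fun i => v 0 i]).
Context (A : {fset subspace}) (hA : arrangement A).
Context (alpha : subspace -> linform K l).
Context (halpha : forall L, L \in A -> defining_form L (alpha L)).
Context (H : subspace) (hH : H \in A).
Context (beta : subspace -> Sbar (alpha H)).
Context (hbeta : forall X, X \in restriction A H -> defining_form_in H X (beta X)).
Local Notation a := (alpha H).
Local Notation pi := (proj (alpha H)).
Local Notation A' := (A `\ H)%fset.
Local Notation AH := (restriction A H).

Lemma alpha_neq0 L : L \in A -> (alpha L : S) <> 0.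
Proof.
move=> LA L0; have LT : L = fullv.
  apply/vspaceP => v; rewrite memvf; apply/halpha => //.
  by rewrite L0 meval0.
by have := hA LA; rewrite LT dimvf /dim /= mul1n => /eqP; rewrite gtn_eqF.
Qed.

Lemma alpha_indep L L' : L \in A -> L' \in A -> L != L' ->
  ~ divides (alpha L : S) (alpha L' : S).
Proof.
move=> LA LA' /eqP LL' [g gE]; apply: LL'; apply/eqP; rewrite eqEdim.
apply/andP; split; last by rewrite -ltnS (hA LA) (hA LA').
apply/subvP => v /(halpha LA) Lv; apply/(halpha LA').
by rewrite gE mevalM Lv mulr0.
Qed.

Lemma alpha_prime L : L \in A -> prime_elt (alpha L : S).
Proof. by move=> /alpha_neq0; exact: linform_prime. Qed.

Lemma dual_exists : exists w : 'rV[K]_l, ev a w = 1.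
Proof. exact/linform_dual/alpha_neq0. Qed.

Lemma SbarI : integral (Sbar a).
Proof. by have [w aw] := dual_exists; exact: (Sbar_integral aw). Qed.

Lemma pi_alpha_neq0 L : L \in A' -> pi (alpha L) <> 0.
Proof.
rewrite in_fsetD1 => /andP[LH LA] /proj_eq0.
by apply: alpha_indep; rewrite // eq_sym.
Qed.

Lemma pi_ev x y v : v \in H -> pi x = pi y -> ev x v = ev y v.
Proof.
move=> /(halpha hH) av xy; have /proj_eq0[g gE] : pi (x - y) = 0.
  by rewrite rmorphB /= xy subrr.
by apply/subr0_eq; rewrite -mevalB gE mevalM av mulr0.
Qed.

Lemma piK (x : K) : x != 0 -> pi x%:MP * pi (x^-1)%:MP = 1.
Proof. by move=> x0; rewrite -rmorphM -mpolyCM divff // mpolyC1 rmorph1. Qed.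

Lemma restrictionP X : X \in AH -> exists2 L, L \in A' & X = (L :&: H)%VS.
Proof. by move=> /imfsetP[L LA ->]; exists L. Qed.

Lemma restriction_mem L : L \in A' -> (L :&: H)%VS \in AH.
Proof. by move=> LA; exact: in_imfset. Qed.

(** A zero class would force X = H, so H would lie in L and alpha_L would be a multiple of a. *)
Lemma beta_neq0 X : X \in AH -> beta X <> 0.
Proof.
move=> XA; have [L LA XE] := restrictionP XA; have [c -> cP] := hbeta XA.
move=> c0; apply: (pi_alpha_neq0 LA).
have LA1 : L \in A by move: LA; rewrite in_fsetD1 => /andP[].
have [v av|x ->] := @linform_prop _ _ (alpha L) a (alpha_neq0 hH).
  have vH : v \in H by apply/(halpha hH).
  have cv : ev c v = 0 by rewrite (pi_ev (y := 0) vH) ?meval0 // c0 rmorph0.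
  have : v \in X by apply/cP.
  by rewrite XE memv_cap => /andP[/(halpha LA1)].
by rewrite rmorphM /= proj_gen mulr0.
Qed.

Lemma pi_alpha L : L \in A' ->
  exists2 x : K, x != 0 & pi (alpha L) = pi x%:MP * beta (L :&: H)%VS.
Proof.
move=> LA; have XA := restriction_mem LA; have [c cE cP] := hbeta XA.
have LA1 : L \in A by move: LA; rewrite in_fsetD1 => /andP[].
have [||v av cv|x xE] := @proj_linform_assoc _ _ a (alpha L) c.
- exact: alpha_neq0.
- by rewrite -cE; exact: beta_neq0.
- have vH : v \in H by apply/(halpha hH).
  have : v \in (L :&: H)%VS by apply/cP.
  by rewrite memv_cap => /andP[/(halpha LA1)].
exists x; last by rewrite cE.
apply/eqP => x0; apply: (pi_alpha_neq0 LA).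
by rewrite xE x0 mpolyC0 rmorph0 mul0r.
Qed.

Lemma beta_prime X : X \in AH -> prime_elt (beta X).
Proof.
move=> XA; have := beta_neq0 XA; have [c -> _] := hbeta XA.
by have [w aw] := dual_exists; exact: (proj_linform_prime aw).
Qed.

Lemma beta_indep X Y : X \in AH -> Y \in AH -> X != Y ->
  ~ divides (beta X) (beta Y).
Proof.
move=> XA YA XY [g gE]; move/negP: XY; apply.
have := beta_neq0 XA; have := beta_neq0 YA.
have [c cE cP] := hbeta XA; have [d dE dP] := hbeta YA.
rewrite cE dE in gE *; move=> d0 c0.
have sub v : v \in H -> ev c v = 0 -> ev d v = 0.
  move=> vH cv; rewrite (pi_ev (y := repr g * (c : S)) vH).
    by rewrite mevalM cv mulr0.
  by rewrite gE rmorphM /= proj_repr.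
have [||v av cv|x xE] := @proj_linform_assoc _ _ a d c => //.
- exact: alpha_neq0.
- by apply: sub => //; apply/(halpha hH).
have x0 : x != 0.
  by apply/eqP => x0; apply: d0; rewrite xE x0 mpolyC0 rmorph0 mul0r.
have inH Z : Z \in AH -> (Z <= H)%VS.
  by move=> /restrictionP[L _ ->]; exact: capvSr.
rewrite eqEsubv; apply/andP; split; apply/subvP => v vX.
  have vH := subvP (inH _ XA) _ vX; apply/(dP v vH)/sub => //.
  exact/(cP v vH).
have vH := subvP (inH _ YA) _ vX; apply/(cP v vH).
rewrite (pi_ev (y := (x^-1)%:MP * (d : S)) vH).
  by rewrite mevalM (dP v vH).1 // mulr0.
by rewrite rmorphM /= xE mulrA (mulrC (pi _)) piK // mul1r.
Qed.

Definition over X : pred subspace := fun L => (L :&: H)%VS == X.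

(** The Ziegler multiplicity of X, which is the exponent of beta X in the class of Q(A'). *)
Definition mult X : nat := count (over X) A'.

Lemma prod_pi_alpha (X : subspace) (s : seq subspace) (P : pred subspace) :
  {subset s <= A'} -> (forall L, L \in s -> P L -> over X L) ->
  exists2 u : K, u != 0 &
    \prod_(L <- s | P L) pi (alpha L) = pi u%:MP * beta X ^+ count P s.
Proof.
elim: s => [|L s IHs] sA sX.
  by exists 1; rewrite ?oner_neq0 // big_nil /= mpolyC1 rmorph1 mulr1.
have [||u u0 uE] := IHs.
- by move=> M Ms; apply: sA; rewrite inE Ms orbT.
- by move=> M Ms; apply: sX; rewrite inE Ms orbT.
rewrite big_cons /=; case: ifP => PL; last by exists u.
have [x x0 xE] := pi_alpha (sA L (mem_head _ _)).
exists (x * u); first by rewrite mulf_neq0.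
rewrite uE xE (eqP (sX L (mem_head _ _) PL)) mpolyCM rmorphM add1n exprS.
by rewrite mulrACA.
Qed.

Lemma mult_gt0 X : X \in AH -> (0 < mult X)%N.
Proof.
move=> /restrictionP[L LA XE]; rewrite -has_count; apply/hasP; exists L => //.
by rewrite /over XE.
Qed.

Lemma pi_Q : exists2 u : K, u != 0 &
  pi (Q (fun L => (alpha L : S)) A') = pi u%:MP * \prod_(X <- AH) beta X ^+ mult X.
Proof.
rewrite /Q rmorph_prod /=.
have -> : \prod_(L <- A') pi (alpha L) =
    \prod_(X <- AH) \prod_(L <- A' | over X L) pi (alpha L).
  exact: (partition_big_imfset _ (fun L => (L :&: H)%VS)).
elim: (enum_fset AH) => [|X s [u u0 uE]].
  by exists 1; rewrite ?oner_neq0 // !big_nil mpolyC1 rmorph1 mulr1.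
have [//|//|v v0 vE] := @prod_pi_alpha X (enum_fset A') (over X).
exists (v * u); first by rewrite mulf_neq0.
by rewrite !big_cons uE vE mpolyCM rmorphM mulrACA.
Qed.

Lemma prod_mult_pred : (\prod_(X <- AH) beta X ^+ (mult X).-1) * Q beta AH =
  \prod_(X <- AH) beta X ^+ mult X.
Proof.
rewrite /Q -big_split big_seq [RHS]big_seq; apply: eq_bigr => X XA /=.
by rewrite mulrC -exprS prednK // mult_gt0.
Qed.

(** The witness B0 shows that the quotient exists, so [xget] does not return its default 0. *)
Lemma Bbar_Q :
  Bbar beta A * Q beta AH = pi (Q (fun L => (alpha L : S)) A').
Proof.
have [u u0 uE] := pi_Q.
pose B0 := pi u%:MP * \prod_(X <- AH) beta X ^+ (mult X).-1.
have B0E : B0 * Q beta AH = pi (Q (fun L => (alpha L : S)) A').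
  by rewrite uE /B0 -mulrA prod_mult_pred.
exact: (@xgetPex _ 0 [set B | B * Q beta AH =
  pi (Q (fun L => (alpha L : S)) A')] (ex_intro _ B0 B0E)).
Qed.

Lemma Qbeta_neq0 : Q beta AH <> 0.
Proof. by apply: (integral_prod_neq0 SbarI) => X XA; exact: beta_neq0. Qed.

Lemma Bbar_prod : exists2 u : K, u != 0 &
  Bbar beta A = pi u%:MP * \prod_(X <- AH) beta X ^+ (mult X).-1.
Proof.
have [u u0 uE] := pi_Q; exists u => //.
apply: (integral_mulIf SbarI Qbeta_neq0).
by rewrite Bbar_Q uE -mulrA prod_mult_pred.
Qed.

Lemma fsetD1W L : L \in A' -> L \in A.
Proof. by rewrite in_fsetD1 => /andP[]. Qed.

Lemma pi_divides x y : divides x y -> divides (pi x) (pi y).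
Proof. by move=> [g ->]; exists (pi g); rewrite rmorphM. Qed.

(** Both forms are constant multiples of beta X modulo a, hence proportional up to a multiple of a;
    e = 0 would make L and L0 equal. *)
Lemma over_comb X L0 L : L0 \in A' -> L \in A' -> over X L0 -> over X L ->
  exists d e : K, [/\ d != 0, L != L0 -> e != 0 &
    (alpha L : S) = d%:MP * (alpha L0 : S) + e%:MP * (a : S)].
Proof.
move=> L0A LA /eqP oL0 /eqP oL.
have [x x0 xE] := pi_alpha L0A; have [y y0 yE] := pi_alpha LA.
rewrite oL0 in xE; rewrite oL in yE; pose d := y / x.
have dE : pi (alpha L) = pi (d%:MP * (alpha L0 : S)).
  by rewrite yE rmorphM /= xE mulrA -rmorphM -mpolyCM mulfVK.
pose c : linform K l := alpha L - d *: alpha L0.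
have cE : (c : S) = (alpha L : S) - d%:MP * (alpha L0 : S) by rewrite mul_mpolyC.
have [v av|e eE] := @linform_prop _ _ c a (alpha_neq0 hH).
  have vH : v \in H by apply/(halpha hH).
  by rewrite cE mevalB (pi_ev vH dE) subrr.
have LE : (alpha L : S) = d%:MP * (alpha L0 : S) + e%:MP * (a : S).
  by rewrite -eE cE addrC subrK.
exists d, e; split=> //; first by rewrite mulf_neq0 ?invr_neq0.
move=> LL0; apply/eqP => e0; apply: (alpha_indep (fsetD1W L0A) (fsetD1W LA)).
  by rewrite eq_sym.
by exists d%:MP; rewrite LE e0 mpolyC0 mul0r addr0.
Qed.

Lemma mult_rem X L0 : L0 \in A' -> over X L0 ->
  count (over X) (rem L0 A') = (mult X).-1.
Proof.
move=> L0A oL0; rewrite /mult (seq.permP (perm_to_rem L0A)) /=.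
by rewrite oL0.
Qed.

(** * Values of the boundary are divisible by powers of the restricted forms *)

Section Containment.
Context (q : nat) (t : ('I_q.+1 -> S) -> S^o).
Context (ht : is_logder (forms (fun L => (alpha L : S)) A') t).

Lemma logder_alpha L g : L \in A' -> divides (alpha L : S) (t (cons_arg (alpha L : S) g)).
Proof.
move=> LA; have := ht.2 (alpha L : S); apply.
- exact: (map_f (fun L => (alpha L : S))).
- exact: (erefl (val (ord0 : 'I_q.+1))).
- exact: cons_arg0.
Qed.

Lemma dbar_divides1 X g : X \in AH ->
  divides (beta X ^+ (mult X).-1) (pi (t (cons_arg (a : S) g))).
Proof.
move=> /restrictionP[L0 L0A XE].
have oL0 : over X L0 by rewrite /over XE.
have [h hE] := logder_alpha g L0A.
have [||u u0 uE] := @prod_pi_alpha X (rem L0 A') (over X).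
- by move=> L /mem_rem.
- by [].
have sA L : L \in rem L0 A' -> L \in A by move=> /mem_rem/fsetD1W.
(* Here t(alpha_L0, g) = h alpha_L0. From alpha_L = d alpha_L0 + e a follows e (t(a, g) - h a) =
   t(alpha_L, g) - h alpha_L, so alpha_L divides the corrected value. *)
have := @prod_primes_divides S (@mpoly_integral K l) _ (rem L0 A') (over X)
  (fun L => (alpha L : S)) (fun _ => 1%N) (t (cons_arg (a : S) g) - h * (a : S)).
case.
- by apply: rem_uniq; exact: fset_uniq.
- by move=> L /sA; exact: alpha_prime.
- by move=> L M /sA LA /sA MA; exact: alpha_indep.
- move=> L Ls oL; rewrite expr1.
  have LA := mem_rem Ls.
  have LL0 : L != L0.
    by move: Ls; rewrite mem_rem_uniq ?fset_uniq // inE => /andP[].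
  have [d [e [d0 /(_ LL0) e0 LE]]] := over_comb L0A LA oL0 oL.
  have [k kE] := logder_alpha g LA.
  rewrite {1}LE Der_linear0 ?hE in kE; last exact: ht.1.
  exists ((e^-1)%:MP * (k - h)).
  have -> : t (cons_arg (a : S) g) - h * (a : S) =
      (e^-1)%:MP * (e%:MP * t (cons_arg (a : S) g) - h * (e%:MP * (a : S))).
    by rewrite mulrBr !mulrA (mulrAC _ h) -mpolyCM mulVf // mpolyC1 !mul1r.
  rewrite -mulrA; congr (_ * _); rewrite mulrBl -kE [in RHS]LE.
  by rewrite mulrDr opprD addrACA (mulrCA h d%:MP) subrr add0r.
move=> k kE.
have : divides (pi u%:MP * beta X ^+ (mult X).-1) (pi (t (cons_arg (a : S) g))).
  exists (pi k); rewrite -(mult_rem L0A oL0) -uE -rmorph_prod -rmorphM /=.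
  have -> : t (cons_arg (a : S) g) =
     k * \prod_(L <- rem L0 A' | over X L) (alpha L : S) + h * (a : S).
    by under eq_bigr do rewrite -[(alpha _ : S)]expr1; rewrite -kE subrK.
  by rewrite rmorphD [X in _ + X]rmorphM /= proj_gen mulr0 addr0.
by apply: divides_trans; exists (pi u%:MP).
Qed.

End Containment.

(** Up to a constant, beta X can be replaced by alpha_L0 and swapped to the front. Then t(alpha_L,
    a, g') = d t(alpha_L0, a, g'), as a repeated a gives 0, so all forms over X divide, L0
    included. *)
Lemma dbar_divides2 q (t : ('I_q.+2 -> S) -> S^o) X g :
  is_logder (forms (fun L => (alpha L : S)) A') t ->
  X \in AH -> pi (g ord0) = beta X ->
  divides (beta X ^+ mult X) (pi (t (cons_arg (a : S) g))).
Proof.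
move=> ht XA gX; have [L0 L0A XE] := restrictionP XA.
have oL0 : over X L0 by rewrite /over XE.
have tD := ht.1.
have [x x0 xE] := pi_alpha L0A; rewrite -XE in xE.
pose g' := g \o lift ord0.
have [||u u0 uE] := @prod_pi_alpha X (enum_fset A') (over X) => //.
have : divides (pi u%:MP * beta X ^+ mult X)
    (pi (t (cons_arg (alpha L0 : S) (cons_arg (a : S) g')))).
  rewrite -uE -rmorph_prod; apply: pi_divides.
  have := @prod_primes_divides S (@mpoly_integral K l) _ (enum_fset A') (over X)
    (fun L => (alpha L : S)) (fun _ => 1%N)
    (t (cons_arg (alpha L0 : S) (cons_arg (a : S) g'))).
  under eq_bigr do rewrite expr1.
  apply.
  - exact: fset_uniq.
  - by move=> L /fsetD1W; exact: alpha_prime.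
  - by move=> L M /fsetD1W LA /fsetD1W MA; exact: alpha_indep.
  move=> L LA oL; rewrite expr1.
  have [d [e [d0 _ LE]]] := over_comb L0A LA oL0 oL.
  have [k kE] := logder_alpha ht (cons_arg (a : S) g') LA.
  exists ((d^-1)%:MP * k); rewrite -mulrA -kE {1}LE Der_linear0 //.
  have -> : t (cons_arg (a : S) (cons_arg (a : S) g')) = 0.
    apply: (@Der_alternate _ _ _ t _ ord0 (lift ord0 ord0)) => //.
    by rewrite cons_argS !cons_arg0.
  by rewrite mulr0 addr0 mulrA -mpolyCM mulVf // mpolyC1 mul1r.
move=> /(divides_trans (ex_intro _ (pi u%:MP) erefl)) h.
have -> : pi (t (cons_arg (a : S) g)) =
    pi (- (x^-1)%:MP) * pi (t (cons_arg (alpha L0 : S) (cons_arg (a : S) g'))).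
  rewrite -dbarE //.
  have -> : (fun j => pi (g j)) =
      (fun j => pi (cons_arg ((x^-1)%:MP * (alpha L0 : S)) g' j)).
    apply/funext => j; case: (unliftP ord0 j) => [j' ->|->].
      by rewrite cons_argS.
    by rewrite cons_arg0 gX rmorphM /= xE mulrA (mulrC (pi _)) piK // mul1r.
  rewrite dbarE // [in LHS]Der_swap //.
  have := Der_linear0 (x^-1) 0 (alpha L0 : S) 0 (cons_arg (a : S) g') tD.
  rewrite mpolyC0 !mul0r !addr0 => ->.
  by rewrite rmorphN rmorphM rmorphN mulNr.
exact: divides_mull.
Qed.

Lemma Bbar_neq0 : Bbar beta A <> 0.
Proof.
move=> B0; have := Bbar_Q; rewrite B0 mul0r => /esym.
rewrite /Q rmorph_prod; apply: (integral_prod_neq0 SbarI) => L LA.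
exact: pi_alpha_neq0.
Qed.

Lemma Bbar_reg x : Bbar beta A * x = 0 -> x = 0.
Proof. by move=> /SbarI[/Bbar_neq0|]. Qed.

Lemma beta_divides (k : subspace -> nat) z :
  (forall X, X \in AH -> divides (beta X ^+ k X) z) ->
  divides (\prod_(X <- AH) beta X ^+ k X) z.
Proof.
move=> h; apply: (prod_primes_divides SbarI (fset_uniq _)) => // [X|X Y|X XA _].
- exact: beta_prime.
- exact: beta_indep.
- exact: h.
Qed.

Lemma Bbar_divides z :
  divides (\prod_(X <- AH) beta X ^+ (mult X).-1) z -> divides (Bbar beta A) z.
Proof.
have [u u0 uE] := Bbar_prod; move=> [g ->]; exists (g * pi (u^-1)%:MP).
by rewrite uE mulrA -(mulrA g) (mulrC (pi _)) piK // mulr1.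
Qed.

Lemma dbar_contained q (t : ('I_q.+1 -> S) -> S^o) :
  is_logder (forms (fun L => (alpha L : S)) A') t ->
  exists2 u, is_logder (forms beta AH) u & dbar a t = Bbar beta A *: u.
Proof.
move=> ht; have [w aw] := dual_exists; have tD := ht.1.
have cD := Der_contract (a : S) tD.
have [||J|u uD uE] := Der_divide (dsec_derivation aw) Bbar_reg (dbar_expand aw tD).
- move=> J Jn; have := Der_coords_alternate (fun i => 'X_i) cD Jn.
  by rewrite /comp => ->; rewrite rmorph0.
- move=> J s; have := Der_coords_perm (fun i => 'X_i) J s cD.
  by rewrite /comp => ->; rewrite rmorphM rmorphXn rmorphN1.
- have [g gE] : divides (Bbar beta A)
      (pi (t (cons_arg (a : S) (fun j => 'X_(J j))))).
    apply/Bbar_divides/beta_divides => X XA; exact: dbar_divides1.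
  by exists g; rewrite gE mulrC.
exists u => //; split=> // b /mapP[X XA ->] g i i0 gi.
have XA' : X \in AH by [].
case: q t ht tD cD u uD uE g i i0 gi => [|q] t ht tD cD u uD uE g i; first by case: i.
move=> i0; have {i i0}-> : i = ord0 by exact: val_inj.
move=> g0.
(* The argument beta X raises the exponent at X by one over that in Bbar; this extra factor is the
   divisibility to be shown for u. *)
pose k Y := if Y == X then mult X else (mult Y).-1.
have [h hE] : divides (\prod_(Y <- AH) beta Y ^+ k Y) (dbar a t g).
  have gE : g = (fun j => pi (sec aw (g j))) by apply/funext => j; rewrite secK.
  rewrite {1}gE dbarE //; apply: beta_divides => Y YA.
  rewrite /k; case: eqVneq => [->|_]; last exact: dbar_divides1.
  by apply: dbar_divides2; rewrite // secK.
have kE : \prod_(Y <- AH) beta Y ^+ k Y =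
    beta X * \prod_(Y <- AH) beta Y ^+ (mult Y).-1.
  rewrite (bigD1_seq X) ?fset_uniq //= [in RHS](bigD1_seq X) ?fset_uniq //=.
  rewrite /k eqxx mulrA -exprS prednK ?mult_gt0 //; congr (_ * _).
  by apply: eq_bigr => Y /negPf->.
have [v v0 vE] := Bbar_prod; exists (h * pi (v^-1)%:MP).
apply: (integral_mulIf SbarI Bbar_neq0).
have -> : u g * Bbar beta A = dbar a t g by rewrite uE -[RHS]/(Bbar beta A * u g) mulrC.
rewrite hE kE vE !mulrA; congr (_ * _).
by rewrite -!mulrA; congr (_ * _); rewrite mulrCA [pi (v^-1)%:MP * _]mulrC piK // mulr1.
Qed.

(** * Kernel and surjectivity of the boundary map *)

Local Notation formsA := (forms (fun L => (alpha L : S)) A).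
Local Notation formsA' := (forms (fun L => (alpha L : S)) A').
Local Notation formsAH := (forms beta AH).

Lemma is_logderP (R : comAlgType K) p (s : seq R) (t : ('I_p -> R) -> R^o) :
  reflect (is_logder s t) (t \in D p s).
Proof. exact: asboolP. Qed.

Lemma dbarP p c (t u : ('I_p -> S) -> S^o) :
  dbar a (c *: t + u) = pi c *: dbar a t + dbar a u.
Proof.
case: p t u => [|p] t u; first by rewrite scaler0 addr0.
apply/funext => g; rewrite -[LHS]/(pi (c * t _ + u _)).
by rewrite rmorphD rmorphM.
Qed.

Lemma dbar0 p : dbar a (0 : ('I_p -> S) -> S^o) = 0.
Proof. by case: p => // p; apply/funext => g; exact: rmorph0. Qed.

Lemma dbarZ p c (t : ('I_p -> S) -> S^o) : dbar a (c *: t) = pi c *: dbar a t.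
Proof. by rewrite -[_ *: t]addr0 dbarP dbar0 addr0. Qed.

Lemma dbarB p (t u : ('I_p -> S) -> S^o) : dbar a (t - u) = dbar a t - dbar a u.
Proof. by rewrite addrC -scaleN1r dbarP rmorphN1 scaleN1r addrC. Qed.

Lemma logder_boundary p (t : ('I_p -> S) -> S^o) :
  t \in D p formsA <-> t \in D p formsA' /\ dbar a t = 0.
Proof.
split=> [/is_logderP[tD tA]|[/is_logderP[tD tA'] t0]].
  split.
    apply/is_logderP; split=> // b /mapP[L /fsetD1W LA ->].
    by apply: tA; exact: (map_f (fun L => (alpha L : S))).
  case: p t tD tA => [//|p] t tD tA; apply/funext => g; apply/proj_eq0.
  apply: (tA (a : S) _ _ ord0) => //; last exact: cons_arg0.
  exact: (map_f (fun L => (alpha L : S))).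
apply/is_logderP; split=> // b /mapP[L LA ->] f i i0 fi.
have [LH|LH] := eqVneq L H; last first.
  apply: (tA' (alpha L : S) _ f i) => //.
  by apply: (map_f (fun L => (alpha L : S))); rewrite in_fsetD1 LH.
rewrite LH in fi *; case: p t tD tA' t0 f i i0 fi => [|p] t tD tA' t0 f i.
  by case: i.
move=> i0; have {i i0}-> : i = ord0 by exact: val_inj.
move=> f0; apply/proj_eq0; rewrite (cons_argE f) f0 -dbarE // t0.
by [].
Qed.

Lemma scale_gen_logder p (t : ('I_p -> S) -> S^o) :
  t \in D p formsA' -> (a : S) *: t \in D p formsA.
Proof.
move=> tA'; apply/logder_boundary; split; first exact: rpredZ.
by rewrite dbarZ proj_gen scale0r.
Qed.

Lemma lift_away q (u : ('I_q -> Sbar a) -> (Sbar a)^o) L0 :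
  is_logder formsAH u -> L0 \in A' ->
  exists2 t, t \in D q.+1 formsA' &
    dbar a t = (\prod_(L <- rem L0 A') pi (alpha L)) *: u.
Proof.
move=> [uD uA] L0A.
have [w [aw bw]] := linform_dual2 (alpha_neq0 hH) (pi_alpha_neq0 L0A).
have [v [vD vu /(_ _ bw) vb]] := Der_lift aw uD.
exists ((\prod_(L <- rem L0 A') (alpha L : S)) *: v); last first.
  by rewrite dbarZ vu rmorph_prod.
apply/is_logderP; split=> [|b /mapP[L LA ->] f i i0 fi]; first exact: is_DerZ.
rewrite -[_ f]/((\prod_(L <- rem L0 A') (alpha L : S)) * v f).
have [LL0|LL0] := eqVneq L L0; last first.
  have Lr : L \in rem L0 A' by rewrite mem_rem_uniq ?fset_uniq // inE LL0.
  apply: divides_mulr; rewrite (big_rem L) //=; apply: divides_mulr.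
  by exists 1; rewrite mul1r.
rewrite LL0 in fi *; apply: divides_mull; apply: (vb _ f i) => // g j j0 gj.
have [x x0 xE] := pi_alpha L0A.
have XA := restriction_mem L0A.
case: q u uD uA {v vD vu vb f i i0 fi} g j j0 gj => [|q] u uD uA g j; first by case: j.
move=> j0; have {j j0}-> : j = ord0 by exact: val_inj.
move=> gj; rewrite (cons_argE g) gj xE.
set X := (L0 :&: H)%VS in xE XA *.
have [h hE] : divides (beta X) (u (cons_arg (beta X) (g \o lift ord0))).
  apply: (uA _ _ _ ord0) => //; last exact: cons_arg0.
  exact: (map_f beta).
have := Der_linear0_alg x 0 (beta X) 0 (g \o lift ord0) uD.
rewrite scale0r !mul0r !addr0 scaleSbarE mulr1 hE => ->.
exists h; rewrite mulrCA; congr (_ * _).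
Qed.

Lemma prod_beta_neq0 X : \prod_(Y <- AH | Y != X) beta Y <> 0.
Proof. by apply: (integral_prod_neq0 SbarI) => Y YA; exact: beta_neq0. Qed.

Lemma mul_rearrange (R : comNzRingType) (P B y : R) : B * (y * P) = P * B * y.
Proof. by rewrite mulrC [RHS]mulrC mulrA. Qed.

Lemma scale_cross (R : comNzRingType) (V : lmodType R) (c x y : R) (u v : V) :
  c *: (x *: u - y *: v) = x *: (c *: u) - y *: (c *: v).
Proof. by rewrite scalerBr !scalerA !(mulrC c). Qed.

Lemma lift_codim1 q (u : ('I_q -> Sbar a) -> (Sbar a)^o) X :
  is_logder formsAH u -> X \in AH ->
  exists2 t, t \in D q.+1 formsA' &
    dbar a t = (\prod_(Y <- AH | Y != X) beta Y) *: (Bbar beta A *: u).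
Proof.
move=> uA XA; have [L0 L0A XE] := restrictionP XA.
have [t tA tE] := lift_away uA L0A; have [x x0 xE] := pi_alpha L0A.
rewrite -XE in xE.
exists (x%:MP *: t); first exact: rpredZ.
rewrite dbarZ tE !scalerA; congr (_ *: _).
(* After multiplication by beta X, both scalars become the class of Q(A'). *)
apply: (integral_mulIf SbarI (beta_neq0 XA)).
transitivity (pi (Q (fun L => (alpha L : S)) A')).
  rewrite mulrAC -xE /Q rmorph_prod /= [in RHS](big_rem L0) //.
rewrite -Bbar_Q /Q (bigD1_seq X) ?fset_uniq //=.
move: (\prod_(Y <- AH | _) beta Y) (Bbar beta A) (beta X) => P B y.
exact: mul_rearrange.
Qed.

Lemma dbar_surjective q (u : ('I_q -> Sbar a) -> (Sbar a)^o) :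
  free_module (submod (D q.+1 formsA)) -> is_logder formsAH u ->
  exists2 t, t \in D q.+1 formsA' & dbar a t = Bbar beta A *: u.
Proof.
move=> [I [b bB]] uA.
have [AH0|[X0 X0A]] : AH = fset0 \/ exists X, X \in AH.
  by have [->|/fset0Pn] := eqVneq AH fset0; [left | right].
  (* If A^H is empty, so is A', and Bbar = 1; any lift of u will do. *)
  have A'0 : A' = fset0.
    apply/fsetP => L; rewrite in_fset0; apply/negP => /restriction_mem.
    by rewrite AH0 in_fset0.
  have [w aw] := dual_exists.
  have [v [vD vu _]] := Der_lift aw uA.1; exists v.
    by apply/is_logderP; split=> // c /mapP[L]; rewrite A'0 in_fset0.
  have -> : Bbar beta A = 1.
    have := Bbar_Q; rewrite /Q AH0 A'0 !big_seq_fset0 mulr1 => ->.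
    exact: rmorph1.
  by rewrite scale1r.
have ext X : exists t, X \in AH -> t \in D q.+1 formsA' /\
    dbar a t = (\prod_(Y <- AH | Y != X) beta Y) *: (Bbar beta A *: u).
  have [XA|_] := boolP (X \in AH); last by exists 0.
  by have [t tA tE] := lift_codim1 uA XA; exists t.
have [t tP] := choice ext.
pose fb X := \prod_(Y <- AH | Y != X) beta Y.
pose f X : S := repr (fb X).
have fE X : pi (f X) = fb X by rewrite /f proj_repr.
have [h hP] := basis_coord_forms bB.
have exa X : exists z : submod (D q.+1 formsA),
    X \in AH -> submod_val z = (a : S) *: t X.
  have [XA|_] := boolP (X \in AH); last by exists 0.
  have zA : (a : S) *: t X \in D q.+1 formsA by apply/scale_gen_logder/(tP X XA).1.
  by exists (Submod zA).
have [z zE] := choice exa.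
have compat X Y i : X \in AH -> Y \in AH ->
    fb Y * pi (h i (z X)) = fb X * pi (h i (z Y)).
  move=> XA YA; have [tX dX] := tP X XA; have [tY dY] := tP Y YA.
  (* The boundaries of the two terms cancel, so this difference lies in D^p(A); a times it has
     coordinates divisible by a. *)
  have yA : f Y *: t X - f X *: t Y \in D q.+1 formsA.
    apply/logder_boundary; split; first by apply: rpredB; exact: rpredZ.
    rewrite dbarB !dbarZ !fE dX dY !scalerA -/(fb X) -/(fb Y).
    by rewrite mulrCA subrr.
  have : (a : S) *: (Submod yA : submod (D q.+1 formsA)) = f Y *: z X - f X *: z Y.
    apply: submod_inj.
    rewrite submod_valB (submod_valZ (f Y)) (submod_valZ (f X)) (submod_valZ (a : S)).
    rewrite -[submod_val (Submod yA)]/(f Y *: t X - f X *: t Y).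
    by rewrite (zE X XA) (zE Y YA); exact: scale_cross.
  have hZ (c : S) x : h i (c *: x) = c * h i x by exact: linearZ_LR.
  move=> /(congr1 (h i)); rewrite linearB !hZ => /(congr1 pi).
  rewrite rmorphB !rmorphM /= proj_gen mul0r !fE => /esym/subr0_eq.
  by [].
have exv i : exists v, forall X, X \in AH -> pi (h i (z X)) = v * fb X.
  apply: (compatible_quotients SbarI (fset_uniq _) X0A) => [X|X Y|X Y XA YA].
  - exact: beta_prime.
  - exact: beta_indep.
  - exact: compat.
have [v vE] := choice exv.
(* A^H is finite, so one list of basis indices supports every z X. *)
have [s us sP] : exists2 s : seq I, uniq s &
    forall X, X \in AH -> z X = \sum_(i <- s) h i (z X) *: b i.
  have exs x : exists s : seq I, [/\ uniq s, forall i, i \notin s -> h i x = 0 &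
      x = \sum_(i <- s) h i x *: b i].
    by have [s us [sz sE]] := hP x; exists s.
  have [sp spP] := choice exs.
  exists (undup (flatten [seq sp (z X) | X <- AH])); first exact: undup_uniq.
  move=> X XA; have [u1 z1 {1}->] := spP (z X).
  apply: sum_supp => //; first exact: undup_uniq.
  move=> i; rewrite mem_undup => /negP iN; apply: z1; apply/negP => iX; apply: iN.
  by apply/flattenP; exists (sp (z X)) => //; exact: (map_f (sp \o z)).
pose V := \sum_(i <- s) (repr (v i) : S) *: b i.
have exW X : exists W : submod (D q.+1 formsA),
    X \in AH -> z X - f X *: V = (a : S) *: W.
  have [XA|_] := boolP (X \in AH); last by exists 0.
  have exg i : exists g : S, h i (z X) - f X * repr (v i) = g * (a : S).
    by apply/proj_eq0; rewrite rmorphB rmorphM /= fE proj_repr vE // mulrC subrr.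
  have [g gE] := choice exg; exists (\sum_(i <- s) g i *: b i) => _.
  rewrite {1}(sP X XA) /V !scaler_sumr -sumrB; apply: eq_bigr => i _.
  by rewrite !scalerA -scalerBl gE mulrC.
have [W WE] := choice exW.
have VW X : X \in AH ->
    f X *: submod_val V = (a : S) *: (t X - submod_val (W X)).
  move=> XA; rewrite scalerBr -(zE X XA).
  have -> : (a : S) *: submod_val (W X) = submod_val (z X) - f X *: submod_val V.
    by rewrite -submod_valZ -WE // submod_valB submod_valZ.
  by rewrite opprB addrC subrK.
have anf X : ~ divides (a : S) (f X).
  by move=> /proj_eq0; rewrite fE; exact: prod_beta_neq0.
have VD : is_Der (submod_val V) by have /is_logderP[] := submod_valP V.
(* By [VW], f_X0 V is a multiple of a, and the prime a does not divide f_X0. *)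
have Vdiv g : divides (a : S) (submod_val V g).
  have [_ _ aM] := alpha_prime hH.
  have /aM[/anf//|//] : divides (a : S) (f X0 * submod_val V g).
  exists ((t X0 - submod_val (W X0)) g).
  by rewrite -[LHS]/((f X0 *: submod_val V) g) VW // mulrC.
have areg x : (a : S) * x = 0 -> x = 0.
  by move=> /mpoly_integral[/(alpha_neq0 hH)|].
have [||J|v' v'D v'E] := Der_divide (@mderiv_derivation K l) areg (Der_coords VD).
- by move=> J; exact: Der_coords_alternate.
- by move=> J s'; exact: Der_coords_perm.
- by have [g gE] := Vdiv ((fun i => 'X_i) \o J); exists g; rewrite gE mulrC.
have v'W X : X \in AH -> f X *: v' = t X - submod_val (W X).
  move=> XA; apply/funext => g; apply/subr0_eq/areg.
  have := congr1 (fun F => F g) (VW X XA); rewrite v'E.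
  rewrite -[_ g]/(f X * ((a : S) * v' g)).
  rewrite -[X in _ = X]/((a : S) * (t X - submod_val (W X)) g) => E.
  by rewrite mulrBr -E -[(f X *: v') g]/(f X * v' g) mulrCA subrr.
have WA X : submod_val (W X) \in D q.+1 formsA' /\ dbar a (submod_val (W X)) = 0.
  exact/logder_boundary/submod_valP.
exists v'.
  apply/is_logderP; split=> // c /mapP[L LA ->] g i i0 gi.
  have XA := restriction_mem LA; set X := (L :&: H)%VS in XA.
  have [_ _ LM] := alpha_prime (fsetD1W LA).
  (* If alpha_L divided f_X, then modulo a the prime beta X would divide some beta Y with Y
     different from X. *)
  have /LM[/pi_divides|//] : divides (alpha L : S) (f X * v' g).
    rewrite -[f X * v' g]/((f X *: v') g) v'W //.
    have : t X - submod_val (W X) \in D q.+1 formsA'.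
      by apply: rpredB; [exact: (tP X XA).1 | exact: (WA X).1].
    move=> /is_logderP[_ tW]; apply: (tW (alpha L : S) _ g i i0 gi).
    exact: (map_f (fun L => (alpha L : S))).
  have [x x0 xE] := pi_alpha LA; rewrite fE xE.
  move=> /(divides_trans (ex_intro _ (pi x%:MP) erefl)).
  move=> /(prime_prod (beta_prime XA))[Y [YA YX]].
  by move=> /(beta_indep XA YA); rewrite eq_sym YX => /(_ isT).
have := congr1 (dbar a) (v'W X0 X0A).
rewrite dbarZ dbarB (WA X0).2 subr0 (tP X0 X0A).2 fE => E.
apply/funext => g; apply: (integral_mulIf SbarI (@prod_beta_neq0 X0)).
have Eg : fb X0 * dbar a v' g = fb X0 * (Bbar beta A *: u) g.
  exact: (congr1 (fun F => F g) E).
by rewrite mulrC [RHS]mulrC.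
Qed.

End Arrangement.

(** * Grading and finite generation *)

Section Grading.
Context (K : fieldType) (l : nat).
Local Notation S := {mpoly K[l]}.

Lemma pihomogM d e (p r : S) : r \is e.-homog ->
  pihomog mdeg d (p * r) = if (e <= d)%N then pihomog mdeg (d - e) p * r else 0.
Proof.
move=> rh; pose m := maxn (mmeasure mdeg p) (d - e).+1.
have {1}-> : p = \sum_(k < m) pihomog mdeg k p.
  by apply: pihomog_partitionE; exact: leq_maxl.
rewrite mulr_suml raddf_sum /=.
have E (k : 'I_m) : pihomog mdeg d (pihomog mdeg k p * r) =
    if (k + e == d)%N then pihomog mdeg k p * r else 0.
  have kh : pihomog mdeg k p * r \is (k + e).-homog.
    by apply: dhomogM => //; exact: pihomogP.
  case: eqVneq => [kd|kd]; first by apply: pihomog_dE; rewrite -kd.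
  exact: (pihomog_ne0 kd kh).
under eq_bigr do rewrite E.
case: leqP => [ed|de]; last first.
  by rewrite big1 // => k _; rewrite gtn_eqF // (leq_trans de) // leq_addl.
have lt : (d - e < m)%N by exact: leq_maxr.
rewrite (bigD1 (Ordinal lt)) //= subnK // eqxx big1 ?addr0 // => k kN.
case: eqVneq => // kd; move/eqP: kN; case; apply: val_inj.
by rewrite /= -kd addnK.
Qed.

Local Notation X_ J := ((fun i => 'X_i : S) \o J).

Lemma expandX p (e : {ffun 'I_p -> 'I_l} -> S) (J : {ffun 'I_p -> 'I_l}) :
  expand (fun i x => x^`M(i)) e (X_ J) = e J.
Proof.
rewrite /expand (bigD1 J) //= [X in _ + X]big1 ?addr0.
  by rewrite big1 ?mul1r // => j _; rewrite mderivXU eqxx.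
move=> J' JJ'; have [j jN] : exists j, J j != J' j.
  apply: contrapT => /forallNP h; move/eqP: JJ'; apply; apply/ffunP => j.
  by have /negP := h j; rewrite negbK => /eqP.
by rewrite (bigD1 j) //= mderivXU (negPf jN) !mul0r.
Qed.

Lemma Der_ext p (t u : ('I_p -> S) -> S^o) : is_Der t -> is_Der u ->
  (forall J : {ffun 'I_p -> 'I_l}, t (X_ J) = u (X_ J)) -> t = u.
Proof.
move=> tD uD tu; rewrite (Der_coords tD) (Der_coords uD); congr (expand _ _).
exact/funext.
Qed.

(** The grading by polynomial degree of the values on tuples of variables. *)
Definition Der_homog p d (t : ('I_p -> S) -> S^o) : ('I_p -> S) -> S^o :=
  expand (fun i x => x^`M(i)) (fun J => pihomog mdeg d (t (X_ J))).

Lemma Der_homogE p d (t : ('I_p -> S) -> S^o) (J : {ffun 'I_p -> 'I_l}) :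
  Der_homog d t (X_ J) = pihomog mdeg d (t (X_ J)).
Proof. exact: expandX. Qed.

Lemma Der_homog_Der p d (t : ('I_p -> S) -> S^o) : is_Der t -> is_Der (Der_homog d t).
Proof.
move=> tD; apply: expand_Der => [i|J Jn|J s]; first exact: mderiv_derivation.
  by rewrite (Der_coords_alternate _ tD Jn) raddf0.
rewrite (Der_coords_perm _ J s tD); case: (odd_perm s); rewrite ?expr0 ?mul1r //.
by rewrite expr1 !mulN1r raddfN.
Qed.

Lemma Der_linform q (t : ('I_q.+1 -> S) -> S^o) (b : linform K l) (g : 'I_q -> S) :
  is_Der t -> t (cons_arg (b : S) g) =
    \sum_i (b : S)@_U_(i) *: (t (cons_arg 'X_i g) : S).
Proof.
move=> tD; have dD := Der_arg0_derivation g tD.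
rewrite [LHS](derivation_coords dD); apply: eq_bigr => i _.
by rewrite mderiv_linform mulrC mul_mpolyC.
Qed.

(** A linear form is a constant combination of variables, so evaluation at it commutes with taking
    components. This makes the logarithmic conditions homogeneous. *)
Lemma Der_homog_contract q d (t : ('I_q.+1 -> S) -> S^o) (b : linform K l)
    (J : {ffun 'I_q -> 'I_l}) : is_Der t ->
  Der_homog d t (cons_arg (b : S) (fun j => 'X_(J j))) =
  pihomog mdeg d (t (cons_arg (b : S) (fun j => 'X_(J j)))).
Proof.
move=> tD; rewrite !Der_linform //; last exact: Der_homog_Der.
rewrite raddf_sum; apply: eq_bigr => i _ /=.
pose J' : {ffun 'I_q.+1 -> 'I_l} := [ffun j => cons_arg i J j].
have -> : cons_arg 'X_i (fun j => 'X_(J j)) = X_ J'.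
  apply/funext => j; rewrite /= ffunE; case: (unliftP ord0 j) => [j' ->|->].
    by rewrite !cons_argS.
  by rewrite !cons_arg0.
by rewrite Der_homogE linearZ.
Qed.

Section Logarithmic.
Context (I : eqType) (s : seq I) (b : I -> linform K l) (p : nat).
Local Notation fs := [seq (b i : S) | i <- s].

Lemma Der_homog_logder d t : t \in D p fs -> Der_homog d t \in D p fs.
Proof.
move=> /is_logderP[tD tb]; apply/is_logderP; split; first exact: Der_homog_Der.
move=> c cs; have /mapP[i _ cE] := cs; case: p t tD tb => [|q] t tD tb f j.
  by case: j.
move=> j0; have {j j0}-> : j = ord0 by exact: val_inj.
move=> f0; rewrite (cons_argE f) f0.
move: (f \o lift ord0) => g; move: g.
apply: (Der_contract_divides (Der_homog_Der d tD)) => J.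
rewrite cE Der_homog_contract //.
have [g gE] : exists g, t (cons_arg (b i : S) (fun j => 'X_(J j))) = g * (b i : S).
  by rewrite -cE; apply: (tb c cs _ ord0) => //; exact: cons_arg0.
rewrite gE (pihomogM _ _ (dhomog_is_dhomog (b i))).
case: ifP => _; first by exists (pihomog mdeg (d - 1) g).
by exists 0; rewrite mul0r.
Qed.

Definition logder_homog d (t : submod (D p fs)) : submod (D p fs) :=
  Submod (Der_homog_logder d (submod_valP t)).

Lemma logder_ext (t u : submod (D p fs)) :
  (forall J : {ffun 'I_p -> 'I_l}, submod_val t (X_ J) = submod_val u (X_ J)) ->
  t = u.
Proof.
move=> tu; apply: submod_inj; apply: Der_ext => //.
  by have /is_logderP[] := submod_valP t.
by have /is_logderP[] := submod_valP u.
Qed.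

Lemma logder_homogE d (t : submod (D p fs)) (J : {ffun 'I_p -> 'I_l}) :
  submod_val (logder_homog d t) (X_ J) = pihomog mdeg d (submod_val t (X_ J)).
Proof. exact: Der_homogE. Qed.

Lemma submod_val_addE (t u : submod (D p fs)) f :
  submod_val (t + u) f = submod_val t f + submod_val u f.
Proof. by rewrite submod_valD. Qed.

Lemma submod_val_scaleE (c : S) (t : submod (D p fs)) f :
  submod_val (c *: t) f = c * submod_val t f.
Proof. by rewrite submod_valZ fct_scaleE. Qed.

(** Evaluation on the finitely many tuples of variables embeds the module in a finite power of S. *)
Lemma logder_noetherian : noetherian (submod (D p fs)).
Proof.
pose N := #|{: {ffun 'I_p -> 'I_l}}|.
have lamP (k : 'I_N) : linear (fun t : submod (D p fs) =>
    submod_val t (X_ (enum_val k : {ffun 'I_p -> 'I_l})) : S^o).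
  by move=> c t u; rewrite submod_val_addE submod_val_scaleE.
apply: (noetherian_sub (lam := fun k => lin_of (lamP k))).
  exact: noetherian_mpoly.
move=> t t0; apply: logder_ext => J.
by have := t0 (enum_rank J); rewrite -[LHS]/(submod_val t _) enum_rankK.
Qed.

Lemma logder_projective_free :
  projective (submod (D p fs)) -> free_module (submod (D p fs)).
Proof.
apply: (graded_projective_free (cmp := logder_homog)) logder_noetherian.
- move=> d t u; apply: logder_ext => J.
  by rewrite submod_val_addE !logder_homogE submod_val_addE raddfD.
- move=> d e c t; apply: logder_ext => J.
  rewrite logder_homogE submod_val_scaleE logder_homogE.
  rewrite (pihomogM _ _ (pihomogP mdeg e _)).
  by case: ifP => // _; rewrite submod_val_scaleE logder_homogE.
move=> t.
exists (\max_(J : {ffun 'I_p -> 'I_l}) mmeasure mdeg (submod_val t (X_ J))) => m hm.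
apply: logder_ext => J; rewrite submod_val_sum fct_sumE.
under eq_bigr do rewrite logder_homogE.
apply: pihomog_partitionE; apply: leq_trans hm.
exact: (leq_bigmax J).
Qed.

End Logarithmic.

End Grading.

(** * Deletion of a hyperplane *)

Section BoundaryMap.
Context (R R' : comNzRingType) (f : {rmorphism R -> R'}).
Context (V : lmodType R) (W : lmodType R').
Context (N0 N1 : submodClosed V) (G : submodClosed W) (B : R') (dl : V -> W).
Context (dlP : forall c t u, dl (c *: t + u) = f c *: dl t + dl u).
Context (ker_dl : forall t, t \in N0 <-> t \in N1 /\ dl t = 0).
Context (dl_contained : forall t, t \in N1 -> exists2 u, u \in G & dl t = B *: u).
Context (dl_surj : forall u, u \in G -> exists2 t, t \in N1 & dl t = B *: u).
Context (Breg : forall u : W, B *: u = 0 -> u = 0).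

Lemma boundary0 : dl 0 = 0.
Proof.
by have := dlP 1 0 0; rewrite scale1r addr0 rmorph1 scale1r => /eqP;
  rewrite -subr_eq0 opprD addrA subrr sub0r oppr_eq0 => /eqP.
Qed.

Lemma boundaryB t u : dl (t - u) = dl t - dl u.
Proof. by rewrite addrC -scaleN1r dlP rmorphN1 scaleN1r addrC. Qed.

Lemma boundary_sum (I : Type) (r : seq I) (P : pred I) (c : I -> R) (t : I -> V) :
  dl (\sum_(i <- r | P i) c i *: t i) = \sum_(i <- r | P i) f (c i) *: dl (t i).
Proof.
elim: r => [|i r IHr]; first by rewrite !big_nil boundary0.
by rewrite !big_cons; case: ifP => // _; rewrite dlP IHr.
Qed.

(** Because B is regular on W, the map e can be [dl] divided by B, so the last term is G itself and
    not its multiple. *)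
Lemma boundary_ses : exists (i : {linear submod N0 -> submod N1})
  (e : {linear submod N1 -> restr f (submod G)}), ses i e.
Proof.
have iP (x : submod N0) : incl N0 x \in N1 by have /ker_dl[] := submod_valP x.
have ex (x : submod N1) : exists u : submod G, dl (submod_val x) = B *: submod_val u.
  by have [u uG uE] := dl_contained (submod_valP x); exists (Submod uG).
have Binj (x y : submod G) : B *: submod_val x = B *: submod_val y -> x = y.
  by move=> xy; apply/submod_inj/subr0_eq/Breg; rewrite scalerBr xy subrr.
have [e eE] := choice ex.
have el : linear (e : submod N1 -> restr f (submod G)).
  move=> c x y; apply: Binj; rewrite -eE restr_scaleE.
  rewrite submod_valD submod_valZ dlP (submod_valD (f c *: e x)) submod_valZ scalerDr.
  by rewrite !eE !scalerA mulrC.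
exists (corestrict iP), (lin_of el); split.
- by move=> x y /(congr1 (@submod_val _ _ _)) xy; apply: submod_inj; exact: xy.
- move=> u; have [t tN tE] := dl_surj (submod_valP u).
  by exists (Submod tN); apply: Binj; rewrite -[LHS]eE.
move=> x; split=> [x0|[y <-]].
  have e0 : e x = 0 := x0.
  have xN0 : submod_val x \in N0.
    by apply/ker_dl; split; [exact: submod_valP | rewrite eE e0 scaler0].
  by exists (Submod xN0); apply: submod_inj.
apply: Binj; have /ker_dl[_ y0] := submod_valP y.
by rewrite -[LHS]eE -[LHS]/(dl (submod_val y)) y0 scaler0.
Qed.

(** The images of generators of N1 generate over R', and they are pruned there. Lifting coefficients
    by s, an element of N1 differs from a combination of the retained generators by an element
    killed by [dl]. *)
Lemma boundary_generators (s : R' -> R) : cancel s f -> noetherian (submod N1) ->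
  exists (n : nat) (phi : 'I_n -> V),
    [/\ forall i, phi i \in N1,
        minimal_generators (fun psi => exists2 eta, eta \in G & psi = B *: eta)
          (fun i => dl (phi i))
      & forall theta, theta \in N1 <->
          exists2 delta, delta \in N0 &
          exists c : 'I_n -> R, theta = delta + \sum_(i < n) c i *: phi i].
Proof.
move=> sK /noetherian_fg[n [b bE]].
have gen : generates (fun psi => exists2 eta, eta \in G & psi = B *: eta)
    (fun i => dl (submod_val (b i))) [set: 'I_n].
  move=> psi; split=> [[u uG ->]|[c ->]].
    have [t tN <-] := dl_surj uG; have [c cE] := bE (Submod tN).
    exists (f \o c); rewrite -boundary_sum; congr (dl _).
    have := congr1 (incl N1) cE; rewrite linear_sum.
    by under eq_bigr do rewrite linearZ.
  have -> : \sum_(i in [set: 'I_n]) c i *: dl (submod_val (b i)) =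
      dl (\sum_(i in [set: 'I_n]) s (c i) *: submod_val (b i)).
    by rewrite boundary_sum; apply: eq_bigr => i _; rewrite sK.
  have [|u uG uE] := dl_contained (t := \sum_(i in [set: 'I_n])
      s (c i) *: submod_val (b i)); last by exists u.
  by apply: rpred_sum => i _; apply: rpredZ; exact: submod_valP.
have [m [h hmin]] := irredundant_generators gen.
pose phi i := submod_val (b (h i)).
have phiN i : phi i \in N1 by exact: submod_valP.
exists m, phi; split=> // theta; split=> [tN|[delta dN [c ->]]]; last first.
  apply: rpredD; first by have /ker_dl[] := dN.
  by apply: rpred_sum => i _; exact: rpredZ.
have /hmin.1[c cE] : exists2 eta, eta \in G & dl theta = B *: eta.
  by have [u uG uE] := dl_contained tN; exists u.
exists (theta - \sum_(i < m) s (c i) *: phi i).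
  apply/ker_dl; split.
    rewrite -scaleN1r; apply: rpredD => //; apply: rpredZ.
    by apply: rpred_sum => i _; exact: rpredZ.
  rewrite boundaryB cE boundary_sum; apply/eqP; rewrite subr_eq0; apply/eqP.
  by apply: eq_big => i; rewrite ?inE // => _; rewrite sK.
by exists (fun i => s (c i)); rewrite subrK.
Qed.

End BoundaryMap.

Theorem theorem1p10 (K : fieldType) (l : nat)
    (A : {fset {vspace 'rV[K]_l}}) (hA : arrangement A)
    (alpha : {vspace 'rV[K]_l} -> linform K l)
    (halpha : forall L, L \in A -> defining_form L (alpha L))
    (p : nat) (hp : (p <= l)%N)
    (H : {vspace 'rV[K]_l}) (hH : H \in A)
    (beta : {vspace 'rV[K]_l} -> Sbar (alpha H))
    (hbeta : forall X, X \in restriction A H -> defining_form_in H X (beta X)) :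
  let D_A := D p (forms (fun L => (alpha L : {mpoly K[l]})) A) in
  let D_A' := D p (forms (fun L => (alpha L : {mpoly K[l]})) (A `\ H)%fset) in
  let D_AH := Dprev p (forms beta (restriction A H)) in
  free_module (submod D_A) ->
  (~ free_module (submod D_A') ->
     (exists (s : nat) (phi : 'I_s -> ('I_p -> {mpoly K[l]}) -> {mpoly K[l]}^o),
        [/\ forall i, phi i \in D_A',
            minimal_generators
              (fun psi => exists2 eta, eta \in D_AH & psi = Bbar beta A *: eta)
              (fun i => dbar (alpha H) (phi i))
          & forall theta, theta \in D_A' <->
              exists2 delta, delta \in D_A &
              exists c : 'I_s -> {mpoly K[l]},
                theta = delta + \sum_(i < s) c i *: phi i])
     /\ pd (submod D_A') = omap succn (pd (submod D_AH)))
  /\ (free_module (submod D_AH) ->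
        exists2 n, pd (submod D_A') = Some n & (n <= 1)%N).
Proof.
move=> D_A D_A' D_AH freeA.
have [w aw] := dual_exists hA halpha hH.
have areg (x : {mpoly K[l]}) : x * (alpha H : {mpoly K[l]}) = 0 -> x = 0.
  by move=> /mpoly_integral[//|/(alpha_neq0 hA halpha hH)].
have contained t : t \in D_A' -> exists2 u, u \in D_AH & dbar (alpha H) t = Bbar beta A *: u.
  (* For p = 0 both the boundary map and D^(-1) are zero. *)
  case: p @D_A @D_A' @D_AH freeA t {hp} => [|q] D_A D_A' D_AH freeA t.
    by move=> _; exists 0; [exact: rpred0 | rewrite scaler0].
  move=> /is_logderP tA; have [u uA uE] := dbar_contained hA halpha hH hbeta tA.
  by exists u => //; apply/is_logderP.
have onto u : u \in D_AH -> exists2 t, t \in D_A' & dbar (alpha H) t = Bbar beta A *: u.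
  case: p @D_A @D_A' @D_AH freeA u {hp contained} => [|q] D_A D_A' D_AH freeA u.
    by move=> /eqP->; exists 0; [exact: rpred0 | rewrite scaler0].
  by move=> /is_logderP; exact: (dbar_surjective hA halpha hH hbeta).
have Breg (u : ('I_p.-1 -> Sbar (alpha H)) -> (Sbar (alpha H))^o) :
    Bbar beta A *: u = 0 -> u = 0.
  move=> Bu; apply/funext => g; apply: (Bbar_reg hA halpha hH hbeta).
  by have := congr1 (fun F => F g) Bu.
have kerE := @logder_boundary K l A alpha H hH p.
have [i [e iex]] := boundary_ses (N0 := D_A) (N1 := D_A') (G := D_AH)
  (@dbarP K l alpha H p) kerE contained onto Breg.
have pF := free_module_projective freeA.
have pdE n : pdle n.+1 (submod D_A') <-> pdle n (submod D_AH).
  rewrite (pdle_middle n pF iex); split.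
    exact: (@restr_pdle {mpoly K[l]} (Sbar (alpha H)) (proj (alpha H)) (sec aw)
      (alpha H) (secK aw) (@proj_eq0 K l (alpha H)) areg).
  exact: (@pdle_restr {mpoly K[l]} (Sbar (alpha H)) (proj (alpha H)) (sec aw)
    (alpha H) (secK aw) (@proj_eq0 K l (alpha H)) areg).
split=> [nfree|freeAH].
  split.
    have noeth : noetherian (submod D_A') := @logder_noetherian K l _ _ _ p.
    have gens := boundary_generators (N0 := D_A) (N1 := D_A') (G := D_AH)
      (@dbarP K l alpha H p) kerE contained onto.
    by apply: (gens (sec aw)) noeth => x; exact: secK.
  apply: pd_shift pdE => pA'; apply: nfree.
  exact: logder_projective_free pA'.
(* D^p(A') may be free here, so only the bound given by [pdE] at n = 0 is read off. *)
by apply: pd_le; apply/pdE; exact: free_module_projective.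
Qed.
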